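(* Let $X$ be an Asplund space, let $A,B\subset X$ be closed, and let $\bar x\in A\cap B$. Suppose that there exist numbers $\alpha\in\,]0,1[$ and $\delta>0$ such that, for all $a\in(A\setminus B)\cap\mathbb B_\delta(\bar x)$, $b\in(B\setminus A)\cap\mathbb B_\delta(\bar x)$ and $x\in\mathbb B_\delta(\bar x)$ with $\|x-a\|=\|x-b\|$, there exists an $\varepsilon>0$ such that $\|x_1^*+x_2^*\|>\alpha$ for all $a'\in A\cap\mathbb B_\varepsilon(a)$, $b'\in B\cap\mathbb B_\varepsilon(b)$, $x_1'\in\mathbb B_\varepsilon(a)$, $x_2'\in\mathbb B_\varepsilon(b)$, $x'\in\mathbb B_\varepsilon(x)$ and $x_1^*,x_2^*\in X^*$ satisfying $$\|x'-x_1'\|=\|x'-x_2'\|,$$ $$\|x_1^*\|+\|x_2^*\|=1,\quad \langle x_1^*,x'-x_1'\rangle=\|x_1^*\|\,\|x'-x_1'\|,\quad \langle x_2^*,x'-x_2'\rangle=\|x_2^*\|\,\|x'-x_2'\|,$$ $$d(x_1^*,N_A(a'))<\delta,\quad d(x_2^*,N_B(b'))<\delta.$$ Then $\{A,B\}$ is subtransversal at $\bar x$. Moreover, ${\rm str}[A,B](\bar x)\ge\alpha$.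
   Context: $X^*$ is the topological dual of the (real) normed space $X$, with the dual norm, and $\langle\cdot,\cdot\rangle$ is the duality pairing. $\mathbb B_\delta(x)$ denotes the open ball with centre $x$ and radius $\delta$. $d(\cdot,S)$ is the distance to a set $S$ (in the norm of the ambient space). An Asplund space is a Banach space in which every continuous convex function on an open convex set is Fréchet differentiable on a dense subset of it; equivalently, the dual of each of its separable subspaces is separable. Fréchet normal cone to $A$ at $a_0\in A$: $$N_A(a_0):=\Big\{x^*\in X^*\;\Big|\;\limsup_{a\to a_0,\,a\in A\setminus\{a_0\}}\frac{\langle x^*,a-a_0\rangle}{\|a-a_0\|}\le0\Big\}$$ (the condition being vacuous if $a_0$ is an isolated point of $A$). Subtransversality: for $\bar x\in A\cap B$, the pair $\{A,B\}$ is subtransversal at $\bar x$ if there exist $\alpha\in\,]0,1[$ and $\delta>0$ such that $$\alpha\, d(x,A\cap B)\le\max\{d(x,A),d(x,B)\}\quad\text{for all }x\in\mathbb B_\delta(\bar x).$$ ${\rm str}[A,B](\bar x)$ denotes the supremum of all $\alpha\in\,]0,1[$ for which this condition is satisfied for some $\delta>0$, with the convention that the supremum of the empty set is $0$. *)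

(* Defs.v *)
From HB Require Import structures.
From mathcomp Require Import all_boot all_order all_algebra.
From mathcomp Require Import all_classical all_reals all_analysis.

Set Implicit Arguments.
Unset Strict Implicit.
Unset Printing Implicit Defensive.

Import Order.TTheory GRing.Theory Num.Theory.
Import numFieldNormedType.Exports.

Local Open Scope classical_set_scope.
Local Open Scope ring_scope.

Section Dual.
Context {R : realType} {X : normedModType R}.

Definition linear_continuous_pred : {pred X -> R^o} :=
  fun f => `[< linear f /\ continuous f >].

Lemma linear_continuous_submod_closed : submod_closed linear_continuous_pred.
Proof.
split.
  apply/asboolP; split; last by move=> x; exact: cvg_cst.
  by move=> k u v /=; rewrite scaler0 addr0.
move=> k f g /asboolP[lf cf] /asboolP[lg cg]; apply/asboolP; split.
  move=> l u v; rewrite !fctE lf lg !scalerDr !scalerA [k * l]mulrC.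
  by rewrite addrACA.
move=> x; apply: (@continuousD R R^o X (k *: f) g x); last exact: cg.
exact: (@continuousZl_tmp R R^o X f k x (cf x)).
Qed.

HB.instance Definition _ := GRing.isSubmodClosed.Build R (X -> R^o)
  linear_continuous_pred linear_continuous_submod_closed.

End Dual.

Record dual (R : realType) (X : normedModType R) := Dual {
  dual_fun :> X -> R^o;
  dual_funP : dual_fun \in linear_continuous_pred }.

Section DualNorm.
Context {R : realType} {X : normedModType R}.
Implicit Types f g : dual X.

HB.instance Definition _ := [isSub for @dual_fun R X].
HB.instance Definition _ := [Choice of dual X by <:].
HB.instance Definition _ := [SubChoice_isSubLmodule of dual X by <:].

Lemma dual_linear f : linear (f : X -> R^o).
Proof. by have /asboolP[] := dual_funP f. Qed.

HB.instance Definition _ f :=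
  GRing.isLinear.Build R X R^o _ (dual_fun f) (dual_linear f).

Lemma dual_continuous f : continuous (f : X -> R^o).
Proof. by have /asboolP[] := dual_funP f. Qed.

Definition dual_norm f : R := sup [set `|f x| | x in [set x : X | `|x| <= 1]].

Lemma dual_norm_has_sup f :
  has_sup [set `|f x| | x in [set x : X | `|x| <= 1]].
Proof.
split; first by exists `|f 0|; exists 0 => //=; rewrite normr0.
have /linear_bounded_continuous/bounded_funP/(_ 1)[M fM] := @dual_continuous f.
by exists M => _ [x /= x1 <-]; exact: fM.
Qed.

Lemma dual_norm_ub f (x : X) : `|x| <= 1 -> `|f x| <= dual_norm f.
Proof.
by move=> x1; apply: ub_le_sup; [case: (dual_norm_has_sup f)|exists x].
Qed.

Lemma dual_norm_ge0 f : 0 <= dual_norm f.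
Proof. by apply: le_trans (@dual_norm_ub f 0 _); rewrite ?normr0. Qed.

Lemma dual_norm_le f (M : R) :
  (forall x : X, `|x| <= 1 -> `|f x| <= M) -> dual_norm f <= M.
Proof.
move=> fM; apply: ge_sup; first by case: (dual_norm_has_sup f).
by move=> _ [x /= x1 <-]; exact: fM.
Qed.

Lemma dual_normD f g : dual_norm (f + g) <= dual_norm f + dual_norm g.
Proof.
apply: dual_norm_le => x x1; apply: (le_trans (ler_normD (f x) (g x))).
by apply: lerD; exact: dual_norm_ub.
Qed.

Lemma dual_normZ (k : R) f : dual_norm (k *: f) = `|k| * dual_norm f.
Proof.
have le_normZ (l : R) h : dual_norm (l *: h) <= `|l| * dual_norm h.
  apply: dual_norm_le => x x1; rewrite [leLHS](normrM l (h x)).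
  by rewrite ler_wpM2l// dual_norm_ub.
apply/eqP; rewrite eq_le le_normZ/=.
have [->|k0] := eqVneq k 0; first by rewrite normr0 mul0r dual_norm_ge0.
rewrite -ler_pdivlMl ?normr_gt0// -normfV.
by apply: le_trans (le_normZ _ _); rewrite scalerA mulVf// scale1r.
Qed.

Lemma dual_norm0_eq0 f : dual_norm f = 0 -> f = 0.
Proof.
move=> f0; apply/val_inj/funext => x /=.
have [->|x0] := eqVneq x 0; first by rewrite linear0.
have nx0 : 0 < `|x| by rewrite normr_gt0.
have : `|f (`|x|^-1 *: x)| <= 0.
  by rewrite -f0 dual_norm_ub// normrZ normfV normr_id mulVf ?gt_eqF.
rewrite linearZ normr_le0 scaler_eq0 invr_eq0 gt_eqF//=.
by move/eqP.
Qed.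

HB.instance Definition _ := Lmodule_isNormed.Build R (dual X)
  dual_normD dual_normZ dual_norm0_eq0.

End DualNorm.

(* As D is open, continuity and (Fréchet) differentiability of f at points of D
   do not depend on the values of f outside D. *)
Definition asplund (R : realType) (X : completeNormedModType R) :=
  forall (D : set X) (f : X -> R^o),
    open D -> convex_set D -> {in D, continuous f} -> convex_function D f ->
    D `<=` closure (D `&` [set x | differentiable f x]).

Section VariationalAnalysis.
Context {R : realType} {X : normedModType R}.
Implicit Types A B : set X.

(* If a0 is isolated in A, the filter is improper and the upper limit is -oo,
   so that every functional belongs to the cone. *)
Definition frechet_normal_cone A (a0 : X) : set (dual X) :=
  [set xs : dual X |
    (limf_esup (fun a : X => (xs (a - a0) / `|a - a0|)%:E)
       (within (A `\ a0) (nbhs a0)) <= 0)%E].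

Definition subtransversal_rate A B (xbar : X) (alpha delta : R) :=
  forall x, ball xbar delta x ->
    (alpha%:E * edist_inf (A `&` B) x <= maxe (edist_inf A x) (edist_inf B x))%E.

Definition subtransversal A B (xbar : X) :=
  exists alpha delta : R, [/\ 0 < alpha < 1, 0 < delta &
    subtransversal_rate A B xbar alpha delta].

(* The set is bounded by 1, and sup set0 = 0. *)
Definition str A B (xbar : X) : R :=
  sup [set alpha : R | 0 < alpha < 1 /\
    exists2 delta : R, 0 < delta & subtransversal_rate A B xbar alpha delta].

End VariationalAnalysis.

(* Main.v *)
Require Import Defs.
From mathcomp Require Import all_boot all_order all_algebra.
From mathcomp Require Import all_classical all_reals all_analysis.
From mathcomp Require Import ring lra.
Import Order.TTheory GRing.Theory Num.Theory.
Import numFieldNormedType.Exports.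
Local Open Scope classical_set_scope.
Local Open Scope ring_scope.

(** Suppose that [alpha' d(x0, A cap B) > max (d(x0, A), d(x0, B))] at points
[x0] arbitrarily close to [xbar], for some [alpha' < alpha].  Ekeland's
principle for [(a, b, x) |-> max (|x - a|, |x - b|)] on [A * B * X] yields a
point [(a, b, x)] near [(xbar, xbar, xbar)] minimizing
[max (|x' - a'|, |x' - b'|) + beta |x' - x| + kap (|a' - a| + |b' - b|)],
where [alpha' < beta < alpha] and [kap] is as small as desired.  Because
[beta < 1] and [kap] is small, this forces [a] off [B], [b] off [A] and
[|x - a| = |x - b| > 0] ([equidistant_pair]).  Writing the optimality of the
minimum of a convex function on [A * B * X] in terms of subgradients and Frechet
normals (a fuzzy sum rule, [fuzzy_normals]) produces functionals that norm
[x' - x1'] and [x' - x2'], have norms adding up to [1], are close to Frechet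
normals, and whose sum has norm at most [alpha]: this is what the hypothesis of
the theorem excludes.

The fuzzy sum rule is where the Asplund property enters.  Its conclusion, that
suitable functionals exist at given nearby points, is by a Hahn-Banach argument
([mazur_orlicz]) equivalent to the nonnegativity of a quantity ([gap]) over all
finite systems of points of [A], [B] and [X].  Each violation involves finitely
many points and persists under small perturbations, so a closed separable
subspace [Y] can be built such that any violation at points of [Y] is witnessed
inside [Y] ([gap_reflection]).  It remains to find, near the Ekeland point,
points of [Y] without violation inside [Y].

In an Asplund space the functionals restricted to the separable subspace [Y]
form a norm separable set ([dual_separable]): support functions of bounded sets
of functionals are convex, hence have points of Frechet differentiability, and
there they cut out slices of small diameter ([small_slice]); a minimal
weak-star closed set over a set of restrictions that is nowhere covered by
countably many small balls has no such slice.  From a sequence [c n] that is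
dense in the dual ball for the seminorm of uniform convergence on the ball of
[Y] one gets, by subtracting in the supremum that defines the norm a small
strictly convex penalty built from the distances to the [c n], functions that
are uniformly close to the norm and Frechet differentiable along [Y] at every
point ([smooth_norm]).  With these
as perturbations, a Borwein-Preiss type principle ([variational]) gives an exact
minimum of the Ekeland function with decoupled variables, smoothly coupled, and
differentiating the smooth terms there shows that [gap] is nonnegative on [Y]
([gap_in_subspace]). *)

Set Implicit Arguments.
Unset Strict Implicit.
Unset Printing Implicit Defensive.

(** * Sublinear functionals and the Mazur-Orlicz theorem *)
Section HahnBanach.
Context {R : realType} {V : lmodType R}.
Implicit Types p q : V -> R.

Definition sublinear p :=
  (forall u v, p (u + v) <= p u + p v) /\
  (forall (t : R) u, 0 <= t -> p (t *: u) = t * p u).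

Lemma sublinear0 p : sublinear p -> p 0 = 0.
Proof. by case=> _ /(_ 0 0 (lexx 0)); rewrite scale0r mul0r. Qed.

Lemma sublinear_lb p q : sublinear q -> (forall v, q v <= p v) ->
  forall v, - p (- v) <= q v.
Proof.
move=> sq qp v; have := sq.1 v (- v); rewrite subrr (sublinear0 sq).
by have := qp (- v); lra.
Qed.

(** Convex cones of pairs [(w, c)], each pair read as the constraint that a
functional take at [w] a value at least [c]. *)
Definition convex_cone (C : set (V * R)) :=
  [/\ C (0, 0),
      forall x y, C x -> C y -> C (x.1 + y.1, x.2 + y.2) &
      forall t x, 0 < t -> C x -> C (t *: x.1, t * x.2)].

(** The largest sublinear functional below [p] that dominates only those linear
forms that satisfy all the constraints of [C]. *)
Definition cone_inf p (C : set (V * R)) (v : V) :=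
  inf [set p (v + x.1) - x.2 | x in C].

Lemma cone_inf_le p C v x : sublinear p -> convex_cone C ->
  (forall x, C x -> x.2 <= p x.1) ->
  C x -> cone_inf p C v <= p (v + x.1) - x.2.
Proof.
move=> sp cC Cp Cx; apply: ge_inf; last by exists x.
exists (- p (- v)) => _ [y Cy <-]; have := Cp _ Cy.
have := sp.1 (- v) (v + y.1); rewrite addKr; lra.
Qed.

Lemma cone_inf_ge p C v r : convex_cone C ->
  (forall x, C x -> r <= p (v + x.1) - x.2) -> r <= cone_inf p C v.
Proof.
move=> [C0 _ _] H; apply: lb_le_inf; first by exists (p (v + 0) - 0), (0, 0).
by move=> _ [x Cx <-]; exact: H.
Qed.

Lemma cone_inf_sublinear p C : sublinear p -> convex_cone C ->
  (forall x, C x -> x.2 <= p x.1) -> sublinear (cone_inf p C).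
Proof.
move=> sp cC Cp; have [C0 CD CZ] := cC.
have lei := @cone_inf_le p C _ _ sp cC Cp.
have scale_le t u : 0 < t -> cone_inf p C (t *: u) <= t * cone_inf p C u.
  move=> t0; rewrite -ler_pdivrMl //; apply: cone_inf_ge => // x Cx.
  rewrite ler_pdivrMl //; apply: (le_trans (lei _ _ (CZ _ _ t0 Cx))) => /=.
  by rewrite -scalerDr (sp.2 _ _ (ltW t0)) mulrBr lexx.
split=> [u v|t u].
  rewrite -lerBlDr; apply: cone_inf_ge => // x Cx.
  rewrite lerBlDr -lerBlDl; apply: cone_inf_ge => // y Cy.
  have := lei (u + v) _ (CD _ _ Cx Cy) => /=.
  have := sp.1 (u + x.1) (v + y.1); rewrite addrACA; lra.
rewrite le_eqVlt => /orP[/eqP <-|t0].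
  rewrite scale0r mul0r; apply/eqP; rewrite eq_le; apply/andP; split.
    by have := lei 0 _ C0; rewrite /= addr0 (sublinear0 sp) subr0.
  by apply: cone_inf_ge => // x Cx; rewrite add0r subr_ge0 Cp.
apply/eqP; rewrite eq_le scale_le //=.
have := scale_le t^-1 (t *: u); rewrite invr_gt0 scalerA mulVf ?gt_eqF //.
by rewrite scale1r => /(_ t0); rewrite ler_pdivlMl.
Qed.

(** Zorn's lemma gives a minimal sublinear [q] below [p].  For each [v], the
infimum over [t >= 0] of [q (u + t v) - t q v] is again sublinear and below [q],
hence equal to [q]; this makes [q] additive. *)
Lemma sublinear_minorant p : sublinear p ->
  exists2 l : V -> R, (forall v, l v <= p v) & linear (l : V -> R^o).
Proof.
move=> sp; pose T := {q : V -> R | sublinear q /\ forall v, q v <= p v}.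
pose r (q q' : T) := `[< forall v, sval q' v <= sval q v >].
have [||||[q [sq qp]] qmin] := @Zorn T r.
- by move=> t; apply/asboolP => v.
- move=> a b c /asboolP ab /asboolP bc; apply/asboolP => v.
  exact: le_trans (bc v) (ab v).
- move=> [a Ha] [b Hb] /asboolP /= ab /asboolP /= ba; apply: eq_exist.
  by apply/funext => v; apply/eqP; rewrite eq_le ab ba.
- move=> A totA; have [[q0 Aq0]|A0] := pselect (exists q : T, A q); last first.
    exists (exist _ p (conj sp (fun v => lexx (p v)))) => s As; exfalso.
    by apply: A0; exists s.
  pose g v := inf [set sval q v | q in A].
  have gle (q : T) v : A q -> g v <= sval q v.
    move=> Aq; apply: ge_inf; last by exists q.
    exists (- p (- v)) => _ [[q' [sq' qp']] _ <-] /=; exact: sublinear_lb.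
  have gge c v : (forall q : T, A q -> c <= sval q v) -> c <= g v.
    move=> H; apply: lb_le_inf; first by exists (sval q0 v), q0.
    by move=> _ [q Aq <-]; exact: H.
  have sg : sublinear g.
    split=> [u v|t u].
      rewrite -lerBlDr; apply: (gge) => q Aq.
      rewrite lerBlDr -lerBlDl; apply: (gge) => q' Aq'.
      have [/asboolP|/asboolP] := totA _ _ Aq Aq'.
        move=> /(_ u); have := gle _ (u + v) Aq'.
        by have := (svalP q').1.1 u v; lra.
      move=> /(_ v); have := gle _ (u + v) Aq.
      by have := (svalP q).1.1 u v; lra.
    rewrite le_eqVlt => /orP[/eqP <-|t0].
      rewrite scale0r mul0r; apply/eqP; rewrite eq_le; apply/andP; split.
        by have := gle _ 0 Aq0; rewrite (sublinear0 (svalP q0).1).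
      by apply: (gge) => q Aq; rewrite (sublinear0 (svalP q).1).
    apply/eqP; rewrite eq_le; apply/andP; split.
      rewrite -ler_pdivrMl //; apply: (gge) => q Aq; rewrite ler_pdivrMl //.
      by rewrite -((svalP q).1.2 _ _ (ltW t0)); apply: (gle).
    apply: (gge) => q Aq; rewrite ((svalP q).1.2 _ _ (ltW t0)).
    by apply: ler_wpM2l; [exact: ltW | apply: (gle)].
  have gp v : g v <= p v by apply: le_trans (gle _ v Aq0) ((svalP q0).2 v).
  by exists (exist _ g (conj sg gp)) => q Aq; apply/asboolP => v /=; apply: (gle).
have q_le u v : q u <= q (u + v) - q v.
  pose C : set (V * R) := [set x | exists2 t, 0 <= t & x = (t *: v, t * q v)].
  have cC : convex_cone C.
    split; first by exists 0 => //; rewrite scale0r mul0r.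
      move=> _ _ [s s0 ->] [t t0 ->] /=; exists (s + t); first exact: addr_ge0.
      by rewrite scalerDl mulrDl.
    move=> t _ t0 [s s0 ->]; exists (t * s); first by rewrite mulr_ge0 // ltW.
    by rewrite scalerA mulrA.
  have Cq x : C x -> x.2 <= q x.1 by move=> [t t0 ->] /=; rewrite sq.2.
  have lei w x := @cone_inf_le q C w x sq cC Cq.
  have sq' := cone_inf_sublinear sq cC Cq.
  have q'q w : cone_inf q C w <= q w.
    have := lei w (0, 0); rewrite /= addr0 subr0; apply.
    by exists 0 => //; rewrite scale0r mul0r.
  have q'p w : cone_inf q C w <= p w := le_trans (q'q w) (qp w).
  have /(congr1 sval) /= E :
      exist _ _ (conj sq' q'p) = exist _ q (conj sq qp) :> T.
    by apply: qmin; apply/asboolP => w /=; apply: (q'q).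
  have := lei u (v, q v); rewrite /= E; apply.
  by exists 1 => //; rewrite scale1r mul1r.
have qD u v : q (u + v) = q u + q v.
  by apply/eqP; rewrite eq_le sq.1 /=; have := q_le u v; lra.
have qN u : q (- u) = - q u.
  by apply/eqP; rewrite -addr_eq0 addrC -qD subrr (sublinear0 sq).
exists q => // t u v; rewrite qD; congr (_ + _).
have [t0|t0] := leP 0 t; first by rewrite sq.2.
rewrite -[t]opprK scaleNr qN sq.2 ?oppr_ge0 ?ltW //.
by rewrite [RHS]mulNr.
Qed.

(** A linear form below [cone_inf p C] is below [p], and at [- w] it is at most
[p 0 - c] for each [(w, c)] in [C]. *)
Lemma mazur_orlicz p (C : set (V * R)) : sublinear p -> convex_cone C ->
  (forall x, C x -> x.2 <= p x.1) ->
  exists l : V -> R, [/\ linear (l : V -> R^o), forall v, l v <= p v &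
    forall x, C x -> x.2 <= l x.1].
Proof.
move=> sp cC Cp; have sq := cone_inf_sublinear sp cC Cp.
have [l lq ll] := sublinear_minorant sq.
have lei w x := @cone_inf_le p C w x sp cC Cp.
exists l; split=> [//|v|x Cx].
  apply: (le_trans (lq v)); have := lei v (0, 0); rewrite /= addr0 subr0.
  by apply; case: cC.
have lN : l (- x.1) = - l x.1.
  have l0 : l 0 = 0.
    by have := ll (-1) 0 0; rewrite !scaleN1r oppr0 addr0 addNr.
  by have := ll (-1) x.1 0; rewrite !addr0 !scaleN1r l0 addr0.
have := le_trans (lq (- x.1)) (lei (- x.1) x Cx).
by rewrite addNr (sublinear0 sp) lN; lra.
Qed.

End HahnBanach.

(** * Functionals of norm at most one and weak-star compactness *)
Lemma ultra_compact_cvg {T : Type} {U : topologicalType} (F : set_system T)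
    (h : T -> U) (K : set U) : UltraFilter F -> compact K -> F (h @^-1` K) ->
  exists2 p, K p & h @ F --> p.
Proof.
move=> UF cK FK; have [p [Kp clp]] := cK (h @ F) _ FK.
exists p => // V Vp; have [//|FV] := in_ultra_setVsetC (h @^-1` V) UF.
have [y [VCy Vy]] := clp (~` V) V FV Vp.
by have := VCy Vy.
Qed.

Section DualBall.
Context {R : realType} {X : normedModType R}.
Implicit Types (f g : dual X) (x y : X).

Lemma dualD f x y : f (x + y) = f x + f y.
Proof. exact: (linearD (f : {linear X -> R^o})). Qed.
Lemma dualZ f (t : R) x : f (t *: x) = t * f x.
Proof. exact: (linearZ_LR (f : {linear X -> R^o})). Qed.
Lemma dualN f x : f (- x) = - f x.
Proof. exact: (linearN (f : {linear X -> R^o})). Qed.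
Lemma dual0 f : f 0 = 0.
Proof. exact: (linear0 (f : {linear X -> R^o})). Qed.
Lemma dual_of_bounded (l : X -> R) (M : R) : linear (l : X -> R^o) ->
  (forall x, l x <= M * `|x|) -> exists f, forall x, f x = l x.
Proof.
move=> ll lM; have lB x y : l (x - y) = l x - l y.
  by have := ll (-1) y x; rewrite !scaleN1r [in l _]addrC [RHS]addrC.
have lN x : l (- x) = - l x.
  by rewrite -[- x]sub0r lB -(subrr x) lB subrr sub0r.
have nl x : `|l x| <= M * `|x|.
  by rewrite ler_norml lM andbT lerNl -lN (le_trans (lM _)) // normrN.
have cl : continuous (l : X -> R^o).
  move=> x; apply/cvgrPdist_lt => e e0.
  have e1 : 0 < e / (`|M| + 1) by rewrite divr_gt0 // ltr_wpDl.
  near=> y; rewrite -lB (le_lt_trans (nl _)) //.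
  apply: (@le_lt_trans _ _ ((`|M| + 1) * `|x - y|)).
    by rewrite ler_wpM2r // ler_wpDr // ler_norm.
  rewrite -ltr_pdivlMl ?ltr_wpDl // mulrC; near: y.
  by apply: cvgr_dist_lt => //; exact: cvg_id.
have lP : (l : X -> R^o) \in linear_continuous_pred by apply/asboolP.
by exists (Dual lP).
Unshelve. all: by end_near. Qed.

Lemma dual_norm_bound f x : `|f x| <= `|f| * `|x|.
Proof.
have [->|x0] := eqVneq x 0; first by rewrite dual0 !normr0 mulr0.
have nx0 : 0 < `|x| by rewrite normr_gt0.
have : `|f (`|x|^-1 *: x)| <= `|f|.
  by apply: dual_norm_ub; rewrite normrZ normfV normr_id mulVf ?gt_eqF.
by rewrite dualZ normrM normfV normr_id mulrC ler_pdivrMr.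
Qed.

Lemma dual_norm_leM f (M : R) :
  0 <= M -> (forall x, f x <= M * `|x|) -> `|f| <= M.
Proof.
move=> M0 fM; apply: dual_norm_le => x x1.
apply: (@le_trans _ _ (M * `|x|)); last by rewrite ler_piMr.
by rewrite ler_norml fM andbT lerNl -dualN (le_trans (fM _)) // normrN.
Qed.

(** The closed unit ball of the dual, in the pointwise form in which limits along
ultrafilters are computed. *)
Definition dual_ball : set (dual X) := [set f | forall x, `|f x| <= `|x|].

Lemma norming_functional x : exists2 f, dual_ball f & f x = `|x|.
Proof.
have sp : @sublinear R X (fun v => `|v|).
  by split=> [u v|t u t0]; rewrite ?ler_normD // normrZ ger0_norm.
pose C : set (X * R) := [set w | exists2 t, 0 <= t & w = (t *: x, t * `|x|)].
have cC : convex_cone C.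
  split; first by exists 0 => //; rewrite scale0r mul0r.
    move=> _ _ [s s0 ->] [t t0 ->] /=; exists (s + t); first exact: addr_ge0.
    by rewrite scalerDl mulrDl.
  move=> t _ t0 [s s0 ->]; exists (t * s); first by rewrite mulr_ge0 // ltW.
  by rewrite scalerA mulrA.
have Cp w : C w -> w.2 <= `|w.1|.
  by move=> [t t0 ->] /=; rewrite normrZ ger0_norm.
have [l [ll lp lC]] := mazur_orlicz sp cC Cp.
have [f fl] : exists f, forall x, f x = l x.
  by apply: (@dual_of_bounded l 1) => // y; rewrite mul1r.
have fb : dual_ball f.
  move=> y; rewrite ler_norml fl lp andbT lerNl -fl -dualN fl.
  by rewrite (le_trans (lp _)) // normrN.
exists f => //; apply/eqP; rewrite eq_le fl lp /=.
by apply: (lC (x, `|x|)); exists 1 => //; rewrite scale1r mul1r.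
Qed.

(** Weak-star convergence along a filter. *)
Definition wcvg (F : set_system (dual X)) f :=
  forall x, g x @[g --> F] --> (f x : R^o).

(** Banach-Alaoglu: along an ultrafilter each value [g x] converges by
compactness of a segment, and the pointwise limit is linear. *)
Lemma dual_ball_compact (F : set_system (dual X)) : UltraFilter F ->
  F dual_ball -> exists2 f, dual_ball f & wcvg F f.
Proof.
move=> UF FB.
have lim_ex x : exists r : R^o, g x @[g --> F] --> r.
  have [r _ rP] : exists2 r : R^o, `[- `|x|, `|x|]%classic r &
      (g x : R^o) @[g --> F] --> r.
    apply: (ultra_compact_cvg UF); first exact: segment_compact.
    by apply: filterS FB => g /(_ x); rewrite /= in_itv /= ler_norml.
  by exists r.
pose l x : R := sval (cid (lim_ex x)).
have lP x : g x @[g --> F] --> (l x : R^o) := svalP (cid (lim_ex x)).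
have ll : linear (l : X -> R^o).
  move=> t u v.
  have luv : (fun g : dual X => t * g u : R^o) + (fun g : dual X => g v : R^o)
      @ F --> (l (t *: u + v) : R^o).
    apply: cvg_trans (lP _); apply: near_eq_cvg; apply: nearW => g.
    by rewrite dualD dualZ.
  have ltuv : (fun g : dual X => t * g u : R^o) + (fun g : dual X => g v : R^o)
      @ F --> (t * l u + l v : R^o).
    apply: cvgD; last exact: lP.
    by apply: cvgMl_tmp; exact: lP.
  exact: (norm_cvg_unique luv ltuv).
have lb x : `|l x| <= `|x|.
  have : `|(g x : R^o)| @[g --> F] --> `|l x| by apply: cvg_norm; exact: lP.
  move/cvgr_to_le; apply; apply: filterS FB => g; exact.
have [f fl] : exists f, forall x, f x = l x.
  apply: (@dual_of_bounded l 1) => // x; rewrite mul1r.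
  exact: le_trans (ler_norm _) (lb x).
exists f => [x|x]; first by rewrite fl.
by rewrite fl; exact: lP.
Qed.

End DualBall.

(** * Slices of small diameter in the dual of an Asplund space *)
Section SmallSlice.
Context {R : realType} {X : completeNormedModType R}.
Implicit Types (f g : dual X) (x y : X) (L : set (dual X)).

Definition support_fun L x : R := sup [set f x | f in L].

Lemma support_fun_ge L f x : L `<=` dual_ball -> L f -> f x <= support_fun L x.
Proof.
move=> LB Lf; apply: ub_le_sup; last by exists f.
exists `|x| => _ [g Lg <-]; apply: le_trans (LB _ Lg x); exact: ler_norm.
Qed.

Lemma support_fun_le L x r : L !=set0 -> (forall f, L f -> f x <= r) ->
  support_fun L x <= r.
Proof.
move=> [f0 Lf0] H; apply: ge_sup; first by exists (f0 x), f0.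
by move=> _ [f Lf <-]; exact: H.
Qed.

(** Of Frechet differentiability only the upper estimate is retained, with a
derivative that is odd. *)
Lemma frechet_upper (s : X -> R^o) x : differentiable s x ->
  exists2 d : X -> R, (forall h, d (- h) = - d h) &
    forall e : R, 0 < e -> exists2 r : R, 0 < r &
    forall h, `|h| < r -> s (x + h) <= s x + d h + e * `|h|.
Proof.
move=> dsx; exists ('d s x : X -> R) => [h|e e0]; first exact: linearN.
have /eqaddoP/(_ e e0) := diff_locally dsx.
move=> /nbhs_ballP[r /= r0 H]; exists r => // h hr.
have := H h; rewrite -ball_normE /= sub0r normrN => /(_ hr).
move/(le_trans (ler_norm _)); rewrite !fctE /= [h + x]addrC.
by rewrite lerBlDl.
Qed.

Lemma support_fun_convex L : L !=set0 -> L `<=` dual_ball ->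
  convex_function (setT : set (convex_lmodType X)) (support_fun L : _ -> R^o).
Proof.
move=> L0 LB t x y _ _.
change (support_fun L (t%:inum *: x + (1 - t%:inum) *: y) <=
  t%:inum * support_fun L x + (1 - t%:inum) * support_fun L y).
apply: support_fun_le => // f Lf; rewrite dualD !dualZ.
have t0 : 0 <= t%:inum :> R by [].
have t1 : 0 <= (1 - t%:inum) :> R by [].
by apply: lerD; apply: ler_wpM2l => //; exact: support_fun_ge.
Qed.

Lemma support_fun_lip L x y : L !=set0 -> L `<=` dual_ball ->
  support_fun L x <= support_fun L y + `|x - y|.
Proof.
move=> L0 LB; apply: support_fun_le => // f Lf.
rewrite -[x in f x](subrK y) dualD addrC lerD ?support_fun_ge //.
exact: le_trans (ler_norm _) (LB _ Lf _).
Qed.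

(** At a point [x] where the support function of [L] is differentiable, with
derivative [d], a functional [f] of [L] that almost attains the supremum at [x]
satisfies [f h <= d h + small] for all [h] of a fixed small norm, so all these
functionals are close to [d]. *)
Lemma small_slice L (e : R) : asplund X -> L !=set0 -> L `<=` dual_ball ->
  0 < e -> exists (x : X) (t : R), (exists2 f, L f & t < f x) /\
  (forall f g, L f -> L g -> t < f x -> t < g x ->
    forall y, `|f y - g y| <= e * `|y|).
Proof.
move=> aX L0 LB e0.
have cs : continuous (support_fun L : X -> R^o).
  move=> x; apply/cvgrPdist_lt => r r0; near=> y.
  apply: (@le_lt_trans _ _ `|x - y|).
    rewrite ler_norml; have := support_fun_lip x y L0 LB.
    by have := support_fun_lip y x L0 LB; rewrite distrC; lra.
  by near: y; apply: cvgr_dist_lt => //; exact: cvg_id.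
have cT : convex_set (setT : set (convex_lmodType X)).
  by move=> x y t _ _; rewrite in_setE.
have csT : {in (setT : set X), continuous (support_fun L : X -> R^o)}.
  by move=> x _; exact: cs.
have := aX setT _ openT cT csT (support_fun_convex L0 LB).
move=> /(_ 0 I setT filterT)[x [[_ dx] _]].
have [d dN dP] := frechet_upper dx.
have e4 : 0 < e / 4 by rewrite divr_gt0.
have [r r0 rP] := dP _ e4.
exists x, (support_fun L x - e / 4 * (r / 2)); split.
  have p : 0 < e / 4 * (r / 2) by rewrite mulr_gt0 // divr_gt0.
  have [] := @sup_adherent R [set f x | f in L] _ p.
    split; first by case: L0 => f Lf; exists (f x), f.
    exists `|x| => _ [g Lg <-]; apply: le_trans (LB _ Lg x); exact: ler_norm.
  by move=> _ [f Lf <-] H; exists f.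
have key f h : L f -> support_fun L x - e / 4 * (r / 2) < f x -> `|h| = r / 2 ->
    f h - d h <= e / 2 * `|h|.
  move=> Lf fx hr; have hr' : `|h| < r by rewrite hr; lra.
  have := rP h hr'; have := support_fun_ge (x + h) LB Lf; rewrite dualD hr.
  by move: fx; nra.
have key2 f g h : L f -> L g -> support_fun L x - e / 4 * (r / 2) < f x ->
    support_fun L x - e / 4 * (r / 2) < g x ->
    `|h| = r / 2 -> f h - g h <= e * `|h|.
  move=> Lf Lg fx gx hr; have := key f h Lf fx hr.
  have := key g (- h) Lg gx; rewrite normrN dN dualN => /(_ hr).
  by lra.
have key3 f g y : L f -> L g -> support_fun L x - e / 4 * (r / 2) < f x ->
    support_fun L x - e / 4 * (r / 2) < g x -> f y - g y <= e * `|y|.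
  move=> Lf Lg fx gx; have [->|y0] := eqVneq y 0.
    by rewrite !dual0 normr0 mulr0 subrr.
  have ny0 : 0 < `|y| by rewrite normr_gt0.
  have c0 : 0 < r / 2 / `|y| by rewrite !divr_gt0.
  have cy : `|(r / 2 / `|y|) *: y| = r / 2.
    by rewrite normrZ gtr0_norm // divfK ?gt_eqF.
  have := key2 f g _ Lf Lg fx gx cy; rewrite !dualZ normrZ gtr0_norm //.
  by rewrite -mulrBr mulrCA ler_pM2l.
move=> f g Lf Lg fx gx y; rewrite ler_norml key3 // andbT lerNl opprB.
exact: key3.
Unshelve. all: by end_near. Qed.

End SmallSlice.

(** * Separability of the dual seen from a separable subspace *)
Section Separability.
Context {R : realType} {X : completeNormedModType R}.
Implicit Types (f g l : dual X) (x y : X) (L : set (dual X)).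

(** Weak-star closedness, tested on ultrafilters. *)
Definition wclosed L := forall (F : set_system (dual X)) f,
  UltraFilter F -> F L -> wcvg F f -> L f.

Lemma wcvg_le (F : set_system (dual X)) f x (r : R) : ProperFilter F ->
  wcvg F f -> F [set g | g x <= r] -> f x <= r.
Proof. by move=> PF /(_ x) fF Fr; apply: (cvgr_to_le fF). Qed.

Lemma wcvg_ge (F : set_system (dual X)) f x (r : R) : ProperFilter F ->
  wcvg F f -> F [set g | r <= g x] -> r <= f x.
Proof. by move=> PF /(_ x) fF Fr; apply: (cvgr_to_ge fF). Qed.

Lemma dual_ball_wclosed : wclosed dual_ball.
Proof.
move=> F f UF FB fF x; rewrite ler_norml; apply/andP; split.
  apply: (wcvg_ge _ fF); apply: filterS FB => g /(_ x) /=.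
  by rewrite ler_norml => /andP[].
apply: (wcvg_le _ fF); apply: filterS FB => g /(_ x) /=.
by rewrite ler_norml => /andP[].
Qed.

(** The finite intersection property of weak-star closed subsets of the ball, in
the form of a common limit for a directed family of nonempty sets. *)
Lemma directed_limit (I : Type) (D : set I) (B : I -> set (dual X)) :
  (exists i, D i) ->
  (forall i j, D i -> D j -> exists2 k, D k & B k `<=` B i `&` B j) ->
  (forall i, D i -> B i !=set0 /\ B i `<=` dual_ball) ->
  exists F f, [/\ UltraFilter F, forall i, D i -> F (B i), dual_ball f &
    wcvg F f].
Proof.
move=> D0 Bdir BP.
have FB : Filter (filter_from D B) by exact: filter_from_filter.
have PB : ProperFilter (filter_from D B).
  by apply: filter_from_proper => i Di; case: (BP i Di).
have [G [UG BG]] := ultraFilterLemma PB.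
have GB i : D i -> G (B i) by move=> Di; apply: BG; exists i.
have Gball : G dual_ball.
  by case: D0 => i Di; apply: filterS (GB i Di); case: (BP i Di).
have [f fb fG] := dual_ball_compact UG Gball.
by exists G, f.
Qed.

Variable q : nat -> X.

Definition near_on (e : R) f g := forall j, `|f (q j) - g (q j)| <= e * `|q j|.

(** Here [q] is a sequence, and the distance of two functionals is measured on its
terms only. *)
Definition coverable (e : R) (A : set (dual X)) :=
  exists2 c : nat -> dual X, (forall n, dual_ball (c n)) &
    forall f, A f -> exists n, near_on e f (c n).

(** A countable base, indexed by the centre and the precision, for the topology of
pointwise convergence on the terms of [q]. *)
Definition rational_nbhd (c : seq rat * nat) : set (dual X) :=
  [set f | dual_ball f /\ forall j, (j < c.2)%N ->
    `|f (q j) - ratr (nth 0 c.1 j)| < (c.2.+1%:R)^-1 / 2].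

Lemma rational_nbhd_ex f k : dual_ball f -> exists r, rational_nbhd (r, k) f.
Proof.
move=> fb; pose e : R := (k.+1%:R)^-1 / 2.
have e0 : 0 < e by rewrite divr_gt0.
have rex j : exists a : rat, `|f (q j) - ratr a| < e.
  have lt : f (q j) - e < f (q j) + e by lra.
  have [a] := rat_in_itvoo lt.
  rewrite in_itv /= => /andP[a1 a2]; exists a.
  by rewrite ltr_norml; apply/andP; split; lra.
exists (mkseq (fun j => sval (cid (rex j))) k); split => //= j jk.
by rewrite nth_mkseq //; exact: (svalP (cid (rex j))).
Qed.

(** What is left of the ball after removing all basic open sets that countably
many balls of radius [e] cover. *)
Definition uncoverable_core (e : R) : set (dual X) :=
  [set f | dual_ball f /\ forall c, rational_nbhd c f -> ~ coverable e (rational_nbhd c)].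

Lemma zero_ball : dual_ball (0 : dual X).
Proof. by move=> x; rewrite (_ : (0 : dual X) x = 0) // normr0. Qed.

Lemma coverable_off_core e : coverable e (dual_ball `\` uncoverable_core e).
Proof.
have cex c : exists s : nat -> dual X, (forall n, dual_ball (s n)) /\
    (coverable e (rational_nbhd c) ->
      forall f, rational_nbhd c f -> exists n, near_on e f (s n)).
  have [[s sb sP]|nc] := pselect (coverable e (rational_nbhd c)); first by exists s.
  by exists (fun=> 0); split => [n|//]; exact: zero_ball.
pose s c := sval (cid (cex c)).
have [sb sP] : (forall c n, dual_ball (s c n)) /\ forall c,
    coverable e (rational_nbhd c) -> forall f, rational_nbhd c f -> exists n, near_on e f (s c n).
  by split=> c; have [] := svalP (cid (cex c)).
exists (fun m => if @unpickle (seq rat * nat * nat)%type m is Some cn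
  then s cn.1 cn.2 else 0) => [n|f [fb fK]].
  by case: unpickle => [cn|]; [exact: sb|exact: zero_ball].
have [c [fc cc]] : exists c, rational_nbhd c f /\ coverable e (rational_nbhd c).
  apply: contrapT => H; apply: fK; split=> // c cf cc.
  by apply: H; exists c.
have [n fn] := sP c cc f fc.
by exists (pickle (c, n)); rewrite pickleK.
Qed.

Definition agree f g := forall j, f (q j) = g (q j).

(** Zorn's lemma on complements: the weak-star closed subsets of the ball that
still contain, for each element of [K], a functional with the same restriction
form an inductive family for inclusion, by compactness. *)
Lemma minimal_closed (K : set (dual X)) : K `<=` dual_ball ->
  exists L, [/\ wclosed L, L `<=` dual_ball,
    forall f, K f -> exists2 l, L l & agree l f &
    forall L', wclosed L' -> L' `<=` L -> ~ (L `<=` L') ->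
      exists2 f, K f & forall l, L' l -> ~ agree l f].
Proof.
move=> KB; pose P (M : set (dual X)) := wclosed (dual_ball `\` M) /\
  forall f, K f -> exists2 l, (dual_ball `\` M) l & agree l f.
have [F FP totF|M [[Mw MK] Mmax]] := @Zorn_bigcup (dual X) P.
  split=> [G f UG GM fG|f Kf].
    have fb : dual_ball f.
      by apply: (dual_ball_wclosed UG _ fG); apply: filterS GM => ? [].
    split=> // -[M FM Mf]; have [Mw _] := FP M FM.
    have [] // : (dual_ball `\` M) f.
    apply: (Mw G) => //; apply: filterS GM => g [gb gM]; split=> // Mg.
    by apply: gM; exists M.
  have [[M0 FM0]|F0] := pselect (exists M, F M); last first.
    exists f; last by [].
    by split=> [|[M FM _]]; [exact: KB|apply: F0; exists M].
  pose B (M : set (dual X)) := [set l | (dual_ball `\` M) l /\ agree l f].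
  have [||M FM|G [l [UG GB lb lG]]] := @directed_limit _ F B.
  - by exists M0.
  - move=> M N FM FN; have [MN|NM] := totF M N FM FN.
      exists N => // l [[lb lN] lf]; split=> //; split=> //.
      by split=> // Ml; apply/lN/MN.
    exists M => // l [[lb lM] lf]; split=> //; split=> //.
    by split=> // Nl; apply/lM/NM.
  - split; last by move=> l [[]].
    by have [_ /(_ f Kf)[l lM lf]] := FP M FM; exists l.
  exists l.
    split=> // -[M FM Ml]; have [Mw _] := FP M FM.
    have [] // : (dual_ball `\` M) l.
    by apply: (Mw G) => //; apply: filterS (GB M FM) => g [].
  move=> j; apply/eqP; rewrite eq_le; apply/andP; split.
    by apply: (wcvg_le _ lG); apply: filterS (GB _ FM0) => g [_ /(_ j)] /= ->.
  by apply: (wcvg_ge _ lG); apply: filterS (GB _ FM0) => g [_ /(_ j)] /= ->.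
exists (dual_ball `\` M); split=> //.
move=> L' L'w L'L nL; apply: contrapT => H.
have E : dual_ball `\` (dual_ball `\` L') = L'.
  apply/seteqP; split=> [l [lb lL]|l L'l].
    by apply: contrapT => ?; apply: lL.
  by split; [case: (L'L _ L'l)|case].
apply: (Mmax (M `|` (dual_ball `\` L'))).
  split=> [|MM]; first by left.
  apply: nL => l [lb lM]; apply: contrapT => lL'.
  by apply/lM/MM; right.
have E' : dual_ball `\` (M `|` (dual_ball `\` L')) = L'.
  apply/seteqP; split=> [l [lb lL]|l L'l].
    by apply: contrapT => ?; apply: lL; right.
  by split; [case: (L'L _ L'l)|case=> [|[]//]; case: (L'L _ L'l)].
rewrite /P E'; split=> // f Kf; apply: contrapT => H'; apply: H.
by exists f => // l L'l lf; apply: H'; exists l.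
Qed.

(** The restrictions to [q] of a weak-star closed set of functionals form a closed
set for pointwise convergence. *)
Lemma separated_nbhd L f : wclosed L -> L `<=` dual_ball ->
  (forall l, L l -> ~ agree l f) ->
  exists k, forall l, L l ->
    ~ (forall j, (j < k)%N -> `|l (q j) - f (q j)| < (k.+1%:R)^-1).
Proof.
move=> Lw LB Lf; apply: contrapT => H.
pose B k := [set l | L l /\
  forall j, (j < k)%N -> `|l (q j) - f (q j)| < (k.+1%:R)^-1].
have [||k _|G [l [UG GB lb lG]]] := @directed_limit nat setT B.
- by exists 0%N.
- have Bmono m n : (m <= n)%N -> B n `<=` B m.
    move=> mn l [Ll lf]; split=> // j jm.
    apply: lt_le_trans (lf j (leq_trans jm mn)) _.
    by rewrite lef_pV2 ?posrE ?ltr0n // ler_nat ltnS.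
  move=> m n _ _; exists (maxn m n) => // l Bl; split.
    by apply: Bmono Bl; rewrite leq_maxl.
  by apply: Bmono Bl; rewrite leq_maxr.
- split; last by move=> l [/LB].
  apply: contrapT => Bk; apply: H; exists k => l Ll lf; apply: Bk.
  by exists l.
apply: (Lf l).
  by apply: (Lw G) => //; apply: filterS (GB 0%N I) => ? [].
have small j k : (j < k)%N -> `|l (q j) - f (q j)| <= (k.+1%:R)^-1.
  move=> jk; pose e : R := (k.+1%:R)^-1; rewrite -/e.
  have Ge : G [set g | `|g (q j) - f (q j)| < e].
    by apply: filterS (GB k I) => g [_ /(_ j jk)].
  rewrite ler_norml; apply/andP; split.
    suff : f (q j) - e <= l (q j) by lra.
    apply: (wcvg_ge _ lG); apply: filterS Ge => g /=.
    by rewrite ltr_norml => /andP[]; lra.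
  suff : l (q j) <= f (q j) + e by lra.
  apply: (wcvg_le _ lG); apply: filterS Ge => g /=.
  by rewrite ltr_norml => /andP[]; lra.
move=> j; apply/eqP; rewrite -subr_eq0 -normr_le0.
apply/ler_addgt0Pr => e e0; rewrite add0r.
pose m := maxn j.+1 (Num.truncn e^-1).
apply: (le_trans (small j m _)); first by rewrite leq_max ltnSn.
rewrite -[e]invrK lef_pV2 ?posrE ?invr_gt0 ?ltr0n // ltW //.
apply: lt_le_trans (truncnS_gt _) _.
by rewrite ler_nat ltnS leq_maxr.
Qed.

(** Take a minimal weak-star closed [L] over the restrictions of the core, and a
small slice of [L].  Removing the slice leaves a closed set that misses the
restriction of some [f] of the core, hence the restrictions of all functionals
of a basic neighbourhood of [f]; those of the core are then matched only by
functionals of the slice and lie in a single small ball.  So this neighbourhood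
is coverable, against the definition of the core. *)
Lemma uncoverable_core_empty e : asplund X -> 0 < e -> uncoverable_core e = set0.
Proof.
move=> aX e0; rewrite -subset0 => f0 Kf0.
have KB : uncoverable_core e `<=` dual_ball by move=> ? [].
have [L [Lw LB LK Lmin]] := minimal_closed KB.
have Ln0 : L !=set0 by have [l Ll _] := LK f0 Kf0; exists l.
have [x [t [[f1 Lf1 tf1] sl]]] := small_slice aX Ln0 LB e0.
pose L' := L `&` [set l | l x <= t].
have L'w : wclosed L'.
  move=> F f UF FL fF; split.
    by apply: (Lw F) => //; apply: filterS FL => ? [].
  by apply: (wcvg_le _ fF); apply: filterS FL => ? [].
have nLL' : ~ L `<=` L'.
  by move=> /(_ f1 Lf1)[_]; rewrite /= leNgt tf1.
have [|f Kf L'f] := Lmin L' L'w _ nLL'; first by move=> ? [].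
have [|k kP] := separated_nbhd L'w _ L'f; first by move=> l [/LB].
have [r fr] := rational_nbhd_ex k (KB _ Kf).
have [_ /(_ _ fr)] := Kf; apply.
have [c cb cP] := coverable_off_core e.
exists (fun n => if n is n.+1 then c n else f1).
  by case=> [|n]; [exact: LB|exact: cb].
move=> g gr; have [Kg|nKg] := pselect (uncoverable_core e g); last first.
  have [n gn] := cP g (conj gr.1 nKg); by exists n.+1.
exists 0%N => j; have [l Ll lg] := LK g Kg; rewrite -lg.
apply: sl => //; rewrite ltNge; apply/negP => lt.
apply: (kP l) => // i ik; rewrite lg.
pose e' : R := (k.+1%:R)^-1; pose a : R := ratr (nth 0 r i).
have h1 : `|(g (q i) : R) - a| < e' / 2 := gr.2 i ik.
have h2 : `|(f (q i) : R) - a| < e' / 2 := fr.2 i ik.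
apply: le_lt_trans (ler_distD a _ _) _; rewrite -/e' [X in _ + X]distrC.
by lra.
Qed.

(** Functionals are continuous, so closeness on the terms of [q] extends to the
closure. *)
Lemma near_on_closure e f g : near_on e f g ->
  forall y, closure (range q) y -> `|f y - g y| <= e * `|y|.
Proof.
move=> fg y yq; apply/ler_addgt0Pr => d d0.
pose M := `|f - g| + `|e| + 1; have M0 : 0 < M by rewrite ltr_wpDl ?addr_ge0.
have [_ [[j _ <-]]] := yq _ (nbhsx_ballx y (d / M) (divr_gt0 d0 M0)).
rewrite -ball_normE /= ltr_pdivlMr // => yj.
have E x : f x - g x = (f - g) x by [].
have := fg j; rewrite !E => fgj.
have h1 : `|(f - g) y| <= `|(f - g) (q j)| + `|f - g| * `|y - q j|.
  rewrite -[X in (f - g) X](subrK (q j)) dualD addrC.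
  by rewrite (le_trans (ler_normD _ _)) // lerD2l dual_norm_bound.
have h2 : e * `|q j| <= e * `|y| + `|e| * `|y - q j|.
  rewrite -lerBlDl -mulrBr (le_trans (ler_norm _)) // normrM.
  by rewrite ler_wpM2l // distrC ler_dist_dist.
have h3 : (`|f - g| + `|e|) * `|y - q j| <= d.
  apply: le_trans (ltW yj); rewrite mulrC ler_wpM2l //.
  by rewrite /M lerDl.
by lra.
Qed.

Lemma dual_separable : asplund X ->
  exists2 c : nat -> dual X, (forall n, dual_ball (c n)) &
    forall f, dual_ball f -> forall e, 0 < e -> exists n,
      forall y, closure (range q) y -> `|f y - c n y| <= e * `|y|.
Proof.
move=> aX.
have cov k : exists2 c : nat -> dual X, (forall n, dual_ball (c n)) &
    forall f, dual_ball f -> exists n, near_on (k.+1%:R)^-1 f (c n).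
  have k0 : 0 < (k.+1%:R)^-1 :> R by rewrite invr_gt0 ltr0n.
  have [c cb cP] := coverable_off_core (k.+1%:R)^-1.
  exists c => // f fb; apply: cP; split=> //.
  by rewrite uncoverable_core_empty.
pose c k := sval (cid2 (cov k)).
have cb k n : dual_ball (c k n) by rewrite /c; case: cid2 => ? /=.
have cP k f : dual_ball f -> exists n, near_on (k.+1%:R)^-1 f (c k n).
  by rewrite /c; case: cid2 => ? /= _; apply.
exists (fun m => if @unpickle (nat * nat)%type m is Some kn
  then c kn.1 kn.2 else 0) => [n|f fb e e0].
  by case: unpickle => [kn|]; [exact: cb|exact: zero_ball].
pose k := Num.truncn e^-1.
have [n fn] := cP k f fb.
exists (pickle (k, n)) => y yq; rewrite pickleK /=.
apply: le_trans (near_on_closure fn yq) _; rewrite ler_wpM2r //.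
rewrite -[e]invrK lef_pV2 ?posrE ?invr_gt0 ?ltr0n // ltW //.
exact: truncnS_gt.
Qed.

End Separability.

(** * Smooth approximations of the norm *)

(** The arithmetic of strong convexity: if the midpoint of two near maximizers
cannot do better than the maximum [Fx], then the distances [a] and [b] of the
two to a common point cannot be far apart. *)
Lemma midpoint_gap (R : realType) (s w e m a b Gg Gf gx fx Fx : R) :
  0 < s -> 0 < w -> 0 < e -> b <= e / 3 -> e / 3 * 2 < a ->
  m + w / 4 * (a - b) ^+ 2 <= (Gg + Gf) / 2 ->
  2^-1 * (gx + fx) - s * m <= Fx ->
  Fx - s * w * (e / 3) ^+ 2 / 4 <= gx - s * Gg -> Fx <= fx - s * Gf -> False.
Proof.
move=> s0 w0 e0 be ea mG mF gmax fmax; have e3 : 0 < e / 3 by rewrite divr_gt0.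
have ab : (e / 3) ^+ 2 <= (a - b) ^+ 2.
  by rewrite ler_sqr ?nnegrE ?(ltW e3) //; lra.
have h1 : s * (m + w / 4 * (a - b) ^+ 2) <= s * ((Gg + Gf) / 2).
  by rewrite ler_wpM2l // ltW.
have h2 : s * w * (e / 3) ^+ 2 <= s * w * (a - b) ^+ 2.
  by rewrite ler_wpM2l // ltW // mulr_gt0.
have h3 : 0 < s * w * (e / 3) ^+ 2 by rewrite !mulr_gt0 // exprn_gt0.
move: h1 h2 h3 mF gmax fmax.
move: (s * w * (e / 3) ^+ 2) => A; rewrite !mulrDr.
have -> : s * (w / 4 * (a - b) ^+ 2) = (s * w * (a - b) ^+ 2) / 4 by field.
move: (s * w * (a - b) ^+ 2) => B.
by lra.
Qed.

Section SmoothApprox.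
Context {R : realType} {X : completeNormedModType R}.
Implicit Types (f g : dual X) (x y : X).
Variables (Y : set X) (c : nat -> dual X).
Hypothesis Y0 : Y 0.
Hypothesis YZ : forall (t : R) y, Y y -> Y (t *: y).
Hypothesis cb : forall n, dual_ball (c n).
Hypothesis cdense : forall f, dual_ball f -> forall e : R, 0 < e ->
  exists n, forall y, Y y -> `|f y - c n y| <= e * `|y|.

(** The norm of the restriction of [f] to [Y]. *)
Definition seminormY f : R := sup [set `|f y| | y in Y `&` [set y | `|y| <= 1]].
Local Notation nY := seminormY.

Lemma seminormY_ub f y : Y y -> `|y| <= 1 -> `|f y| <= nY f.
Proof.
move=> Yy y1; apply: ub_le_sup; last by exists y.
by exists `|f| => _ [z [_ z1] <-]; exact: dual_norm_ub.
Qed.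

Lemma seminormY_le f (M : R) :
  (forall y, Y y -> `|y| <= 1 -> `|f y| <= M) -> nY f <= M.
Proof.
move=> fM; apply: ge_sup; last by move=> _ [y [Yy y1] <-]; exact: fM.
by exists `|f 0|, 0 => //; split => //=; rewrite normr0.
Qed.

Lemma seminormY_ge0 f : 0 <= nY f.
Proof. by apply: le_trans (@seminormY_ub f 0 Y0 _); rewrite ?normr0. Qed.

Lemma seminormYD f g : nY (f + g) <= nY f + nY g.
Proof.
apply: seminormY_le => y Yy y1; apply: (le_trans (ler_normD (f y) (g y))).
by apply: lerD; exact: seminormY_ub.
Qed.

Lemma seminormYN f : nY (- f) = nY f.
Proof.
have le g : nY (- g) <= nY g.
  by apply: seminormY_le => y Yy y1; rewrite [leLHS]normrN seminormY_ub.
by apply/eqP; rewrite eq_le le -{1}[f]opprK le.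
Qed.

Lemma seminormY_half f g : nY (2^-1 *: (f + g)) <= (nY f + nY g) / 2.
Proof.
apply: seminormY_le => y Yy y1; have -> : (2^-1 *: (f + g)) y = 2^-1 * (f y + g y) by [].
rewrite normrM gtr0_norm ?invr_gt0 // mulrC ler_wpM2r // ?invr_ge0 //.
by apply: (le_trans (ler_normD _ _)); apply: lerD; exact: seminormY_ub.
Qed.

Lemma seminormYP f y : Y y -> `|f y| <= nY f * `|y|.
Proof.
move=> Yy; have [->|y0] := eqVneq y 0; first by rewrite dual0 !normr0 mulr0.
have ny0 : 0 < `|y| by rewrite normr_gt0.
have := @seminormY_ub f _ (YZ `|y|^-1 Yy).
rewrite normrZ normfV normr_id mulVf ?gt_eqF // dualZ normrM normfV normr_id.
by move=> /(_ (lexx 1)); rewrite mulrC ler_pdivrMr.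
Qed.

Lemma seminormY_ball f : dual_ball f -> nY f <= 1.
Proof. by move=> fb; apply: seminormY_le => y _; exact: le_trans (fb y). Qed.

Local Opaque seminormY.

Lemma dual_ballN f : dual_ball f -> dual_ball (- f).
Proof. by move=> fb x; have -> : (- f) x = - f x by []; rewrite normrN fb. Qed.

Lemma dual_ball_half f g : dual_ball f -> dual_ball g ->
  dual_ball (2^-1 *: (f + g)).
Proof.
move=> fb gb x; have -> : (2^-1 *: (f + g)) x = 2^-1 * (f x + g x) by [].
rewrite normrM gtr0_norm ?invr_gt0 // ler_pdivrMl //.
rewrite (le_trans (ler_normD _ _)) //; have := fb x; have := gb x.
by lra.
Qed.

Definition wgt (n : nat) : R := 2^-1 ^+ n.+1.

Lemma wgt_gt0 n : 0 < wgt n.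
Proof. by rewrite exprn_gt0 // invr_gt0. Qed.

Lemma sum_wgt N : \sum_(n < N) wgt n = 1 - 2^-1 ^+ N.
Proof.
elim: N => [|N IH]; first by rewrite big_ord0 expr0 subrr.
by rewrite big_ord_recr /= IH /wgt exprS; set a := _ ^+ N; lra.
Qed.

(** The penalty is strictly convex enough because the square of a distance to a
single point is, along any segment on which this distance varies.  Both [c n]
and its opposite occur, which makes the penalty even. *)
Definition defect (n : nat) f : R :=
  wgt n * (nY (f - c n) ^+ 2 + nY (f + c n) ^+ 2).

Lemma defect_ge0 n f : 0 <= defect n f.
Proof. by rewrite mulr_ge0 ?(ltW (wgt_gt0 _)) // addr_ge0 // sqr_ge0. Qed.

Lemma defectN n f : defect n (- f) = defect n f.
Proof.
rewrite /defect -opprD seminormYN addrC -[nY (f + c n)]seminormYN opprD.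
by rewrite [nY (- f + c n)](_ : _ = nY (f - c n)) ?seminormYN // -seminormYN opprD opprK.
Qed.

Lemma defect_half n f g :
  defect n (2^-1 *: (f + g)) + wgt n / 4 * (nY (f - c n) - nY (g - c n)) ^+ 2
   <= (defect n f + defect n g) / 2.
Proof.
have E d : 2^-1 *: (f + g) + d = 2^-1 *: ((f + d) + (g + d)).
  rewrite addrACA !scalerDr -[in RHS]scalerDl.
  rewrite [X in _ = _ + X *: d](_ : _ = 1) ?scale1r ?scalerDr //.
  by lra.
rewrite /defect E [_ + c n]E.
have := seminormY_half (f - c n) (g - c n).
have := seminormY_half (f + c n) (g + c n).
have := seminormY_ge0 (2^-1 *: ((f - c n) + (g - c n))).
have := seminormY_ge0 (2^-1 *: ((f + c n) + (g + c n))).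
set a := nY (f - c n); set b := nY (g - c n).
set a' := nY (f + c n); set b' := nY (g + c n).
set m := nY (2^-1 *: (f - c n + (g - c n))).
set m' := nY (2^-1 *: (f + c n + (g + c n))).
move=> m'0 m0 m'ab mab; have w0 := ltW (wgt_gt0 n).
have h : m ^+ 2 <= ((a + b) / 2) ^+ 2 by rewrite ler_sqr ?nnegrE //; lra.
have h' : m' ^+ 2 <= ((a' + b') / 2) ^+ 2 by rewrite ler_sqr ?nnegrE //; lra.
have h'' : 0 <= (a' - b') ^+ 2 by rewrite sqr_ge0.
have -> : (wgt n * (a ^+ 2 + a' ^+ 2) + wgt n * (b ^+ 2 + b' ^+ 2)) / 2 =
  wgt n * ((a ^+ 2 + a' ^+ 2 + b ^+ 2 + b' ^+ 2) / 2) by lra.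
have -> : wgt n * (m ^+ 2 + m' ^+ 2) + wgt n / 4 * (a - b) ^+ 2 =
  wgt n * (m ^+ 2 + m' ^+ 2 + (a - b) ^+ 2 / 4) by lra.
by rewrite ler_wpM2l //; nra.
Qed.

Lemma defect_ball n f : dual_ball f -> defect n f <= 8 * wgt n.
Proof.
move=> fb; rewrite /defect mulrC ler_wpM2r ?(ltW (wgt_gt0 _)) //.
have f1 := seminormY_ball fb; have c1 := seminormY_ball (@cb n).
have := seminormYD f (c n); have := seminormYD f (- c n); rewrite seminormYN.
have := seminormY_ge0 (f - c n); have := seminormY_ge0 (f + c n).
by move=> *; nra.
Qed.

Lemma defectE n f :
  defect n f = wgt n * (nY (f - c n) ^+ 2 + nY (f + c n) ^+ 2).
Proof. by []. Qed.

Local Opaque defect.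

Definition pdefect N f : R := \sum_(n < N) defect n f.

Lemma pdefect_le8 N f : dual_ball f -> pdefect N f <= 8.
Proof.
move=> fb; rewrite /pdefect (@le_trans _ _ (\sum_(n < N) 8 * wgt n)) //.
  by apply: ler_sum => n _; exact: defect_ball.
rewrite -big_distrr /= sum_wgt ler_piMr // gerBl exprn_ge0.
Qed.

Lemma pdefect_mono M N f : (M <= N)%N -> pdefect M f <= pdefect N f.
Proof.
move=> MN; rewrite -(subnKC MN) /pdefect big_split_ord /= lerDl.
by apply: sumr_ge0 => n _; exact: defect_ge0.
Qed.

Definition total_defect f : R := sup (range (pdefect ^~ f)).
Local Notation G := total_defect.

Lemma total_defect_ub N f : dual_ball f -> pdefect N f <= G f.
Proof.
move=> fb; apply: ub_le_sup; last by exists N.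
by exists 8 => _ [n _ <-]; exact: pdefect_le8.
Qed.

Lemma total_defect_le f (M : R) : (forall N, pdefect N f <= M) -> G f <= M.
Proof.
move=> H; apply: ge_sup; first by exists (pdefect 0 f), 0%N.
by move=> _ [n _ <-]; exact: H.
Qed.

Lemma total_defect_ge0 f : dual_ball f -> 0 <= G f.
Proof.
by move=> fb; apply: le_trans (total_defect_ub 0 fb); rewrite /pdefect big_ord0.
Qed.

Lemma total_defectN f : dual_ball f -> G (- f) <= G f.
Proof.
move=> fb; apply: total_defect_le => N.
apply: le_trans (total_defect_ub N fb).
by apply: ler_sum => n _; rewrite defectN.
Qed.

(* Unification must not unfold the penalty: it would compare functionals up to
   conversion. *)
Lemma pdefectE N f : pdefect N f = \sum_(n < N) defect n f.
Proof. by []. Qed.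

Local Opaque pdefect total_defect.

Lemma total_defect_half n f g : dual_ball f -> dual_ball g ->
  G (2^-1 *: (f + g)) + wgt n / 4 * (nY (f - c n) - nY (g - c n)) ^+ 2
   <= (G f + G g) / 2.
Proof.
move=> fb gb; rewrite -lerBrDr; apply: total_defect_le => N.
pose M := maxn N n.+1; have nM : (n < M)%N by rewrite leq_max ltnSn orbT.
apply: le_trans (pdefect_mono _ (leq_maxl N n.+1)) _; rewrite -/M lerBrDr.
apply: (@le_trans _ _ ((pdefect M f + pdefect M g) / 2)); last first.
  by rewrite ler_wpM2r ?invr_ge0 // lerD // total_defect_ub.
have D1 (k : dual X) : pdefect M k =
    defect n k + \sum_(i < M | i != Ordinal nM) defect i k.
  by rewrite pdefectE (bigD1 (Ordinal nM)).
have mid (a b d a1 a2 b1 b2 : R) : a + d <= (a1 + a2) / 2 ->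
  b <= (b1 + b2) / 2 -> a + b + d <= (a1 + b1 + (a2 + b2)) / 2 by lra.
rewrite !D1.
have h := defect_half n f g.
have h' : \sum_(i < M | i != Ordinal nM) defect i (2^-1 *: (f + g)) <=
   (\sum_(i < M | i != Ordinal nM) defect i f +
    \sum_(i < M | i != Ordinal nM) defect i g) / 2.
  rewrite -big_split /= big_distrl /=; apply: ler_sum => i _.
  apply: le_trans (defect_half i f g); rewrite lerDl mulr_ge0 ?sqr_ge0 //.
  by rewrite divr_ge0 // ltW // wgt_gt0.
exact: mid h h'.
Qed.

(** Each seminorm is a supremum of weak-star continuous functions.  Along an
ultrafilter the finitely many seminorms that occur converge, to limits that
dominate the seminorms of the limit. *)
Lemma total_defect_lsc (F : set_system (dual X)) f x (s r : R) :
  UltraFilter F -> F dual_ball -> wcvg F f -> 0 < s -> dual_ball f ->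
  F [set g : dual X | r <= g x - s * G g] -> r <= f x - s * G f.
Proof.
move=> UF FB fF s0 fb Fr.
suff H N : pdefect N f <= (f x - r) / s.
  by have := total_defect_le H; rewrite ler_pdivlMr //; lra.
have lim_nY (d : dual X) : dual_ball d -> exists2 a : R, nY (f + d) <= a &
    (fun g : dual X => nY (g + d)) @ F --> (a : R^o).
  move=> db; have [a _ aP] : exists2 a : R, `[0, 2]%classic a &
      (fun g : dual X => nY (g + d)) @ F --> (a : R^o).
    apply: (ultra_compact_cvg UF); first exact: segment_compact.
    apply: filterS FB => g gb /=; rewrite in_itv /= seminormY_ge0 /=.
    have := seminormYD g d; have := seminormY_ball gb.
    by have := seminormY_ball db; lra.
  exists a => //; apply: seminormY_le => y Yy y1.
  have cvy : (fun g : dual X => `|(g + d) y| : R) @ F --> (`|(f + d) y| : R^o).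
    apply: cvg_norm; have -> : (fun g : dual X => (g + d) y : R^o) =
      (fun g : dual X => g y : R^o) + cst (d y : R^o) by apply/funext.
    by apply: cvgD; [exact: fF | exact: cvg_cst].
  apply: (ler_cvg_to cvy aP).
  by apply: nearW => g; rewrite seminormY_ub.
have lim_defect n : exists2 a : R, defect n f <= a &
    (fun g : dual X => defect n g) @ F --> (a : R^o).
  have [a fa aP] := lim_nY _ (dual_ballN (@cb n)).
  have [b fb' bP] := lim_nY _ (@cb n).
  exists (wgt n * (a * a + b * b)).
    rewrite defectE ler_wpM2l ?(ltW (wgt_gt0 _)) //.
    have := seminormY_ge0 (f - c n); have := seminormY_ge0 (f + c n).
    by move=> *; nra.
  under eq_fun do rewrite defectE.
  apply: cvgMl_tmp; apply: cvgD; rewrite /=.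
    by under eq_fun do rewrite expr2; apply: cvgM.
  by under eq_fun do rewrite expr2; apply: cvgM.
have lim_sum : exists2 a : R, pdefect N f <= a &
    (fun g : dual X => pdefect N g) @ F --> (a : R^o).
  elim: N => [|N [a fa aP]].
    exists 0; first by rewrite pdefectE big_ord0.
    by under eq_fun do rewrite pdefectE big_ord0; exact: cvg_cst.
  have [b fb' bP] := lim_defect N; exists (a + b).
    by rewrite pdefectE big_ord_recr /= lerD.
  by under eq_fun do rewrite pdefectE big_ord_recr /= -pdefectE; exact: cvgD.
have [a fa aP] := lim_sum; apply: le_trans fa _; rewrite ler_pdivlMr //.
have h : (fun g : dual X => (g x : R) - s * pdefect N g) @ F --> ((f x : R) - s * a : R^o).
  by apply: cvgB; [exact: fF | apply: cvgMl_tmp].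
suff : r <= (f x : R) - s * a by lra.
apply: (cvgr_to_ge h); apply: filterS (filterI FB Fr) => g [gb /= gr].
apply: le_trans gr _; rewrite lerD2l lerN2 ler_wpM2l ?(ltW s0) //.
exact: total_defect_ub.
Qed.

Variable s : R.
Hypothesis s0 : 0 < s.

(** The conjugate of the penalty on the dual ball, a convex function close to the
norm when [s] is small. *)
Definition smoothing x : R := sup [set f x - s * G f | f in dual_ball].
Local Notation F := smoothing.

Lemma smoothing_ub f x : dual_ball f -> f x - s * G f <= F x.
Proof.
move=> fb; apply: ub_le_sup; last by exists f.
exists `|x| => _ [g gb <-]; rewrite lerBlDr.
rewrite (le_trans (ler_norm _)) // (le_trans (gb x)) // lerDl.
by apply: mulr_ge0; [exact: ltW | exact: total_defect_ge0].
Qed.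

Lemma smoothing_le x (M : R) : (forall f, dual_ball f -> f x - s * G f <= M) ->
  F x <= M.
Proof.
move=> H; apply: ge_sup; last by move=> _ [f fb <-]; exact: H.
by exists ((0 : dual X) x - s * G 0), 0 => //; exact: zero_ball.
Qed.

Lemma smoothing_adherent x (e : R) : 0 < e ->
  exists2 f, dual_ball f & F x - e < f x - s * G f.
Proof.
move=> e0; apply: contrapT => H; have : F x <= F x - e.
  apply: smoothing_le => f fb; rewrite leNgt; apply/negP => lt.
  by apply: H; exists f.
by rewrite leNgt gtrBl e0.
Qed.

Lemma smoothing_lip x y : F x <= F y + `|x - y|.
Proof.
apply: smoothing_le => f fb; rewrite -[x in f x](subrK y) dualD.
have := smoothing_ub y fb; have := fb (x - y); rewrite ler_norml => /andP[_].
by lra.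
Qed.

Lemma smoothing_ge0 x : F 0 <= F x.
Proof.
apply: smoothing_le => f fb; rewrite dual0.
have := smoothing_ub x fb; have := smoothing_ub x (dual_ballN fb).
have -> : (- f) x = - f x by [].
have : s * G (- f) <= s * G f.
  by apply: ler_wpM2l; [exact: ltW | exact: total_defectN].
by move: (G (- f)) => b; have [fx|fx] := leP 0 (f x); lra.
Qed.

Lemma smoothing_norm x : `|x| <= F x - F 0 + 8 * s.
Proof.
have [f fb fx] := norming_functional x; have := smoothing_ub x fb.
have : s * G f <= s * 8.
  rewrite ler_wpM2l ?(ltW s0) //; apply: total_defect_le => N.
  exact: pdefect_le8.
have : F 0 <= 0.
  apply: smoothing_le => g gb; rewrite dual0 sub0r oppr_le0.
  by rewrite mulr_ge0 ?(ltW s0) // total_defect_ge0.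
by rewrite fx; lra.
Qed.

Lemma smoothing_attained x : exists2 f, dual_ball f & F x <= f x - s * G f.
Proof.
pose B k := [set f | dual_ball f /\ F x - (k.+1%:R)^-1 <= f x - s * G f].
have [||k _|U [f [UU UB fb fU]]] := @directed_limit _ _ nat setT B.
- by exists 0%N.
- have Bmono m n : (m <= n)%N -> B n `<=` B m.
    move=> mn l [lb lf]; split=> //; apply: le_trans lf.
    by rewrite lerD2l lerN2 lef_pV2 ?posrE ?ltr0n // ler_nat ltnS.
  move=> m n _ _; exists (maxn m n) => // l Bl; split.
    by apply: Bmono Bl; rewrite leq_maxl.
  by apply: Bmono Bl; rewrite leq_maxr.
- split; last by move=> l [].
  have [f fb fx] := @smoothing_adherent x (k.+1%:R)^-1 ltac:(by rewrite invr_gt0 ltr0n).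
  by exists f; split=> //; exact: ltW.
exists f => //; apply/ler_addgt0Pr => e e0; rewrite -lerBlDr.
pose k := Num.truncn e^-1.
apply: (@le_trans _ _ (F x - (k.+1%:R)^-1)).
  rewrite lerD2l lerN2 -[e]invrK lef_pV2 ?posrE ?invr_gt0 ?ltr0n // ltW //.
  exact: truncnS_gt.
apply: (total_defect_lsc (F := U)) => //.
  by apply: filterS (UB 0%N I) => ? [].
by apply: filterS (UB k I) => ? [].
Qed.

(** The maximizer [f] at [x] is at distance at most [e / 3] from some [c n], by
density; a near maximizer [g] then has almost the same distance to that [c n],
by [midpoint_gap], so it is close to [f]. *)
Lemma smoothing_stable x f (e : R) : dual_ball f -> F x <= f x - s * G f -> 0 < e ->
  exists2 t : R, 0 < t & forall g, dual_ball g -> F x - t <= g x - s * G g ->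
    forall y, Y y -> `|g y - f y| <= e * `|y|.
Proof.
move=> fb fmax e0; have e3 : 0 < e / 3 by rewrite divr_gt0.
have [n fn] := cdense fb e3.
exists (s * wgt n * (e / 3) ^+ 2 / 4).
  by rewrite divr_gt0 // !mulr_gt0 // wgt_gt0.
move=> g gb gmax y Yy.
have w0 := wgt_gt0 n.
have fcn : nY (f - c n) <= e / 3.
  apply: seminormY_le => z Yz z1; apply: le_trans (fn z Yz) _.
  by rewrite ler_piMr // ltW.
have gcn : nY (g - c n) <= e / 3 * 2.
  rewrite leNgt; apply/negP => lt.
  have mF := smoothing_ub x (dual_ball_half gb fb).
  have mG := total_defect_half n gb fb.
  exact: (midpoint_gap s0 w0 e0 fcn lt mG mF gmax fmax).
have -> : g y - f y = (g - f) y by [].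
apply: le_trans (seminormYP _ Yy) _; rewrite ler_wpM2r //.
have -> : g - f = (g - c n) + - (f - c n) by rewrite opprB addrA subrK.
apply: le_trans (seminormYD (g - c n) (- (f - c n))) _.
rewrite seminormYN; apply: le_trans (lerD gcn fcn) _.
by rewrite (_ : e / 3 * 2 + e / 3 = e) //; field.
Qed.

(** A near maximizer at [x + h] is a near maximizer at [x], hence close to the
maximizer [f] at [x] by [smoothing_stable], so that the increment of the
smoothing is [f h] up to a small multiple of [|h|]. *)
Lemma smoothing_smooth x : exists2 f, dual_ball f & forall e : R, 0 < e ->
  exists2 r : R, 0 < r & forall h, Y h -> `|h| < r ->
    F (x + h) <= F x + f h + e * `|h|.
Proof.
have [f fb fmax] := smoothing_attained x; exists f => // e e0.
have e2 : 0 < e / 2 by rewrite divr_gt0.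
have [t t0 tP] := smoothing_stable fb fmax e2.
exists (t / (2 + e)) => [|h Yh]; first by rewrite divr_gt0 // addr_gt0.
rewrite ltr_pdivlMr ?addr_gt0 // => hr.
have [->|h0] := eqVneq h 0; first by rewrite addr0 dual0 normr0; lra.
have nh0 : 0 < `|h| by rewrite normr_gt0.
have eh : 0 < e / 2 * `|h| by rewrite mulr_gt0.
have [g gb gx] := smoothing_adherent (x + h) eh.
have gh := gb h; rewrite ler_norml in gh; case/andP: gh => gh1 gh2.
have Fh := smoothing_lip x (x + h).
rewrite opprD addNKr normrN in Fh.
rewrite dualD in gx.
rewrite mulrDr in hr.
have gmax : F x - t <= g x - s * G g.
  by clear - Fh gx hr gh2 eh; move: (F (x + h)) Fh gx => b; lra.
have := tP g gb gmax h Yh; rewrite ler_norml => /andP[_ gf].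
have := smoothing_ub x gb.
by clear - gf gx; move: (F (x + h)) gx => b; lra.
Qed.

End SmoothApprox.

Lemma smooth_norm (R : realType) (X : completeNormedModType R) (Y : set X)
    (c : nat -> dual X) (s : R) :
  Y 0 -> (forall (t : R) y, Y y -> Y (t *: y)) ->
  (forall n, dual_ball (c n)) ->
  (forall f, dual_ball f -> forall e : R, 0 < e ->
    exists n, forall y, Y y -> `|f y - c n y| <= e * `|y|) ->
  0 < s ->
  exists N : X -> R, [/\ forall x, 0 <= N x, N 0 = 0,
    forall x y, N x <= N y + `|x - y|, forall x, `|x| <= N x + s &
    forall x, exists2 f : dual X, dual_ball f & forall e : R, 0 < e ->
      exists2 r : R, 0 < r & forall h, Y h -> `|h| < r ->
        N (x + h) <= N x + f h + e * `|h|].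
Proof.
move=> Y0 YZ cb cd s0; have s8 : 0 < s / 8 by rewrite divr_gt0.
pose F := smoothing Y c (s / 8).
exists (fun x => F x - F 0); split=> [x||x y|x|x].
- by rewrite subr_ge0 smoothing_ge0.
- by rewrite subrr.
- by have := smoothing_lip Y0 cb s8 x y; rewrite -/F; lra.
- by have := smoothing_norm Y0 cb s8 x; rewrite -/F; lra.
- have [f fb fP] := smoothing_smooth Y0 YZ cb cd s8 x.
  exists f => // e e0; have [r r0 rP] := fP e e0.
  by exists r => // h Yh hr; have := rP h Yh hr; rewrite -/F; lra.
Qed.

(** * A variational principle *)
Section Variational.
Context {R : realType} {Z : choiceType}.
Variables (S : set Z) (d : Z -> Z -> R) (rho : nat -> Z -> Z -> R).
Variables (s mu : nat -> R) (f : Z -> R) (C : R) (z0 : Z) (e0 : R).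
Hypothesis d_refl : forall z, d z z = 0.
Hypothesis d_sym : forall z w, d z w = d w z.
Hypothesis d_tri : forall z w v, d z v <= d z w + d w v.
Hypothesis complete : forall z : nat -> Z, (forall n, S (z n)) ->
  (forall e : R, 0 < e -> exists N, forall m n, (N <= m)%N -> (N <= n)%N ->
     d (z m) (z n) < e) ->
  exists2 v, S v & forall e : R, 0 < e -> exists N, forall n, (N <= n)%N ->
     d (z n) v < e.
Hypothesis f_lip : forall z w, f z <= f w + C * d z w.
Hypothesis rho_ge0 : forall n z w, 0 <= rho n z w.
Hypothesis rho_refl : forall n z, rho n z z = 0.
Hypothesis rho_lip : forall n z z' w, rho n z w <= rho n z' w + d z z'.
Hypothesis rho_d : forall n z w, S z -> S w -> d z w <= rho n z w + s n.
Hypothesis s_cvg : forall e : R, 0 < e -> exists N, forall n, (N <= n)%N -> s n < e.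
Hypothesis mu_gt0 : forall n, 0 < mu n.
Hypothesis Sz0 : S z0.
Hypothesis e0_gt0 : 0 < e0.
Hypothesis f_z0 : forall z, S z -> f z0 <= f z + e0.

Let tol n : R := if n is n.+1 then mu n.+1 * (n.+1%:R)^-1 else e0.

Let tol_gt0 n : 0 < tol n.
Proof. by case: n => [//|n]; rewrite mulr_gt0 // invr_gt0 ltr0n. Qed.

(* The state of the construction: the perturbed function, the current closed set
   and its current near minimizer, which is the centre of the next bump. *)
Let near_min (g : Z -> R) (A : set Z) (t : R) (dflt : Z) : Z :=
  xget dflt [set z | A z /\ forall w, A w -> g z <= g w + t].

Let step n (st : (Z -> R) * set Z * Z) : (Z -> R) * set Z * Z :=
  let: (g, A, z) := st in
  let g' w := g w + mu n * rho n w z in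
  let A' := [set w | A w /\ g' w <= g' z] in
  (g', A', near_min g' A' (tol n.+1) z).

Let st := fix st n := if n is n.+1 then step n (st n) else (f, S, z0).

Let g n := (st n).1.1.
Let A n := (st n).1.2.
Let z n := (st n).2.

Let gS n w : g n.+1 w = g n w + mu n * rho n w (z n).
Proof. by rewrite /g /z /=; case: (st n) => [[? ?] ?]. Qed.

Let AS n w : A n.+1 w <-> A n w /\ g n.+1 w <= g n.+1 (z n).
Proof. by rewrite /A /g /z /=; case: (st n) => [[? ?] ?]. Qed.

Let zS n : z n.+1 = near_min (g n.+1) (A n.+1) (tol n.+1) (z n).
Proof. by rewrite /A /g /z /=; case: (st n) => [[? ?] ?]. Qed.

Let A_sub n w : A n w -> S w.
Proof. by elim: n => [//|n IH] /AS[/IH]. Qed.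

Let g_ge n w : f w <= g n w.
Proof.
elim: n => [//|n IH]; rewrite gS (le_trans IH) // lerDl mulr_ge0 //.
exact: ltW.
Qed.

Let near_min_ex (h : Z -> R) (B : set Z) (t : R) (w : Z) : B w -> 0 < t ->
  (forall v, B v -> f v <= h v) -> B `<=` S ->
  exists z, B z /\ forall w, B w -> h z <= h w + t.
Proof.
move=> Bw t0 fh BS.
have hi : has_inf [set h v | v in B].
  split; first by exists (h w), w.
  exists (f z0 - e0) => _ [v Bv <-].
  by have := f_z0 (BS _ Bv); have := fh v Bv; lra.
have [_ [v Bv <-] vt] := inf_adherent t0 hi.
exists v; split=> // u Bu; have : inf [set h v | v in B] <= h u.
  by apply: ge_inf; [case: hi | exists u].
by lra.
Qed.

Let zP n : A n (z n) /\ forall w, A n w -> g n (z n) <= g n w + tol n.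
Proof.
elim: n => [|n [IH _]]; first by split.
rewrite zS /near_min; set P := [set _ | _].
have Pne : exists z, P z.
  apply: (near_min_ex (w := z n)); [exact/AS | exact: tol_gt0 | |].
    by move=> v _; exact: g_ge.
  by move=> w /A_sub.
exact: (xgetPex (z n) Pne).
Qed.

Let A_near n w : A n.+1 w -> d w (z n) <= tol n / mu n + s n.
Proof.
move=> Aw; have [An gn] := (AS n w).1 Aw; have [Azn zmin] := zP n.
apply: le_trans (rho_d n (A_sub An) (A_sub Azn)) _; rewrite lerD2r.
rewrite ler_pdivlMr // mulrC; have := zmin w An.
by move: gn; rewrite !gS rho_refl mulr0; lra.
Qed.

Let A_mono m n : (m <= n)%N -> A n `<=` A m.
Proof.
move=> /subnK <-; elim: (n - m)%N => [//|k IH] w.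
by rewrite addSn => /AS[/IH].
Qed.

Let radius_cvg (e : R) : 0 < e ->
  exists N, forall n, (N <= n)%N -> tol n / mu n + s n < e.
Proof.
move=> e_gt0; have e2 : 0 < e / 2 by rewrite divr_gt0.
have [N NP] := s_cvg e2; exists (maxn N (Num.truncn (e / 2)^-1).+1) => n.
rewrite geq_max => /andP[Nn tn]; have := NP n Nn.
suff : tol n / mu n <= e / 2 by lra.
case: n tn {Nn} => [//|n]; rewrite ltnS => tn.
rewrite /tol mulrAC divff ?gt_eqF // mul1r -[e / 2]invrK.
rewrite lef_pV2 ?posrE ?invr_gt0 ?ltr0n // ltW //.
by apply: lt_le_trans (truncnS_gt _) _; rewrite ler_nat.
Qed.

Let g_lip n : exists2 K : R, 0 <= K & forall w v, g n w <= g n v + K * d w v.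
Proof.
have d0 w v : 0 <= d w v.
  by have := d_tri w v w; rewrite d_refl (d_sym v w); lra.
elim: n => [|n [K K0 IH]].
  exists `|C| => // w v; apply: le_trans (f_lip w v) _.
  by rewrite lerD2l ler_wpM2r // ler_norm.
exists (K + mu n) => [|w v]; first by rewrite addr_ge0 // ltW.
rewrite !gS mulrDl; have := IH w v.
have : mu n * rho n w (z n) <= mu n * (rho n v (z n) + d w v).
  by rewrite ler_wpM2l ?(ltW (mu_gt0 n)).
by rewrite mulrDr; lra.
Qed.

(** A form of the principles of Ekeland ([rho n] is the distance) and of Borwein
and Preiss ([rho n] is a smooth approximation of it, up to [s n]).  The sets on
which the perturbed function is at most its value at the centre shrink to a
point [v].  A point [w] off one of these sets is beaten by the centres that
follow, hence by [v], with the partial sums of the perturbation from some index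
on; the infinite sum is never formed. *)
Lemma variational : exists v (z : nat -> Z), [/\ S v, forall n, S (z n),
  z 0%N = z0, d v z0 <= e0 / mu 0%N + s 0%N &
  forall w, S w -> exists m0, forall m, (m0 <= m)%N ->
    f v + \sum_(n < m) mu n * rho n v (z n) <=
    f w + \sum_(n < m) mu n * rho n w (z n)].
Proof.
have gE m w : g m w = f w + \sum_(n < m) mu n * rho n w (z n).
  elim: m => [|m IH]; first by rewrite big_ord0 addr0.
  by rewrite gS IH big_ord_recr /= addrA.
have Sz n : S (z n) by apply: (@A_sub n); case: (zP n).
have [v Sv vP] : exists2 v, S v & forall e : R, 0 < e -> exists N, forall n,
    (N <= n)%N -> d (z n) v < e.
  apply: complete => // e e_gt0.
  have [N NP] := radius_cvg (divr_gt0 e_gt0 (ltr0Sn _ 1)).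
  exists N.+1 => m n Nm Nn.
  have h k : (N.+1 <= k)%N -> d (z k) (z N) < e / 2.
    move=> Nk; apply: le_lt_trans (A_near _) (NP N (leqnn N)).
    by apply: (A_mono Nk); case: (zP k).
  apply: le_lt_trans (d_tri _ (z N) _) _; rewrite (d_sym (z N)).
  by have := h m Nm; have := h n Nn; lra.
have Av n : A n v.
  elim: n => [//|n IH]; apply/AS; split=> //.
  apply/ler_addgt0Pr => e e_gt0.
  have [K K0 KP] := g_lip n.+1.
  have [N NP] := vP _ (divr_gt0 e_gt0 (ltr_wpDl K0 ltr01)).
  pose k := maxn N n.+1; have := NP k (leq_maxl _ _).
  rewrite ltr_pdivlMr ?ltr_wpDl // d_sym => dk.
  have /AS[_ gk] : A n.+1 (z k).
    by apply: (A_mono (leq_maxr N n.+1)); case: (zP k).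
  have := KP v (z k); have : 0 <= d v (z k).
    by have := d_tri v (z k) v; rewrite d_refl (d_sym (z k) v); lra.
  by nra.
exists v, z; split=> //; first exact: (A_near (Av 1%N)).
have gmono m n w : (m <= n)%N -> g m w <= g n w.
  move=> /subnK <-; elim: (n - m)%N => [//|k IH]; rewrite addSn gS.
  by rewrite (le_trans IH) // lerDl mulr_ge0 // ltW.
move=> w Sw; have [Aw|nAw] := pselect (forall n, A n w).
  exists 0%N => m _; rewrite -!gE; have [K K0 KP] := g_lip m.
  apply/ler_addgt0Pr => e e_gt0; apply: le_trans (KP v w) _; rewrite lerD2l.
  have [N NP] := radius_cvg (divr_gt0 e_gt0 (ltr_wpDl (addr_ge0 K0 K0) ltr01)).
  have := NP N (leqnn N); have := A_near (Aw N.+1); have := A_near (Av N.+1).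
  have := d_tri v (z N) w; rewrite (d_sym (z N) w).
  rewrite ltr_pdivlMr; last by rewrite ltr_wpDl // addr_ge0.
  move: (d v w) (d v (z N)) (d w (z N)) (_ / _ + _) => a b c t.
  by move=> abc bt ct tK; nra.
have [n nAn nmin] : exists2 n, ~ A n w & forall k, (k < n)%N -> A k w.
  have [n nP] : exists n, `[< ~ A n w >].
    by move/existsNP: nAw => [n ?]; exists n; apply/asboolP.
  case: (ex_minnP (ex_intro (fun n => `[< ~ A n w >]) n nP)) => k /asboolP kP kmin.
  exists k => // j jk; apply: contrapT => /asboolP /kmin.
  by rewrite leqNgt jk.
case: n nAn nmin => [//|k] nAk /(_ k (ltnSn k)) Ak.
have gk : g k.+1 (z k) < g k.+1 w.
  by rewrite ltNge; apply/negP => le; apply: nAk; apply/AS.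
exists k.+1 => -[//|m]; rewrite ltnS => km; rewrite -!gE.
have bm : g m.+1 (z m) <= g k.+1 (z k).
  move: km => /subnK <-; elim: (m - k)%N => [//|j IH].
  apply: le_trans IH; rewrite addSn gS rho_refl mulr0 addr0.
  by have /AS[] := (zP (j + k).+1).1.
have /AS[_ vm] := Av m.+1.
apply: le_trans vm _; apply: le_trans bm _; apply: le_trans (ltW gk) _.
exact: gmono.
Qed.

End Variational.

(** * The gap functional and its reflection in a separable subspace *)

(** Level [n.+1] contains level [n] and the values of all operations on finite
lists of elements of level [n]. *)
Lemma closing_off (X : Type) (x0 : X) (op : nat -> seq X -> X) :
  exists q : nat -> X, forall k l, exists j, q j = op k (map q l).
Proof.
pose e := fix e n : nat -> X := if n is n.+1 then fun m =>
  match @unpickle (nat + nat * seq nat)%type m with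
  | Some (inl i) => e n i
  | Some (inr kl) => op kl.1 (map (e n) kl.2)
  | None => x0
  end else fun=> x0.
have eS n i : exists j, e n.+1 j = e n i.
  by exists (pickle (inl i : nat + nat * seq nat)%type); rewrite /= pickleK.
have emono n m i : (n <= m)%N -> exists j, e m j = e n i.
  move=> /subnK <-; elim: (m - n)%N => [|k [j <-]]; first by exists i.
  exact: eS.
pose q m := if @unpickle (nat * nat)%type m is Some ni then e ni.1 ni.2 else x0.
exists q => k l.
have [N [l' ql]] : exists N l', map q l = map (e N) l'.
  elim: l => [|m l [N [l' IH]]]; first by exists 0%N, [::].
  have [n [i qm]] : exists n i, q m = e n i.
    by rewrite /q; case: unpickle => [ni|]; [exists ni.1, ni.2 | exists 0%N, 0%N].
  have [j ej] := emono n (maxn n N) i (leq_maxl _ _).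
  have [l'' el] : exists l'', map (e (maxn n N)) l'' = map (e N) l'.
    elim: {IH} l' => [|i' l' [l'' IH]]; first by exists [::].
    have [j' ej'] := emono N (maxn n N) i' (leq_maxr _ _).
    by exists (j' :: l''); rewrite /= ej' IH.
  by exists (maxn n N), (j :: l''); rewrite /= ej el qm IH.
exists (pickle (N.+1, pickle (inr (k, l') : nat + nat * seq nat)%type)).
by rewrite /q pickleK /= pickleK /= ql.
Qed.

Section Gap.
Context {R : realType} {X : normedModType R}.
Implicit Types (l la lb : seq (R * (nat * X))) (w : nat -> X).

(** An entry [(t, (n, c))] of a list stands for the step [c - a] from the base
point [a], taken with coefficient [t] and charged at the rate [1 / (n + 1)]. *)
Definition comb (a : X) l : X := \sum_(e <- l) e.1 *: (e.2.2 - a).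
Definition cost (a : X) l : R :=
  \sum_(e <- l) e.1 * (`|e.2.2 - a| / e.2.1.+1%:R).
Definition mass l : R := \sum_(e <- l) e.1.
Definition admissible (A : set X) (r : nat -> R) (a : X) l :=
  forall e, e \in l -> [/\ 0 <= e.1, A e.2.2 & `|e.2.2 - a| < r e.2.1].

(** The points [w 0], [w 1], [w 2] are [x1'], [x2'], [x'], and [w 3], [w 4] are the
base points in [A] and [B].  Functionals [f1], [f2] norming [x' - x1'] and
[x' - x2'] jointly, with [|f1 + f2| <= beta], each within [eta] of a normal at
its base point, force this quantity to be nonnegative; [gap_functionals] is the
converse. *)
Definition gap (eta beta : R) w (tau : R) (y : X) la lb : R :=
  Num.max `|tau *: (w 2 - w 0) + y - comb (w 3) la|
          `|tau *: (w 2 - w 1) + y - comb (w 4) lb|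
  + eta * (`|comb (w 3) la| + `|comb (w 4) lb|) + beta * `|y|
  + cost (w 3) la + cost (w 4) lb
  - tau * Num.max `|w 2 - w 0| `|w 2 - w 1|.

Definition lscale (t : R) l := [seq (t * e.1, e.2) | e <- l].

Lemma comb_scale t a l : comb a (lscale t l) = t *: comb a l.
Proof.
by rewrite /comb big_map scaler_sumr; apply: eq_bigr => e _; rewrite scalerA.
Qed.

Lemma cost_scale t a l : cost a (lscale t l) = t * cost a l.
Proof.
by rewrite /cost big_map mulr_sumr; apply: eq_bigr => e _; rewrite mulrA.
Qed.

Lemma mass_scale t l : mass (lscale t l) = t * mass l.
Proof. by rewrite /mass big_map mulr_sumr. Qed.

Lemma admissible_scale A r a t l : 0 <= t -> admissible A r a l ->
  admissible A r a (lscale t l).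
Proof.
by move=> t0 H _ /mapP[e /H[e0 Ae re] ->]; split=> //=; rewrite mulr_ge0.
Qed.

Lemma admissibleW A A' (r r' : nat -> R) a a' l :
  (forall e, e \in l -> A e.2.2 -> `|e.2.2 - a| < r e.2.1 ->
     A' e.2.2 /\ `|e.2.2 - a'| < r' e.2.1) ->
  admissible A r a l -> admissible A' r' a' l.
Proof.
by move=> H al e el; have [e0 Ae re] := al e el; have [? ?] := H e el Ae re; split.
Qed.

Lemma mass_ge0 A r a l : admissible A r a l -> 0 <= mass l.
Proof.
move=> H; rewrite /mass big_seq; apply: sumr_ge0 => e /H[].
by [].
Qed.

Lemma gap_scale eta beta w tau y la lb t : 0 <= t ->
  gap eta beta w (t * tau) (t *: y) (lscale t la) (lscale t lb) =
  t * gap eta beta w tau y la lb.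
Proof.
move=> t0; rewrite /gap !comb_scale !cost_scale -!scalerA -!scalerDr -!scalerBr.
rewrite !normrZ ger0_norm // -maxr_pMr //.
by ring.
Qed.

Lemma comb_lip a a' l s : (forall e, e \in l -> 0 <= e.1) -> mass l <= 1 ->
  `|a - a'| <= s -> `|comb a l - comb a' l| <= s.
Proof.
move=> l0 l1 aa'.
have -> : comb a l - comb a' l = mass l *: (a' - a).
  rewrite /comb /mass scaler_suml -sumrB; apply: eq_bigr => e _.
  by rewrite -scalerBr opprB addrC addrA subrK.
have m0 : 0 <= mass l by rewrite /mass big_seq; apply: sumr_ge0.
rewrite normrZ ger0_norm // distrC (le_trans _ aa') // ler_piMl //.
Qed.

Lemma cost_lip a a' l s : (forall e, e \in l -> 0 <= e.1) -> mass l <= 1 ->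
  `|a - a'| <= s -> cost a' l <= cost a l + s.
Proof.
move=> l0 l1 aa'.
have m0 : 0 <= mass l by rewrite /mass big_seq; apply: sumr_ge0.
have s0 : 0 <= s := le_trans (normr_ge0 _) aa'.
apply: (@le_trans _ _ (cost a l + mass l * s)); last first.
  by rewrite lerD2l ler_piMl.
rewrite /cost /mass mulr_suml -big_split /= big_seq [leRHS]big_seq.
apply: ler_sum => e el; rewrite -mulrDr ler_wpM2l ?l0 //.
have i0 : 0 <= (e.2.1.+1%:R)^-1 :> R by rewrite invr_ge0 ler0n.
have i1 : (e.2.1.+1%:R)^-1 <= 1 :> R.
  by rewrite invf_le1 ?ltr0n // ler1n.
apply: (@le_trans _ _ ((`|e.2.2 - a| + s) * (e.2.1.+1%:R)^-1)).
  rewrite ler_wpM2r // (le_trans (ler_distD a _ _)) // lerD2l //.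
by rewrite mulrDl lerD2l ler_piMr.
Qed.

(** Bounds on the coefficients make the gap Lipschitz in the points, with a
constant that does not depend on the lists. *)
Lemma gap_lip eta beta w w' tau y la lb s : 0 <= eta <= 1 -> 0 <= tau <= 1 ->
  (forall e, e \in la -> 0 <= e.1) -> (forall e, e \in lb -> 0 <= e.1) ->
  mass la <= 1 -> mass lb <= 1 ->
  (forall i, (i < 5)%N -> `|w i - w' i| <= s) ->
  gap eta beta w' tau y la lb <= gap eta beta w tau y la lb + 9 * s.
Proof.
move=> /andP[eta0 eta1] /andP[t0 t1] la0 lb0 la1 lb1 ww'.
have s0 : 0 <= s := le_trans (normr_ge0 _) (ww' 0%N isT).
have ca := comb_lip la0 la1 (ww' 3 isT).
have cb := comb_lip lb0 lb1 (ww' 4 isT).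
have ka := cost_lip la0 la1 (ww' 3 isT).
have kb := cost_lip lb0 lb1 (ww' 4 isT).
have dw i : (i < 2)%N -> `|(w 2 - w i) - (w' 2 - w' i)| <= 2 * s.
  move=> i2; rewrite opprD opprK addrACA [- w i + _]addrC.
  rewrite (le_trans (ler_normD _ _)) // mulr_natl mulr2n.
  rewrite lerD ?ww' // distrC ww' //.
  exact: ltn_trans i2 _.
have dist_norm (u v : X) (t : R) : `|u - v| <= t -> `|v| <= `|u| + t.
  move=> uv; rewrite -lerBlDl (le_trans (lerB_dist _ _)) //.
  by rewrite distrC.
have dist_norm' (u v : X) (t : R) : `|u - v| <= t -> `|u| <= `|v| + t.
  by rewrite distrC; exact: dist_norm.
have nca := dist_norm _ _ _ ca; have ncb := dist_norm _ _ _ cb.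
have n0 := dist_norm' _ _ _ (dw 0%N isT); have n1 := dist_norm' _ _ _ (dw 1%N isT).
have main (i j : nat) l : (i < 2)%N -> `|comb (w j) l - comb (w' j) l| <= s ->
   `|tau *: (w' 2 - w' i) + y - comb (w' j) l| <=
   `|tau *: (w 2 - w i) + y - comb (w j) l| + 3 * s.
  move=> i2 cl; apply: dist_norm.
  have -> : tau *: (w 2 - w i) + y - comb (w j) l -
     (tau *: (w' 2 - w' i) + y - comb (w' j) l) =
     tau *: (w 2 - w i - (w' 2 - w' i)) - (comb (w j) l - comb (w' j) l).
    rewrite [in RHS]scalerBr opprD opprD !opprK.
    rewrite addrACA; congr (_ + _); last by rewrite opprB addrC.
    by rewrite addrACA subrr addr0.
  rewrite (le_trans (ler_normB _ _)) //.
  have : `|tau *: (w 2 - w i - (w' 2 - w' i))| <= 2 * s.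
    rewrite normrZ ger0_norm // (le_trans _ (dw i i2)) // ler_piMl //.
  by lra.
have m0 := main 0%N 3 la isT ca; have m1 := main 1%N 4 lb isT cb.
have h1 : Num.max `|tau *: (w' 2 - w' 0) + y - comb (w' 3) la|
          `|tau *: (w' 2 - w' 1) + y - comb (w' 4) lb| <=
  Num.max `|tau *: (w 2 - w 0) + y - comb (w 3) la|
          `|tau *: (w 2 - w 1) + y - comb (w 4) lb| + 3 * s.
  rewrite ge_max; apply/andP; split.
    by apply: le_trans m0 _; rewrite lerD2r le_max lexx.
  by apply: le_trans m1 _; rewrite lerD2r le_max lexx orbT.
have h2 : eta * (`|comb (w' 3) la| + `|comb (w' 4) lb|) <=
  eta * (`|comb (w 3) la| + `|comb (w 4) lb|) + 2 * s.
  apply: (@le_trans _ _ (eta * (`|comb (w 3) la| + `|comb (w 4) lb| + 2 * s))).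
    by rewrite ler_wpM2l //; lra.
  by rewrite mulrDr lerD2l ler_piMl // mulr_ge0.
have h3 : tau * Num.max `|w 2 - w 0| `|w 2 - w 1| <=
    tau * Num.max `|w' 2 - w' 0| `|w' 2 - w' 1| + 2 * s.
  apply: (@le_trans _ _ (tau * (Num.max `|w' 2 - w' 0| `|w' 2 - w' 1| + 2 * s))).
    rewrite ler_wpM2l // ge_max; apply/andP; split.
      by apply: le_trans n0 _; rewrite lerD2r le_max lexx.
    by apply: le_trans n1 _; rewrite lerD2r le_max lexx orbT.
  by rewrite mulrDr lerD2l ler_piMl // mulr_ge0.
by rewrite /gap; lra.
Qed.

End Gap.

Section Reflection.
Context {R : realType} {X : normedModType R}.
Implicit Types (l la lb : seq (R * (nat * X))) (w : nat -> X).

Lemma common_bound (T : eqType) (l : seq T) (phi : T -> R) :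
  (forall e, e \in l -> 0 < phi e) ->
  exists2 d : R, 0 < d & forall e, e \in l -> d <= phi e.
Proof.
elim: l => [|e l IH] H; first by exists 1.
have [e' e'l|d d0 dl] := IH; first by apply: H; rewrite inE e'l orbT.
exists (Num.min d (phi e)) => [|e']; first by rewrite lt_min d0 H ?mem_head.
rewrite inE => /orP[/eqP ->|/dl le]; first by rewrite ge_min lexx orbT.
by rewrite ge_min le.
Qed.

Lemma common_index l : exists M, forall e, e \in l -> (e.2.1 < M)%N.
Proof.
elim: l => [|e l [M ML]]; first by exists 0%N.
exists (maxn M e.2.1.+1) => e'; rewrite inE => /orP[/eqP ->|/ML le].
  by rewrite leq_max ltnSn orbT.
by rewrite leq_max le.
Qed.

Lemma inv_below (d : R) : 0 < d -> exists p : nat, (p.+1%:R)^-1 <= d.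
Proof.
move=> d0; exists (Num.truncn d^-1).
rewrite -[d]invrK lef_pV2 ?posrE ?invr_gt0 ?ltr0n // ltW //.
by rewrite invrK truncnS_gt.
Qed.

Variables (A B : set X) (eta beta : R).
Hypothesis eta01 : 0 <= eta <= 1.

(** A modulus of Frechet normality is coded by integers: steps shorter than
[inv_radius ks n] are charged at the rate [1 / (n + 1)]. *)
Definition inv_radius (ks : nat -> nat) (n : nat) : R := ((ks n).+1%:R)^-1.

(** Only the finitely many values of [ks] listed in [kd] are used, and a margin is
kept so that nearby base points see the same admissible lists. *)
Definition short_radius (kd : seq nat) (p n : nat) : R :=
  if (n < size kd)%N then inv_radius (nth 0%N kd) n - (p.+1%:R)^-1 else 0.

(** A negative gap with normalized coefficients and with a margin, a property that
depends on the points and on countably many parameters only. *)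
Definition robust_violation (kd : seq nat) (p : nat) w tau y la lb :=
  [/\ 0 <= tau <= 1, mass la <= 1 /\ mass lb <= 1,
      admissible A (short_radius kd p) (w 3) la,
      admissible B (short_radius kd p) (w 4) lb &
      gap eta beta w tau y la lb < - (p.+1%:R)^-1].

Definition violation_points (kd : seq nat) (p : nat) w : seq X :=
  if pselect (exists v : R * X * seq (R * (nat * X)) * seq (R * (nat * X)),
    robust_violation kd p w v.1.1.1 v.1.1.2 v.1.2 v.2) is left H
  then let v := sval (cid H) in
    v.1.1.2 :: [seq e.2.2 | e <- v.1.2] ++ [seq e.2.2 | e <- v.2]
  else [::].

Lemma violation_pointsP kd p w tau y la lb : robust_violation kd p w tau y la lb ->
  exists tau' y' la' lb', robust_violation kd p w tau' y' la' lb' /\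
    [/\ y' \in violation_points kd p w,
        forall e, e \in la' -> e.2.2 \in violation_points kd p w &
        forall e, e \in lb' -> e.2.2 \in violation_points kd p w].
Proof.
move=> Q; rewrite /violation_points; case: pselect => [H|]; last first.
  by case; exists (tau, y, la, lb).
have := svalP (cid H); set v := sval (cid H) => Hv.
exists v.1.1.1, v.1.1.2, v.1.2, v.2; split; first exact: Hv.
split=> [|e el|e el]; rewrite inE ?eqxx // mem_cat.
  by rewrite (map_f (fun e => e.2.2) el) orbT.
by rewrite (map_f (fun e => e.2.2) el) !orbT.
Qed.

(** A negative gap at [w] may be rescaled, the gap being positively homogeneous,
and is then robust at all points near [w]. *)
Lemma violation_robust w tau y la lb (ks : nat -> nat) : 0 <= tau ->
  admissible A (inv_radius ks) (w 3) la -> admissible B (inv_radius ks) (w 4) lb ->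
  gap eta beta w tau y la lb < 0 ->
  exists kd p, (forall n, (n < size kd)%N -> nth 0%N kd n = ks n) /\
    exists2 s : R, 0 < s & s <= (p.+1%:R)^-1 / 9 /\
    forall w', (forall i, (i < 5)%N -> `|w i - w' i| <= s) ->
      exists tau' y' la' lb', robust_violation kd p w' tau' y' la' lb'.
Proof.
move=> t0 Ala Blb lt0.
pose c := (1 + tau + mass la + mass lb)^-1.
have m0 := mass_ge0 Ala; have m0' := mass_ge0 Blb.
have D0 : 0 < 1 + tau + mass la + mass lb by lra.
have c0 : 0 < c by rewrite invr_gt0.
have cle (x : R) : x <= 1 + tau + mass la + mass lb -> c * x <= 1.
  by move=> H; rewrite mulrC ler_pdivrMr // mul1r.
have Ala' := admissible_scale (ltW c0) Ala.
have Blb' := admissible_scale (ltW c0) Blb.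
have lt0' : gap eta beta w (c * tau) (c *: y) (lscale c la) (lscale c lb) < 0.
  by rewrite (gap_scale _ _ _ _ _ _ _ (ltW c0)) pmulr_rlt0.
move: Ala' Blb' lt0'.
set la' := lscale c la; set lb' := lscale c lb => Ala' Blb' lt0'.
have [M ML] := common_index (la' ++ lb').
have [da da0 daP] : exists2 d : R, 0 < d & forall e, e \in la' ->
    d <= inv_radius ks e.2.1 - `|e.2.2 - w 3|.
  by apply: common_bound => e /Ala'[_ _ H]; rewrite subr_gt0.
have [db db0 dbP] : exists2 d : R, 0 < d & forall e, e \in lb' ->
    d <= inv_radius ks e.2.1 - `|e.2.2 - w 4|.
  by apply: common_bound => e /Blb'[_ _ H]; rewrite subr_gt0.
pose g := gap eta beta w (c * tau) (c *: y) la' lb'.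
pose d := Num.min (Num.min da db) (- g) / 3.
have d0 : 0 < d by rewrite divr_gt0 // !lt_min da0 db0 oppr_gt0 lt0'.
have [dda ddb ddg] : [/\ d * 3 <= da, d * 3 <= db & d * 3 <= - g].
  by rewrite /d divfK // !ge_min !lexx ?orbT.
have [p pd] := inv_below d0.
have p0 : 0 < (p.+1%:R)^-1 :> R by rewrite invr_gt0 ltr0n.
set e := (p.+1%:R)^-1 in pd p0.
exists (mkseq ks M), p; split=> [n|].
  by rewrite size_mkseq => nM; rewrite nth_mkseq.
exists (e / 9); first by rewrite divr_gt0.
split=> // w' ww'; exists (c * tau), (c *: y), la', lb'.
have small n : (n < M)%N -> short_radius (mkseq ks M) p n = inv_radius ks n - e.
  by move=> nM; rewrite /short_radius size_mkseq nM /inv_radius nth_mkseq.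
have tr i z : (i < 5)%N -> `|z - w' i| <= `|z - w i| + e / 9.
  move=> i5; rewrite (le_trans (ler_distD (w i) _ _)) // lerD2l.
  exact: ww'.
split.
- by rewrite mulr_ge0 ?(ltW c0) //= cle //; lra.
- by split; rewrite mass_scale cle //; lra.
- apply: admissibleW Ala' => f fl Af fr; split=> //.
  rewrite small; last by apply: ML; rewrite mem_cat fl.
  by have := daP f fl; have := tr 3 f.2.2 isT; lra.
- apply: admissibleW Blb' => f fl Af fr; split=> //.
  rewrite small; last by apply: ML; rewrite mem_cat fl orbT.
  by have := dbP f fl; have := tr 4 f.2.2 isT; lra.
- have : gap eta beta w' (c * tau) (c *: y) la' lb' <= g + 9 * (e / 9).
    apply: gap_lip => //.
    + by rewrite mulr_ge0 ?(ltW c0) //= cle //; lra.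
    + by move=> f /Ala'[].
    + by move=> f /Blb'[].
    + by rewrite mass_scale cle //; lra.
    + by rewrite mass_scale cle //; lra.
  by rewrite -/e; lra.
Qed.

Definition opcode := (nat + rat + seq nat * nat * nat)%type.

(** Vector operations with rational coefficients, the seeds, and the points
occurring in a chosen robust violation at given points. *)
Definition closing_op (seeds : seq X) (k : nat) (l : seq X) : X :=
  match @unpickle opcode k with
  | Some (inl (inl n)) =>
      if n is n.+1 then nth 0 seeds n else nth 0 l 0 + nth 0 l 1
  | Some (inl (inr a)) => ratr a *: nth 0 l 0
  | Some (inr (kd, p, i)) => nth 0 (violation_points kd p (nth 0 l)) i
  | None => 0
  end.

(** Approximate the points by elements of the sequence [q]: a violation at [w]
becomes a robust one at these, which by construction of [q] has a variant with
points of [q]; by robustness this variant is a violation at [w] again. *)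
Lemma gap_reflection (seeds : seq X) : exists q : nat -> X,
  let Y := closure (range q) in
  [/\ forall z, z \in seeds -> Y z,
      (forall u v, Y u -> Y v -> Y (u + v)) /\
      (forall (t : R) u, Y u -> Y (t *: u)) &
  forall w ks, (forall i, (i < 5)%N -> Y (w i)) ->
    (forall (tau : R) (y : X) la lb, 0 <= tau -> Y y ->
      admissible (A `&` Y) (inv_radius ks) (w 3) la ->
      admissible (B `&` Y) (inv_radius ks) (w 4) lb ->
      0 <= gap eta beta w tau y la lb) ->
    forall (tau : R) (y : X) la lb, 0 <= tau ->
      admissible A (inv_radius ks) (w 3) la -> admissible B (inv_radius ks) (w 4) lb ->
      0 <= gap eta beta w tau y la lb].
Proof.
have [q qP] := closing_off 0 (closing_op seeds).
have qop c (ids : seq nat) : exists j,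
    q j = closing_op seeds (pickle (c : opcode)) (map q ids).
  exact: qP.
exists q => Y.
have qY j : Y (q j) by apply: subset_closure; exists j.
have approx (u : X) (e : R) : Y u -> 0 < e -> exists j, `|u - q j| < e.
  move=> Yu e0; have [_ [[j _ <-]]] := Yu _ (nbhsx_ballx u e e0).
  by rewrite -ball_normE /=; exists j.
have closeY (u : X) : (forall e : R, 0 < e -> exists j, `|u - q j| < e) -> Y u.
  move=> H V /nbhs_ballP[e /= e0 eV]; have [j je] := H e e0.
  by exists (q j); split; [exists j | apply: eV; rewrite -ball_normE].
have YD u v : Y u -> Y v -> Y (u + v).
  move=> Yu Yv; apply: closeY => e e0.
  have e2 : 0 < e / 2 by rewrite divr_gt0.
  have [i ui] := approx u _ Yu e2; have [j vj] := approx v _ Yv e2.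
  have [k kE] := qop (inl (inl 0%N)) [:: i; j].
  exists k; rewrite {}kE /closing_op pickleK /= opprD addrACA.
  by rewrite (le_lt_trans (ler_normD _ _)) //; lra.
have YZ (t : R) u : Y u -> Y (t *: u).
  move=> Yu; apply: closeY => e e0.
  pose D := 2 * (`|t| + `|u| + 2).
  have D0 : 0 < D by rewrite mulr_gt0 // ltr_wpDl // addr_ge0.
  pose r := Num.min 1 (e / D).
  have r0 : 0 < r by rewrite lt_min ltr01 divr_gt0.
  have r1 : r <= 1 by rewrite ge_min lexx.
  have rD : r * D <= e by rewrite -ler_pdivlMr // ge_min lexx orbT.
  have [j uj] := approx u r Yu r0.
  have lt : t - r < t + r by lra.
  have [a] := rat_in_itvoo lt; rewrite in_itv /= => /andP[a1 a2].
  have [k kE] := qop (inl (inr a)) [:: j].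
  exists k; rewrite {}kE /closing_op pickleK /=.
  have -> : t *: u - ratr a *: q j = t *: (u - q j) + (t - ratr a) *: q j.
    by rewrite scalerBr scalerBl addrA subrK.
  rewrite (le_lt_trans (ler_normD _ _)) // !normrZ.
  have ta : `|t - ratr a| <= r by rewrite ler_norml; apply/andP; split; lra.
  have qj : `|q j| <= `|u| + 1.
    rewrite -lerBlDl (le_trans (lerB_dist _ _)) // distrC.
    exact: le_trans (ltW uj) r1.
  have h1 : `|t| * `|u - q j| <= `|t| * r by rewrite ler_wpM2l // ltW.
  have h2 : `|t - ratr a| * `|q j| <= r * (`|u| + 1) by rewrite ler_pM.
  have h3 : 0 < r * (`|t| + `|u| + 2) by rewrite mulr_gt0 // ltr_wpDl // addr_ge0.
  move: rD h1 h2 h3; rewrite /D !mulrDr.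
  by lra.
split=> // [z /(nthP 0)[n _ <-]|w ks Yw HY tau y la lb t0 Ala Blb].
  have [k kE] := qop (inl (inl n.+1)) [::].
  by have := qY k; rewrite {}kE /closing_op pickleK.
rewrite leNgt; apply/negP => lt0.
have [kd [p [kdE [s s0 [sp sQ]]]]] := violation_robust t0 Ala Blb lt0.
have js i : exists j, (i < 5)%N -> `|w i - q j| <= s.
  have [i5|] := boolP (i < 5)%N; last by exists 0%N.
  by have [j H] := approx _ _ (Yw i i5) s0; exists j => _; exact: ltW.
pose ind i := sval (cid (js i)).
have indP i : (i < 5)%N -> `|w i - q (ind i)| <= s := svalP (cid (js i)).
pose li := mkseq ind 5.
pose w' := nth 0 (map q li).
have w'E i : (i < 5)%N -> w' i = q (ind i).
  by move=> i5; rewrite /w' (nth_map 0%N) ?size_mkseq // nth_mkseq.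
have ww' i : (i < 5)%N -> `|w i - w' i| <= s.
  by move=> i5; rewrite w'E // indP.
have [tau1 [y1 [la1 [lb1 Q1]]]] := sQ w' ww'.
have [tau2 [y2 [la2 [lb2 [Q2 [y2w la2w lb2w]]]]]] := violation_pointsP Q1.
have wY z : z \in violation_points kd p w' -> Y z.
  move=> /(nthP 0)[i _ <-].
  have [k kE] := qop (inr (kd, p, i)) li.
  by have := qY k; rewrite {}kE /closing_op pickleK.
have [t2 [ma2 mb2] Aa2 Bb2 g2] := Q2.
set e := (p.+1%:R)^-1 in sp g2.
have short_le n (r : R) : r < short_radius kd p n -> 0 <= r ->
    r + s < inv_radius ks n.
  rewrite /short_radius; case: ifP => [nk|_]; last by move=> ? ?; lra.
  rewrite /inv_radius kdE // -/e; have : s <= e by lra.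
  by move: (((ks n).+1%:R)^-1 : R) => c se rc r0; lra.
have tr i z : (i < 5)%N -> `|z - w i| <= `|z - w' i| + s.
  move=> i5; rewrite (le_trans (ler_distD (w' i) _ _)) // lerD2l distrC.
  exact: ww'.
have : 0 <= gap eta beta w tau2 y2 la2 lb2.
  apply: HY => //; first by case/andP: t2.
  - exact: wY.
  - apply: admissibleW Aa2 => f fl Af fr; split; first by split=> //; exact/wY/la2w.
    by apply: le_lt_trans (tr 3 _ isT) _; exact: short_le.
  - apply: admissibleW Bb2 => f fl Af fr; split; first by split=> //; exact/wY/lb2w.
    by apply: le_lt_trans (tr 4 _ isT) _; exact: short_le.
have : gap eta beta w tau2 y2 la2 lb2 <= gap eta beta w' tau2 y2 la2 lb2 + 9 * s.
  apply: gap_lip => //.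
  + by move=> f /Aa2[].
  + by move=> f /Bb2[].
  + by move=> i i5; rewrite distrC ww'.
by lra.
Qed.

End Reflection.

(** * From nonnegative gaps to functionals and Frechet normals *)
Section Functionals.
Context {R : realType} {X : normedModType R}.
Implicit Types (l la lb : seq (R * (nat * X))) (w : nat -> X).

Lemma comb_cat (a : X) l l' : comb a (l ++ l') = comb a l + comb a l'.
Proof. by rewrite /comb big_cat. Qed.

Lemma cost_cat (a : X) l l' : cost a (l ++ l') = cost a l + cost a l'.
Proof. by rewrite /cost big_cat. Qed.

Lemma admissible_cat A (r : nat -> R) (a : X) l l' : admissible A r a l ->
  admissible A r a l' -> admissible A r a (l ++ l').
Proof. by move=> H H' e; rewrite mem_cat => /orP[/H|/H']. Qed.

Lemma comb_nil (a : X) : comb a [::] = 0. Proof. by rewrite /comb big_nil. Qed.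
Lemma cost_nil (a : X) : cost a [::] = 0. Proof. by rewrite /cost big_nil. Qed.

(** The four functionals are found as one linear form on the fourth power of [X].
The sublinear [p] encodes the norm bounds, and the cone of constraints encodes
that the value at [(w 2 - w 0, w 2 - w 1)] is attained, that [f1 + f2] is small,
and that [f1 + e1] and [f2 + e2] are normals with modulus [ks]. *)
Lemma gap_functionals (A B : set X) (eta beta : R) w (ks : nat -> nat) :
  0 <= eta -> 0 <= beta ->
  (forall (tau : R) (y : X) la lb, 0 <= tau ->
     admissible A (inv_radius ks) (w 3) la -> admissible B (inv_radius ks) (w 4) lb ->
     0 <= gap eta beta w tau y la lb) ->
  exists f1 f2 e1 e2 : dual X,
    [/\ (forall k1 k2, f1 k1 + f2 k2 <= Num.max `|k1| `|k2|),
        Num.max `|w 2 - w 0| `|w 2 - w 1| <= f1 (w 2 - w 0) + f2 (w 2 - w 1),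
        `|f1 + f2| <= beta /\ (`|e1| <= eta /\ `|e2| <= eta),
        (forall n c, A c -> `|c - w 3| < inv_radius ks n ->
          (f1 + e1) (c - w 3) <= `|c - w 3| / n.+1%:R) &
        (forall n c, B c -> `|c - w 4| < inv_radius ks n ->
          (f2 + e2) (c - w 4) <= `|c - w 4| / n.+1%:R)].
Proof.
move=> eta0 beta0 Hgap.
pose V : lmodType R := (X * X * X * X)%type.
pose u1 := w 2 - w 0; pose u2 := w 2 - w 1.
pose m := Num.max `|u1| `|u2|.
pose p (v : V) : R := Num.max `|v.1.1.1| `|v.1.1.2| + eta * `|v.1.2| + eta * `|v.2|.
have sp : sublinear p.
  split=> [u v|t u t0]; rewrite /p /=.
    have h1 : Num.max `|u.1.1.1 + v.1.1.1| `|u.1.1.2 + v.1.1.2| <=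
        Num.max `|u.1.1.1| `|u.1.1.2| + Num.max `|v.1.1.1| `|v.1.1.2|.
      rewrite ge_max; apply/andP; split; apply: le_trans (ler_normD _ _) _;
        by rewrite lerD // le_max lexx ?orbT.
    have h2 : eta * `|u.1.2 + v.1.2| <= eta * `|u.1.2| + eta * `|v.1.2|.
      by rewrite -mulrDr ler_wpM2l // ler_normD.
    have h3 : eta * `|u.2 + v.2| <= eta * `|u.2| + eta * `|v.2|.
      by rewrite -mulrDr ler_wpM2l // ler_normD.
    by lra.
  by rewrite !normrZ ger0_norm // -maxr_pMr //; ring.
pose C : set (V * R) := [set x | exists tau y la lb,
  [/\ 0 <= tau, admissible A (inv_radius ks) (w 3) la,
      admissible B (inv_radius ks) (w 4) lb,
      x.1 = (tau *: u1 + y - comb (w 3) la, tau *: u2 + y - comb (w 4) lb,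
             - comb (w 3) la, - comb (w 4) lb) &
      x.2 <= tau * m - beta * `|y| - cost (w 3) la - cost (w 4) lb]].
have cC : convex_cone C.
  split.
  - exists 0, 0, [::], [::]; split=> //=.
      by rewrite !comb_nil !scale0r addr0 subr0 oppr0.
    by rewrite !cost_nil normr0 mul0r mulr0 !subr0.
  - move=> x x' [tau [y [la [lb [t0 Ala Blb -> xc]]]]].
    move=> [tau' [y' [la' [lb' [t0' Ala' Blb' -> xc']]]]].
    exists (tau + tau'), (y + y'), (la ++ la'), (lb ++ lb'); split.
    + exact: addr_ge0.
    + exact: admissible_cat.
    + exact: admissible_cat.
    + rewrite !comb_cat !scalerDl /=.
      have E (a b c a' b' c' : X) :
          a + b - c + (a' + b' - c') = a + a' + (b + b') - (c + c').
        by rewrite addrACA (addrACA a) opprD.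
      have E' (c c' : X) : - c - c' = - (c + c') by rewrite opprD.
      by congr (_, _, _, _); rewrite /= ?E ?E'.
    + rewrite /= !cost_cat.
      have : beta * `|y + y'| <= beta * `|y| + beta * `|y'|.
        by rewrite -mulrDr ler_wpM2l // ler_normD.
      by lra.
  - move=> t x t0 [tau [y [la [lb [tau0 Ala Blb E xc]]]]].
    exists (t * tau), (t *: y), (lscale t la), (lscale t lb); split.
    + by rewrite mulr_ge0 // ltW.
    + exact: admissible_scale (ltW t0) Ala.
    + exact: admissible_scale (ltW t0) Blb.
    + rewrite !comb_scale E -!scalerA -!scalerDr -!scalerBr -!scalerN.
      by [].
    + rewrite /= !cost_scale normrZ gtr0_norm //.
      have : t * x.2 <= t * (tau * m - beta * `|y| - cost (w 3) la - cost (w 4) lb).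
        by rewrite ler_wpM2l // ltW.
      by rewrite !mulrBr !mulrA [beta * t]mulrC.
have Cp x : C x -> x.2 <= p x.1.
  move=> [tau [y [la [lb [t0 Ala Blb -> xc]]]]]; apply: le_trans xc _.
  have := Hgap tau y la lb t0 Ala Blb; rewrite /gap /p /= -/u1 -/u2 -/m !normrN.
  by lra.
have [L [Ll Lp LC]] := mazur_orlicz sp cC Cp.
have LD u v : L (u + v) = L u + L v by have := Ll 1 u v; rewrite !scale1r.
have LZ (t : R) v : L (t *: v) = t * L v.
  have L0 : L 0 = 0 by have := LD 0 0; rewrite addr0; lra.
  by have := Ll t v 0; rewrite !addr0 L0 addr0.
have mk (i : X -> V) : (forall (t : R) x y, i (t *: x + y) = t *: i x + i y) ->
    forall M, (forall x, p (i x) <= M * `|x|) ->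
    exists2 f : dual X, (forall x, f x = L (i x)) & forall x, f x <= M * `|x|.
  move=> il M iM; have lin : linear (L \o i : X -> R^o).
    by move=> t x y; rewrite /= il LD LZ.
  have bnd x : (L \o i) x <= M * `|x| by rewrite /= (le_trans (Lp _)).
  have [f fE] := dual_of_bounded lin bnd.
  by exists f => // x; rewrite fE; exact: bnd.
have [f1 f1E f1b] : exists2 f : dual X, (forall x, f x = L (x, 0, 0, 0)) &
    forall x, f x <= 1 * `|x|.
  apply: (mk (fun x => (x, 0, 0, 0))) => [t x y|x].
    by congr (_, _, _, _); rewrite /= ?scaler0 ?addr0.
  by rewrite /p /= !normr0 !mulr0 !addr0 mul1r ge_max lexx normr_ge0.
have [f2 f2E f2b] : exists2 f : dual X, (forall x, f x = L (0, x, 0, 0)) &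
    forall x, f x <= 1 * `|x|.
  apply: (mk (fun x => (0, x, 0, 0))) => [t x y|x].
    by congr (_, _, _, _); rewrite /= ?scaler0 ?addr0.
  by rewrite /p /= !normr0 !mulr0 !addr0 mul1r ge_max lexx normr_ge0.
have [e1 e1E e1b] : exists2 f : dual X, (forall x, f x = L (0, 0, x, 0)) &
    forall x, f x <= eta * `|x|.
  apply: (mk (fun x => (0, 0, x, 0))) => [t x y|x].
    by congr (_, _, _, _); rewrite /= ?scaler0 ?addr0.
  by rewrite /p /= !normr0 mulr0 addr0 maxxx add0r.
have [e2 e2E e2b] : exists2 f : dual X, (forall x, f x = L (0, 0, 0, x)) &
    forall x, f x <= eta * `|x|.
  apply: (mk (fun x => (0, 0, 0, x))) => [t x y|x].
    by congr (_, _, _, _); rewrite /= ?scaler0 ?addr0.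
  by rewrite /p /= !normr0 mulr0 addr0 maxxx add0r.
have LE a b c d : L (a, b, c, d) = f1 a + f2 b + e1 c + e2 d.
  rewrite f1E f2E e1E e2E -!LD; congr L.
  by congr (_, _, _, _); rewrite /= ?addr0 ?add0r.
exists f1, f2, e1, e2; split.
- move=> k1 k2; have := Lp (k1, k2, 0, 0); rewrite LE !dual0 !addr0.
  by rewrite /p /= normr0 mulr0 !addr0.
- have := LC ((u1, u2, 0, 0), m); rewrite /= LE !dual0 !addr0; apply.
  exists 1, 0, [::], [::]; split=> //=.
    by rewrite !comb_nil !scale1r !addr0 !subr0 oppr0.
  by rewrite !cost_nil normr0 mul1r mulr0 !subr0.
- split; last by split; apply: dual_norm_leM.
  apply: dual_norm_leM => // y; rewrite -[leLHS]/(f1 y + f2 y).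
  have := LC ((- y, - y, 0, 0), - (beta * `|y|)); rewrite /= LE !dual0 !addr0 !dualN.
  move=> H; suff : - (beta * `|y|) <= - f1 y - f2 y by lra.
  apply: H; exists 0, (- y), [::], [::]; split=> //=.
    by rewrite !comb_nil !scale0r !add0r ?subr0 ?oppr0.
  by rewrite !cost_nil normrN mul0r sub0r !subr0.
- move=> n c Ac cr; rewrite -[leLHS]/(f1 (c - w 3) + e1 (c - w 3)).
  have Al : admissible A (inv_radius ks) (w 3) [:: (1, (n, c))].
    by move=> e; rewrite inE => /eqP ->; split.
  have cE : comb (w 3) [:: (1, (n, c))] = c - w 3.
    by rewrite /comb big_seq1 /= scale1r.
  have kE : cost (w 3) [:: (1, (n, c))] = `|c - w 3| / n.+1%:R.
    by rewrite /cost big_seq1 /= mul1r.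
  have := LC ((- (c - w 3), 0, - (c - w 3), 0), - (`|c - w 3| / n.+1%:R)).
  rewrite /= LE !dual0 !addr0 !dualN.
  move=> H.
  suff : - (`|c - w 3| / n.+1%:R) <= - f1 (c - w 3) - e1 (c - w 3).
    by rewrite -opprD lerN2.
  apply: H; exists 0, 0, [:: (1, (n, c))], [::]; split=> //=.
    by rewrite cE !comb_nil !scale0r !add0r ?subr0 ?oppr0.
  by rewrite kE !cost_nil normr0 mul0r mulr0 !subr0 sub0r.
- move=> n c Bc cr; rewrite -[leLHS]/(f2 (c - w 4) + e2 (c - w 4)).
  have Bl : admissible B (inv_radius ks) (w 4) [:: (1, (n, c))].
    by move=> e; rewrite inE => /eqP ->; split.
  have cE : comb (w 4) [:: (1, (n, c))] = c - w 4.
    by rewrite /comb big_seq1 /= scale1r.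
  have kE : cost (w 4) [:: (1, (n, c))] = `|c - w 4| / n.+1%:R.
    by rewrite /cost big_seq1 /= mul1r.
  have := LC ((0, - (c - w 4), 0, - (c - w 4)), - (`|c - w 4| / n.+1%:R)).
  rewrite /= LE !dual0 !add0r !addr0 !dualN.
  move=> H.
  suff : - (`|c - w 4| / n.+1%:R) <= - f2 (c - w 4) - e2 (c - w 4).
    by rewrite -opprD lerN2.
  apply: H; exists 0, 0, [::], [:: (1, (n, c))]; split=> //=.
    by rewrite cE !comb_nil !scale0r !add0r ?subr0 ?oppr0.
  by rewrite kE !cost_nil normr0 mul0r mulr0 !subr0 sub0r.
Qed.

End Functionals.

Section NormalCone.
Context {R : realType} {X : normedModType R}.
Implicit Types (f g : dual X) (A : set X).

Lemma frechet_normal_of_modulus A (a : X) f (ks : nat -> nat) :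
  (forall n c, A c -> `|c - a| < inv_radius ks n ->
     f (c - a) <= `|c - a| / n.+1%:R) ->
  frechet_normal_cone A a f.
Proof.
move=> fA; apply/lee_addgt0Pr => e e0; rewrite add0e.
have [n ne] := inv_below e0.
have r0 : 0 < inv_radius ks n :> R by rewrite invr_gt0 ltr0n.
pose W : set X := (A `\ a) `&` ball a (inv_radius ks n).
apply: (@le_trans _ _ (ereal_sup ((fun c : X => (f (c - a) / `|c - a|)%:E) @` W))).
  apply: ereal_inf_lbound; exists W => //.
  rewrite /within /=; apply: filterS (nbhsx_ballx a _ r0) => c ca Ac.
  by split.
apply: ge_ereal_sup => z [c [[Ac /eqP ca]]].
rewrite -ball_normE /= distrC => cr <- {z}.
have nc0 : 0 < `|c - a| by rewrite normr_gt0 subr_eq0.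
rewrite lee_fin ler_pdivrMr //; apply: le_trans (fA n c Ac cr) _.
by rewrite mulrC ler_wpM2r.
Qed.

Lemma edist_inf_lt (T : normedModType R) (S : set T) (x y : T) (r s : R) :
  S y -> `|x - y| <= s -> s < r -> (edist_inf S x < r%:E)%E.
Proof.
move=> Sy xy sr; have s0 : 0 <= s := le_trans (normr_ge0 _) xy.
pose t := (s + r) / 2.
have ts : s < t by rewrite /t; lra.
have tr : t < r by rewrite /t; lra.
apply: (@le_lt_trans _ _ t%:E); last by rewrite lte_fin.
apply: (@le_trans _ _ (edist (x, y))).
  by apply: ereal_inf_lbound; exists y.
apply: edist_fin => /=; first exact: le_lt_trans s0 ts.
by rewrite -ball_normE /=; apply: le_lt_trans xy ts.
Qed.

Lemma dual_norm_le1 f (M : R) : (forall x, `|x| <= 1 -> f x <= M) -> `|f| <= M.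
Proof.
move=> fM; apply: dual_norm_le => x x1; rewrite ler_norml fM // andbT lerNl.
by rewrite -dualN fM // normrN.
Qed.

(** The inequality [f1 u1 + f2 u2 <= |f1| |u1| + |f2| |u2|] is an equality.  If one
of the [u] had smaller norm, the functional in front of it would vanish and the
other would have norm [1], which [|f1 + f2| < 1] excludes. *)
Lemma max_norm_subgradient f1 f2 (u1 u2 : X) :
  (forall k1 k2, f1 k1 + f2 k2 <= Num.max `|k1| `|k2|) ->
  Num.max `|u1| `|u2| <= f1 u1 + f2 u2 ->
  0 < Num.max `|u1| `|u2| -> `|f1 + f2| < 1 ->
  [/\ `|u1| = `|u2|, `|f1| + `|f2| = 1, f1 u1 = `|f1| * `|u1| &
      f2 u2 = `|f2| * `|u2|].
Proof.
move=> fmax fu m0 f12; set m := Num.max _ _ in fu m0.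
have sum1 : `|f1| + `|f2| <= 1.
  rewrite -lerBrDr; apply: dual_norm_le1 => x x1.
  rewrite lerBrDr -lerBrDl; apply: dual_norm_le1 => y y1.
  by rewrite lerBrDl (le_trans (fmax x y)) // ge_max x1.
have um1 : `|u1| <= m by rewrite le_max lexx.
have um2 : `|u2| <= m by rewrite le_max lexx orbT.
have b1 : f1 u1 <= `|f1| * `|u1| by apply: le_trans (dual_norm_bound f1 u1); exact: ler_norm.
have b2 : f2 u2 <= `|f2| * `|u2| by apply: le_trans (dual_norm_bound f2 u2); exact: ler_norm.
have c1 : `|f1| * `|u1| <= `|f1| * m by rewrite ler_wpM2l.
have c2 : `|f2| * `|u2| <= `|f2| * m by rewrite ler_wpM2l.
have tri : `|f1 + f2| <= `|f1| + `|f2| := ler_normD _ _.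
have sm : (`|f1| + `|f2|) * m <= m by rewrite ler_piMl // ltW.
have E : `|f1| + `|f2| = 1.
  apply/eqP; rewrite eq_le sum1 /= -(ler_pM2r m0) mul1r mulrDl.
  by lra.
have E1 : `|f1| * `|u1| = `|f1| * m.
  by apply/eqP; rewrite eq_le c1 /=; rewrite mulrDl in sm; lra.
have E2 : `|f2| * `|u2| = `|f2| * m.
  by apply/eqP; rewrite eq_le c2 /=; rewrite mulrDl in sm; lra.
have nz1 : `|f1| != 0.
  apply: contraTneq f12 => z1; rewrite -leNgt -E z1 add0r.
  by rewrite (normr0_eq0 z1) add0r.
have nz2 : `|f2| != 0.
  apply: contraTneq f12 => z2; rewrite -leNgt -E z2 addr0.
  by rewrite (normr0_eq0 z2) addr0.
have U1 : `|u1| = m by apply: (mulfI nz1).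
have U2 : `|u2| = m by apply: (mulfI nz2).
have EM : `|f1| * m + `|f2| * m = m by rewrite -mulrDl E mul1r.
split=> //; first by rewrite U1 U2.
- by apply/eqP; rewrite eq_le b1 /=; rewrite U1; lra.
- by apply/eqP; rewrite eq_le b2 /=; rewrite U2; lra.
Qed.

End NormalCone.

(** * Minimizing a smoothly coupled energy in the separable subspace *)
Section UniformSmooth.
Context {R : realType} {X : normedModType R}.

Lemma sum_wgt_tail (M m : nat) :
  \sum_(n < m) (if (n < M)%N then 0 else wgt n) <= 2^-1 ^+ M :> R.
Proof.
suff H : \sum_(n < m) (if (n < M)%N then 0 else wgt n) <=
    2^-1 ^+ M - 2^-1 ^+ (maxn M m) :> R.
  by apply: le_trans H _; rewrite gerBl exprn_ge0 // invr_ge0 ler0n.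
elim: m => [|m IH]; first by rewrite big_ord0 maxn0 subrr.
rewrite big_ord_recr /=; have [mM|Mm] := ltnP m M.
  rewrite addr0 (le_trans IH) // (maxn_idPl (ltnW mM)).
  by rewrite (maxn_idPl mM).
apply: le_trans (lerD IH (lexx _)) _.
rewrite (maxn_idPr Mm) (maxn_idPr (leqW Mm)) /wgt exprS.
by set a := _ ^+ m; lra.
Qed.

Lemma wgt_small (e : R) : 0 < e -> exists M : nat, 2^-1 ^+ M <= e.
Proof.
move=> e0; have [p pe] := inv_below e0; exists p; apply: le_trans pe.
rewrite exprVn lef_pV2 ?posrE ?ltr0n ?exprn_gt0 // -natrX ler_nat.
exact: ltn_expl.
Qed.

(** Differentiability of a series, for all partial sums at once: finitely many
terms share a modulus, and the others contribute at most twice the remaining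
weight times [|h|]. *)
Lemma uniform_smooth (Y : set X) (N : nat -> X -> R) (a : nat -> X)
    (psi : nat -> dual X) :
  (forall n x y, N n x <= N n y + `|x - y|) ->
  (forall n, dual_ball (psi n)) ->
  (forall n (e : R), 0 < e -> exists2 r : R, 0 < r & forall h, Y h -> `|h| < r ->
     N n (a n + h) <= N n (a n) + psi n h + e * `|h|) ->
  forall e : R, 0 < e -> exists2 r : R, 0 < r & forall m h, Y h -> `|h| < r ->
    \sum_(n < m) wgt n * N n (a n + h) <=
    \sum_(n < m) wgt n * N n (a n) + \sum_(n < m) wgt n * psi n h
      + e * `|h|.
Proof.
move=> Nlip psib Nsm e e0.
have e4 : 0 < e / 4 by rewrite divr_gt0.
have e2 : 0 < e / 2 by rewrite divr_gt0.
have [M Me] := wgt_small e4.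
have [r r0 rP] : exists2 r : R, 0 < r & forall n h, (n < M)%N -> Y h -> `|h| < r ->
    N n (a n + h) <= N n (a n) + psi n h + e / 2 * `|h|.
  elim: M {Me} => [|M [r r0 rP]]; first by exists 1.
  have [s s0 sP] := Nsm M _ e2.
  exists (Num.min r s) => [|n h]; first by rewrite lt_min r0.
  rewrite lt_min ltnS leq_eqVlt => /orP[/eqP ->|nM] Yh /andP[hr hs].
    exact: sP.
  exact: rP.
exists r => // m h Yh hr.
have term n : wgt n * N n (a n + h) <=
    wgt n * N n (a n) + wgt n * psi n h +
    (e / 2 * `|h| * wgt n +
     2 * `|h| * (if (n < M)%N then 0 else wgt n)).
  have w0 := wgt_gt0 (R := R) n; have h0 := normr_ge0 h.
  rewrite -mulrDr; case: ifP => nM.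
    rewrite mulr0 addr0 [e / 2 * `|h| * _]mulrC -mulrDr ler_pM2l //.
    exact: rP.
  have b1 : N n (a n + h) <= N n (a n) + `|h|.
    by have := Nlip n (a n + h) (a n); rewrite addrAC subrr add0r.
  have b2 : - `|h| <= psi n h.
    by have := psib n h; rewrite ler_norml => /andP[].
  have b3 : 0 <= e / 2 * `|h| by rewrite mulr_ge0 // ltW.
  rewrite -mulrDl [(_ + _) * wgt n]mulrC -mulrDr ler_pM2l //.
  by lra.
apply: (@le_trans _ _ (\sum_(n < m) (wgt n * N n (a n) + wgt n * psi n h +
    (e / 2 * `|h| * wgt n +
     2 * `|h| * (if (n < M)%N then 0 else wgt n))))).
  by apply: ler_sum => n _; exact: term.
rewrite !big_split /= lerD2l -!mulr_sumr sum_wgt.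
have := sum_wgt_tail M m; set t := \sum_(i < m) _ => tM.
have p0 : 0 <= 2^-1 ^+ m :> R by rewrite exprn_ge0 // invr_ge0.
have h0 := normr_ge0 h.
have h1 : 2 * `|h| * t <= 2 * `|h| * (e / 4).
  by rewrite ler_wpM2l ?mulr_ge0 // (le_trans tM).
have h2 : e / 2 * `|h| * (1 - 2^-1 ^+ m) <= e / 2 * `|h|.
  by rewrite ler_piMr ?gerBl // mulr_ge0 // ltW.
by lra.
Qed.

Lemma sum_wgt_psi (psi : nat -> dual X) m h : (forall n, dual_ball (psi n)) ->
  `|\sum_(n < m) wgt n * psi n h| <= `|h|.
Proof.
move=> pb; apply: le_trans (ler_norm_sum _ _ _) _.
apply: (@le_trans _ _ (\sum_(n < m) wgt n * `|h|)).
  apply: ler_sum => n _; rewrite normrM gtr0_norm ?wgt_gt0 //.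
  by rewrite ler_wpM2l ?(ltW (wgt_gt0 _)) // pb.
by rewrite -mulr_suml sum_wgt ler_piMl // gerBl exprn_ge0 // invr_ge0 ler0n.
Qed.

End UniformSmooth.

Section SmoothMinimum.
Context {R : realType} {X : completeNormedModType R}.
Implicit Types (l la lb : seq (R * (nat * X))) (w : nat -> X).

Lemma complete_seq (D : set X) (u : nat -> X) : closed D ->
  (forall n, D (u n)) ->
  (forall e : R, 0 < e -> exists N, forall m n, (N <= m)%N -> (N <= n)%N ->
     `|u m - u n| < e) ->
  exists2 x, D x & forall e : R, 0 < e -> exists N, forall n, (N <= n)%N ->
     `|u n - x| < e.
Proof.
move=> cD Du cu.
have /cauchy_cvg uc : cauchy (u @ \oo).
  apply/cauchy_ballP => e e0; have [N NP] := cu e e0.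
  exists ([set x | exists2 n, (N <= n)%N & x = u n],
          [set x | exists2 n, (N <= n)%N & x = u n]) => /=.
    by split; exists N => // n /= Nn; exists n.
  move=> [x y] /= [[m Nm ->] [n Nn ->]]; rewrite -ball_normE /=.
  exact: NP.
have ul : forall e : R, 0 < e -> exists N, forall n, (N <= n)%N ->
     `|u n - lim (u @ \oo)| < e.
  move=> e e0; have /cvgrPdist_lt/(_ e e0)[N _ NP] := uc.
  by exists N => n Nn; rewrite distrC; exact: NP.
exists (lim (u @ \oo)) => //; apply: cD => V /nbhs_ballP[e /= e0 eV].
have [N NP] := ul e e0; exists (u N); split=> //; apply: eV.
by rewrite -ball_normE /= distrC NP.
Qed.

Lemma comb_linear (L : X -> R) (a : X) l :
  (forall u v, L (u + v) = L u + L v) -> (forall (t : R) u, L (t *: u) = t * L u) ->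
  L (comb a l) = \sum_(e <- l) e.1 * L (e.2.2 - a).
Proof.
move=> LD LZ; rewrite /comb; elim: l => [|e l IH].
  by rewrite !big_nil; have := LZ 0 0; rewrite scale0r mul0r.
by rewrite !big_cons (LD (e.1 *: _)) LZ IH.
Qed.

Lemma comb_mem (Y : set X) (a : X) l : Y 0 ->
  (forall u v, Y u -> Y v -> Y (u + v)) ->
  (forall (t : R) u, Y u -> Y (t *: u)) ->
  Y a -> (forall e, e \in l -> Y e.2.2) -> Y (comb a l).
Proof.
move=> Y0 YD YZ Ya; rewrite /comb; elim: l => [|e l IH] H; first by rewrite big_nil.
rewrite big_cons; apply: (YD); last first.
  by apply: IH => e' e'l; apply: H; rewrite inE e'l orbT.
apply/YZ; apply: (YD); first by apply: H; rewrite mem_head.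
by rewrite -scaleN1r; apply: (YZ).
Qed.

Lemma eventually_all (T : eqType) (r : seq T) (P : T -> nat -> Prop) :
  (forall e, e \in r -> exists m0, forall m, (m0 <= m)%N -> P e m) ->
  exists m0, forall m, (m0 <= m)%N -> forall e, e \in r -> P e m.
Proof.
elim: r => [|e r IH] H; first by exists 0%N.
have [m1 H1] : exists m0, forall m, (m0 <= m)%N -> forall e, e \in r -> P e m.
  by apply: IH => e' e'r; apply: H; rewrite inE e'r orbT.
have [m2 H2] := H e (mem_head _ _).
exists (maxn m1 m2) => m; rewrite geq_max => /andP[m1m m2m] e'.
by rewrite inE => /orP[/eqP ->|]; [exact: H2 | exact: H1].
Qed.

Lemma maxnormD (a b c d : X) :
  Num.max `|a + c| `|b + d| <= Num.max `|a| `|b| + Num.max `|c| `|d|.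
Proof.
rewrite ge_max; apply/andP; split; apply: le_trans (ler_normD _ _) _;
  by rewrite lerD // le_max lexx ?orbT.
Qed.

Lemma maxnormZ (t : R) (a b : X) : 0 <= t ->
  Num.max `|t *: a| `|t *: b| = t * Num.max `|a| `|b|.
Proof. by move=> t0; rewrite !normrZ ger0_norm // -maxr_pMr. Qed.

(** The difference quotients of the convex function
[t |-> max (|u1 + t k1|, |u2 + t k2|)] increase with [t], and [t <= 1 / tau]. *)
Lemma maxnorm_slope (tau t : R) (u1 u2 k1 k2 : X) : 0 < t -> t * tau <= 1 ->
  Num.max `|u1 + t *: k1| `|u2 + t *: k2| - Num.max `|u1| `|u2| <=
  t * (Num.max `|tau *: u1 + k1| `|tau *: u2 + k2| -
       tau * Num.max `|u1| `|u2|).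
Proof.
move=> t0 tt.
have E (u k : X) : u + t *: k = t *: (tau *: u + k) + (1 - t * tau) *: u.
  by rewrite scalerDr scalerA scalerBl scale1r [RHS]addrC [RHS]addrA subrK.
rewrite (E u1) (E u2); have := maxnormD (t *: (tau *: u1 + k1))
  (t *: (tau *: u2 + k2)) ((1 - t * tau) *: u1) ((1 - t * tau) *: u2).
rewrite !maxnormZ ?(ltW t0) ?subr_ge0 //.
by rewrite mulrBl mul1r mulrBr mulrA; lra.
Qed.

Definition smooth_along (Y : set X) (N : X -> R) := forall x,
  exists2 f : dual X, dual_ball f & forall e : R, 0 < e ->
    exists2 r : R, 0 < r & forall h, Y h -> `|h| < r ->
      N (x + h) <= N x + f h + e * `|h|.

Definition approx_norm (Y : set X) (s : R) (N : X -> R) :=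
  [/\ forall x, 0 <= N x, N 0 = 0, forall x y, N x <= N y + `|x - y|,
      forall x, `|x| <= N x + s & smooth_along Y N].

End SmoothMinimum.

Lemma small_step (R : realType) (tau r1 r2 H1 H2 : R) : 0 <= tau ->
  0 < r1 -> 0 < r2 -> 0 <= H1 -> 0 <= H2 ->
  exists t, [/\ 0 < t, t * tau <= 1, t * H1 < r1 & t * H2 < r2].
Proof.
move=> tau0 r10 r20 H10 H20; pose D := 1 + tau + H1 + H2.
have D0 : 0 < D by rewrite /D; lra.
have r0 : 0 < Num.min 1 (Num.min r1 r2) by rewrite !lt_min ltr01 r10.
pose t := Num.min 1 (Num.min r1 r2) / D.
have t0 : 0 < t by rewrite divr_gt0.
have tD : t * D = Num.min 1 (Num.min r1 r2) by rewrite /t divfK // gt_eqF.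
exists t; split=> //.
- apply: (@le_trans _ _ (t * D)); last by rewrite tD ge_min lexx.
  by rewrite ler_pM2l // /D; lra.
- apply: (@lt_le_trans _ _ (t * D)); last by rewrite tD !ge_min lexx orbT.
  by rewrite ltr_pM2l // /D; lra.
- apply: (@lt_le_trans _ _ (t * D)); last by rewrite tD !ge_min lexx !orbT.
  by rewrite ltr_pM2l // /D; lra.
Qed.

Lemma descent_rate (R : realType) (t M0 M1 Mk theta beta kap BX BX' a1 a2 KX'
    N1 N1' N2 N2' p1 p2 s1 s2 s3 s4 H1 H2 Yn tauM : R) : 0 < t ->
  M0 + beta * BX + kap * (a1 + a2) + 2 * N1 + 2 * N2 + theta * (s2 + s3 + s4) <=
  M1 + BX' + KX' + 2 * N1' + 2 * N2' + theta * (s1 + s3 + s4) ->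
  theta * s1 <= theta * (s2 + t * (H1 + H2 + Yn)) ->
  BX' <= beta * (BX + t * Yn) ->
  KX' <= kap * (a1 + t * H1 + (a2 + t * H2)) ->
  N1' <= N1 + t * p1 + theta * (t * H1) ->
  N2' <= N2 + t * p2 + theta * (t * H2) ->
  M1 - M0 <= t * (Mk - tauM) ->
  0 <= Mk - tauM + (beta + theta) * Yn + (kap + theta * 3) * (H1 + H2)
    + 2 * p1 + 2 * p2.
Proof.
move=> t0 mT thB bT kT h1 h2 sl; rewrite -(pmulr_rge0 _ t0).
by lra.
Qed.

Lemma descent_sum (R : realType) (Mk theta beta beta' kap eta p1 p2 H1 H2 Yn tauM
    ca cb P1 P2 : R) :
  0 <= Mk - tauM + (beta + theta) * Yn + (kap + theta * 3) * (H1 + H2)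
    + 2 * p1 + 2 * p2 ->
  2 * p1 - P1 <= ca -> 2 * p2 - P2 <= cb -> P1 <= theta * H1 -> P2 <= theta * H2 ->
  (kap + theta * 4) * (H1 + H2) <= eta * (H1 + H2) ->
  (beta + theta) * Yn <= beta' * Yn ->
  0 <= Mk + eta * (H1 + H2) + beta' * Yn + ca + cb - tauM.
Proof. by lra. Qed.

Section GapInSubspace.
Context {R : realType} {X : completeNormedModType R}.
Implicit Types (l la lb : seq (R * (nat * X))).
Variables (Y A B : set X) (ah bh xh : X) (beta kap : R).
Hypothesis Ycl : closed Y.
Hypothesis Y0 : Y 0.
Hypothesis YD : forall u v, Y u -> Y v -> Y (u + v).
Hypothesis YZ : forall (t : R) u, Y u -> Y (t *: u).
Hypothesis Yapprox : forall s : R, 0 < s -> exists N : X -> R, approx_norm Y s N.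
Hypotheses (Acl : closed A) (Bcl : closed B).
Hypotheses (Aah : A ah) (Bbh : B bh) (Yah : Y ah) (Ybh : Y bh) (Yxh : Y xh).
Hypotheses (beta01 : 0 <= beta <= 1) (kap01 : 0 <= kap <= 1).
Hypothesis hmin : forall a b x, A a -> B b ->
  Num.max `|xh - ah| `|xh - bh| <=
  Num.max `|x - a| `|x - b| + beta * `|x - xh| + kap * (`|a - ah| + `|b - bh|).

(* The five components stand for [x1], [x2], [x] and the base points [a], [b]. *)
Let Z : Type := (X * X * X * X * X)%type.
Let dist (z z' : Z) : R := `|z.1.1.1.1 - z'.1.1.1.1| + `|z.1.1.1.2 - z'.1.1.1.2|
  + `|z.1.1.2 - z'.1.1.2| + `|z.1.2 - z'.1.2| + `|z.2 - z'.2|.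

Let S : set Z := [set z | [/\ Y z.1.1.1.1, Y z.1.1.1.2, Y z.1.1.2,
  (A `&` Y) z.1.2 & (B `&` Y) z.2]].

Let z0 : Z := (ah, bh, xh, ah, bh).

Let dist_refl z : dist z z = 0.
Proof. by rewrite /dist !subrr normr0 !addr0. Qed.

Let dist_sym z w : dist z w = dist w z.
Proof. by rewrite /dist; congr (_ + _ + _ + _ + _); rewrite distrC. Qed.

Let dist_tri z w v : dist z v <= dist z w + dist w v.
Proof.
rewrite /dist.
have := ler_distD w.1.1.1.1 z.1.1.1.1 v.1.1.1.1.
have := ler_distD w.1.1.1.2 z.1.1.1.2 v.1.1.1.2.
have := ler_distD w.1.1.2 z.1.1.2 v.1.1.2.
have := ler_distD w.1.2 z.1.2 v.1.2.
have := ler_distD w.2 z.2 v.2.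
by lra.
Qed.

Let dist_ge z w : [/\ `|z.1.1.1.1 - w.1.1.1.1| <= dist z w,
  `|z.1.1.1.2 - w.1.1.1.2| <= dist z w, `|z.1.1.2 - w.1.1.2| <= dist z w,
  `|z.1.2 - w.1.2| <= dist z w & `|z.2 - w.2| <= dist z w].
Proof.
rewrite /dist.
have := normr_ge0 (z.1.1.1.1 - w.1.1.1.1).
have := normr_ge0 (z.1.1.1.2 - w.1.1.1.2).
have := normr_ge0 (z.1.1.2 - w.1.1.2).
have := normr_ge0 (z.1.2 - w.1.2).
have := normr_ge0 (z.2 - w.2).
by move=> *; split; lra.
Qed.

Let S_complete (z : nat -> Z) : (forall n, S (z n)) ->
  (forall e : R, 0 < e -> exists N, forall m n, (N <= m)%N -> (N <= n)%N ->
     dist (z m) (z n) < e) ->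
  exists2 v, S v & forall e : R, 0 < e -> exists N, forall n, (N <= n)%N ->
     dist (z n) v < e.
Proof.
move=> Sz cz.
have coord (pr : Z -> X) (D : set X) : closed D -> (forall n, D (pr (z n))) ->
    (forall u v, `|pr u - pr v| <= dist u v) ->
    exists2 x, D x & forall e : R, 0 < e -> exists N, forall n, (N <= n)%N ->
     `|pr (z n) - x| < e.
  move=> cD Dz prd; apply: complete_seq => // e e0.
  have [N NP] := cz e e0; exists N => m n Nm Nn.
  exact: le_lt_trans (prd _ _) (NP m n Nm Nn).
have [x1 Yx1 x1P] : exists2 x, Y x & forall e : R, 0 < e -> exists N,
    forall n, (N <= n)%N -> `|(z n).1.1.1.1 - x| < e.
  apply: (coord (fun z => z.1.1.1.1)) => // [n|u v]; first by case: (Sz n).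
  by case: (dist_ge u v).
have [x2 Yx2 x2P] : exists2 x, Y x & forall e : R, 0 < e -> exists N,
    forall n, (N <= n)%N -> `|(z n).1.1.1.2 - x| < e.
  apply: (coord (fun z => z.1.1.1.2)) => // [n|u v]; first by case: (Sz n).
  by case: (dist_ge u v).
have [x Yx xP] : exists2 x, Y x & forall e : R, 0 < e -> exists N,
    forall n, (N <= n)%N -> `|(z n).1.1.2 - x| < e.
  apply: (coord (fun z => z.1.1.2)) => // [n|u v]; first by case: (Sz n).
  by case: (dist_ge u v).
have [a Ya aP] : exists2 x, (A `&` Y) x & forall e : R, 0 < e -> exists N,
    forall n, (N <= n)%N -> `|(z n).1.2 - x| < e.
  apply: (coord (fun z => z.1.2)) => [|n|u v]; first exact: closedI.
    by case: (Sz n).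
  by case: (dist_ge u v).
have [b Yb bP] : exists2 x, (B `&` Y) x & forall e : R, 0 < e -> exists N,
    forall n, (N <= n)%N -> `|(z n).2 - x| < e.
  apply: (coord (fun z => z.2)) => [|n|u v]; first exact: closedI.
    by case: (Sz n).
  by case: (dist_ge u v).
exists (x1, x2, x, a, b) => // e e0.
have e5 : 0 < e / 5 by rewrite divr_gt0.
have [N1 P1] := x1P _ e5; have [N2 P2] := x2P _ e5; have [N3 P3] := xP _ e5.
have [N4 P4] := aP _ e5; have [N5 P5] := bP _ e5.
exists (maxn N1 (maxn N2 (maxn N3 (maxn N4 N5)))) => n.
rewrite !geq_max => /and5P[n1 n2 n3 n4 n5].
have := P1 n n1; have := P2 n n2; have := P3 n n3; have := P4 n n4.
by have := P5 n n5; rewrite /dist /=; lra.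
Qed.

(* The Ekeland function with [a] and [b] replaced by free copies [x1] and [x2],
   which a steep smooth term keeps close to [a] and [b]: the nonsmooth terms and
   the constraints then involve different variables. *)
Let energy (N : X -> R) (z : Z) : R :=
  Num.max `|z.1.1.2 - z.1.1.1.1| `|z.1.1.2 - z.1.1.1.2| + beta * `|z.1.1.2 - xh|
  + kap * (`|z.1.1.1.1 - ah| + `|z.1.1.1.2 - bh|)
  + 2 * N (z.1.1.1.1 - z.1.2) + 2 * N (z.1.1.1.2 - z.2).

(* Smoothness of the perturbation is wanted in the constrained variables only. *)
Let bump (N : X -> R) (z z' : Z) : R := `|z.1.1.1.1 - z'.1.1.1.1|
  + `|z.1.1.1.2 - z'.1.1.1.2| + `|z.1.1.2 - z'.1.1.2|
  + N (z.1.2 - z'.1.2) + N (z.2 - z'.2).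

Let norm_lip (u v c : X) : `|u - c| <= `|v - c| + `|u - v|.
Proof. by rewrite [leRHS]addrC; exact: ler_distD. Qed.

Let energy_lip N s z w : approx_norm Y s N ->
  energy N z <= energy N w + 11 * dist z w.
Proof.
move=> [_ _ Nlip _ _]; rewrite /energy.
have [d1 d2 d3 d4 d5] := dist_ge z w.
have D0 : 0 <= dist z w := le_trans (normr_ge0 _) d1.
have [b0 b1] := andP beta01; have [k0 k1] := andP kap01.
have diff (u v u' v' : X) : `|(u - v) - (u' - v')| <= `|u - u'| + `|v - v'|.
  rewrite opprD addrACA opprK (le_trans (ler_normD _ _)) // lerD2l.
  by rewrite addrC distrC.
have h1 : Num.max `|z.1.1.2 - z.1.1.1.1| `|z.1.1.2 - z.1.1.1.2| <=
    Num.max `|w.1.1.2 - w.1.1.1.1| `|w.1.1.2 - w.1.1.1.2| + dist z w.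
  have nd (u v : X) : `|u| <= `|v| + `|u - v|.
    by rewrite -{1}(subrK v u) addrC ler_normD.
  have dd1 := diff z.1.1.2 z.1.1.1.1 w.1.1.2 w.1.1.1.1.
  have dd2 := diff z.1.1.2 z.1.1.1.2 w.1.1.2 w.1.1.1.2.
  have n1 := normr_ge0 (z.1.1.1.1 - w.1.1.1.1).
  have n2 := normr_ge0 (z.1.1.1.2 - w.1.1.1.2).
  have n4 := normr_ge0 (z.1.2 - w.1.2); have n5 := normr_ge0 (z.2 - w.2).
  rewrite ge_max; apply/andP; split.
    apply: le_trans (nd _ (w.1.1.2 - w.1.1.1.1)) _; apply: lerD.
      by rewrite le_max lexx.
    by apply: le_trans dd1 _; rewrite /dist; lra.
  apply: le_trans (nd _ (w.1.1.2 - w.1.1.1.2)) _; apply: lerD.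
    by rewrite le_max lexx orbT.
  by apply: le_trans dd2 _; rewrite /dist; lra.
have h2 : beta * `|z.1.1.2 - xh| <= beta * `|w.1.1.2 - xh| + dist z w.
  have := ler_wpM2l b0 (norm_lip z.1.1.2 w.1.1.2 xh); rewrite mulrDr.
  have : beta * `|z.1.1.2 - w.1.1.2| <= dist z w.
    by apply: le_trans d3; rewrite ler_piMl.
  by lra.
have h3 : kap * (`|z.1.1.1.1 - ah| + `|z.1.1.1.2 - bh|) <=
    kap * (`|w.1.1.1.1 - ah| + `|w.1.1.1.2 - bh|) + dist z w.
  have H : `|z.1.1.1.1 - ah| + `|z.1.1.1.2 - bh| <=
    `|w.1.1.1.1 - ah| + `|w.1.1.1.2 - bh| + dist z w.
    have := norm_lip z.1.1.1.1 w.1.1.1.1 ah.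
    have := norm_lip z.1.1.1.2 w.1.1.1.2 bh.
    have n3 := normr_ge0 (z.1.1.2 - w.1.1.2).
    have n4 := normr_ge0 (z.1.2 - w.1.2); have n5 := normr_ge0 (z.2 - w.2).
    by rewrite /dist; lra.
  have := ler_wpM2l k0 H; rewrite [in X in _ <= X]mulrDr.
  have : kap * dist z w <= dist z w by rewrite ler_piMl.
  by lra.
have h4 : N (z.1.1.1.1 - z.1.2) <= N (w.1.1.1.1 - w.1.2) + 2 * dist z w.
  have := Nlip (z.1.1.1.1 - z.1.2) (w.1.1.1.1 - w.1.2).
  by have := diff z.1.1.1.1 z.1.2 w.1.1.1.1 w.1.2; lra.
have h5 : N (z.1.1.1.2 - z.2) <= N (w.1.1.1.2 - w.2) + 2 * dist z w.
  have := Nlip (z.1.1.1.2 - z.2) (w.1.1.1.2 - w.2).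
  by have := diff z.1.1.1.2 z.2 w.1.1.1.2 w.2; lra.
by lra.
Qed.

(* The function of [hmin] is Lipschitz with constant at most [2] in [a] and [b],
   which the factor [2] in front of [N] compensates. *)
Let energy_min N s z : approx_norm Y s N -> S z ->
  energy N z0 <= energy N z + 4 * s.
Proof.
move=> [N0 N00 Nlip Ns _] [_ _ _ [Aa _] [Bb _]].
have [k0 k1] := andP kap01.
rewrite {1}/energy /z0 /= !subrr !normr0 N00 !mulr0 !addr0 mulr0 addr0.
apply: le_trans (hmin z.1.1.2 Aa Bb) _; rewrite /energy.
have n1 := Ns (z.1.1.1.1 - z.1.2); have n2 := Ns (z.1.1.1.2 - z.2).
have g1 := normr_ge0 (z.1.1.1.1 - z.1.2); have g2 := normr_ge0 (z.1.1.1.2 - z.2).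
have h1 : Num.max `|z.1.1.2 - z.1.2| `|z.1.1.2 - z.2| <=
    Num.max `|z.1.1.2 - z.1.1.1.1| `|z.1.1.2 - z.1.1.1.2| +
    `|z.1.1.1.1 - z.1.2| + `|z.1.1.1.2 - z.2|.
  have t1 := ler_distD z.1.1.1.1 z.1.1.2 z.1.2.
  have t2 := ler_distD z.1.1.1.2 z.1.1.2 z.2.
  have m1 : `|z.1.1.2 - z.1.1.1.1| <=
    Num.max `|z.1.1.2 - z.1.1.1.1| `|z.1.1.2 - z.1.1.1.2| by rewrite le_max lexx.
  have m2 : `|z.1.1.2 - z.1.1.1.2| <=
    Num.max `|z.1.1.2 - z.1.1.1.1| `|z.1.1.2 - z.1.1.1.2|.
    by rewrite le_max lexx orbT.
  move: m1 m2; move: (Num.max `|z.1.1.2 - z.1.1.1.1| _) => M m1 m2.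
  rewrite ge_max; apply/andP; split.
    by rewrite (le_trans t1) // -addrA lerD // lerDl.
  by rewrite (le_trans t2) // addrAC -addrA lerD // lerDl.
have h2 : kap * (`|z.1.2 - ah| + `|z.2 - bh|) <=
    kap * (`|z.1.1.1.1 - ah| + `|z.1.1.1.2 - bh|) +
    (`|z.1.1.1.1 - z.1.2| + `|z.1.1.1.2 - z.2|).
  have t1 := norm_lip z.1.2 z.1.1.1.1 ah; have t2 := norm_lip z.2 z.1.1.1.2 bh.
  rewrite (distrC z.1.2 z.1.1.1.1) in t1; rewrite (distrC z.2 z.1.1.1.2) in t2.
  have H : `|z.1.2 - ah| + `|z.2 - bh| <=
    (`|z.1.1.1.1 - ah| + `|z.1.1.1.2 - bh|) +
    (`|z.1.1.1.1 - z.1.2| + `|z.1.1.1.2 - z.2|) by lra.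
  apply: le_trans (ler_wpM2l k0 H) _; rewrite mulrDr lerD2l.
  by apply: ler_piMl => //; apply: addr_ge0.
by lra.
Qed.

Lemma perturbed_minimum (theta eps : R) : 0 < theta <= 1 -> 0 < eps ->
  exists (N : X -> R) (NN : nat -> X -> R) (v : Z) (z : nat -> Z),
  [/\ exists s, approx_norm Y s N, forall n, exists s, approx_norm Y s (NN n),
      S v /\ dist v z0 < eps, forall n, S (z n) &
      forall u, S u -> exists m0, forall m, (m0 <= m)%N ->
        energy N v + theta * \sum_(n < m) wgt n * bump (NN n) v (z n) <=
        energy N u + theta * \sum_(n < m) wgt n * bump (NN n) u (z n)].
Proof.
move=> /andP[th0 th1] eps0.
have s0 : 0 < theta * eps / 32 by rewrite divr_gt0 // mulr_gt0.
have [N NP] := Yapprox s0.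
pose sn n : R := eps / 16 / n.+1%:R.
have sn0 n : 0 < sn n by rewrite !divr_gt0.
pose NN n := sval (cid (Yapprox (sn0 n))).
have NNP n : approx_norm Y (sn n) (NN n) := svalP (cid (Yapprox (sn0 n))).
have Sz0 : S z0 by split.
have := @variational R Z S dist (fun n => bump (NN n)) (fun n => 2 * sn n)
  (fun n => theta * wgt n) (energy N) 11 z0 (4 * (theta * eps / 32))
  dist_refl dist_sym dist_tri S_complete.
have wth n : 0 < theta * wgt n by rewrite mulr_gt0 // wgt_gt0.
case=> //.
- by move=> z w; apply: energy_lip NP.
- move=> n z w; have [N0 _ _ _ _] := NNP n.
  by rewrite !addr_ge0.
- move=> n z; have [_ N00 _ _ _] := NNP n.
  by rewrite /bump !subrr normr0 N00 !addr0.
- move=> n z z' w; have [_ _ Nlip _ _] := NNP n; rewrite /bump /dist.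
  have := norm_lip z.1.1.1.1 z'.1.1.1.1 w.1.1.1.1.
  have := norm_lip z.1.1.1.2 z'.1.1.1.2 w.1.1.1.2.
  have := norm_lip z.1.1.2 z'.1.1.2 w.1.1.2.
  have := Nlip (z.1.2 - w.1.2) (z'.1.2 - w.1.2).
  have := Nlip (z.2 - w.2) (z'.2 - w.2).
  have E (a b c : X) : a - c - (b - c) = a - b by rewrite opprB addrA subrK.
  by rewrite !E; lra.
- move=> n z w _ _; have [_ _ _ Ns _] := NNP n; rewrite /bump /dist.
  by have := Ns (z.1.2 - w.1.2); have := Ns (z.2 - w.2); lra.
- move=> e e0; pose d := e / eps.
  have d0 : 0 < d by rewrite divr_gt0.
  have [p pd] := inv_below d0; exists p => n pn.
  have np : (n.+1%:R)^-1 <= d.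
    by apply: le_trans pd; rewrite lef_pV2 ?posrE ?ltr0n // ler_nat ltnS.
  rewrite /sn; have : eps / 16 / n.+1%:R <= eps / 16 * d.
    by rewrite ler_wpM2l // divr_ge0 // ltW.
  have -> : eps / 16 * d = e / 16 by rewrite /d; field; rewrite gt_eqF.
  by move: (eps / 16 / _) => c ce; lra.
- by rewrite mulr_gt0.
- by move=> z Sz; exact: energy_min NP Sz.
move=> v [z [Sv Sz _ dv vmin]].
exists N, NN, v, z; split=> //.
- by exists (theta * eps / 32).
- by move=> n; exists (sn n).
- split=> //; apply: le_lt_trans dv _.
  rewrite /sn /wgt expr1.
  have -> : 4 * (theta * eps / 32) / (theta / 2) = eps / 4.
    by field; rewrite gt_eqF.
  by lra.
- move=> u Su; have [m0 m0P] := vmin u Su; exists m0 => m mm.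
  have E (x : Z) : theta * \sum_(n < m) wgt n * bump (NN n) x (z n) =
      \sum_(n < m) theta * wgt n * bump (NN n) x (z n).
    by rewrite mulr_sumr; apply: eq_bigr => n _; rewrite mulrA.
  by rewrite !E; exact: m0P.
Qed.

(* Derivatives of the successive perturbations at the minimum. *)
Let smooth_choice (NN : nat -> X -> R) (c : nat -> X) :
  (forall n, exists s, approx_norm Y s (NN n)) ->
  exists2 psi : nat -> dual X, (forall n, dual_ball (psi n)) &
    forall n (e : R), 0 < e -> exists2 r : R, 0 < r & forall h, Y h -> `|h| < r ->
      NN n (c n + h) <= NN n (c n) + psi n h + e * `|h|.
Proof.
move=> NNP.
have ex n : exists2 f : dual X, dual_ball f & forall e : R, 0 < e ->
    exists2 r : R, 0 < r & forall h, Y h -> `|h| < r ->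
      NN n (c n + h) <= NN n (c n) + f h + e * `|h|.
  by have [s [_ _ _ _]] := NNP n; apply.
exists (fun n => sval (cid2 (ex n))) => n; by case: (cid2 (ex n)).
Qed.

(** At the minimum, moving [a] to a point [c] of [A] shows that
[2 phi1 (c - a)] minus the derivative of the perturbation is at most
[o (|c - a|)], and likewise for [b]; moving [(x1, x2, x)] along
[t (comb a la, comb b lb, y)] bounds the slope of the convex terms from below by
minus [2 phi1 (comb a la) + 2 phi2 (comb b lb)].  In the sum of these estimates
the derivatives [phi1] and [phi2] cancel. *)
Lemma gap_in_subspace (eta beta' eps : R) : kap < eta -> beta < beta' ->
  0 < eps -> exists (w : nat -> X) (ks : nat -> nat),
  [/\ A (w 3) /\ B (w 4), forall i, (i < 5)%N -> Y (w i),
      [/\ `|w 0 - ah| < eps, `|w 1 - bh| < eps, `|w 2 - xh| < eps,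
        `|w 3 - ah| < eps & `|w 4 - bh| < eps] &
      forall (tau : R) (y : X) la lb, 0 <= tau -> Y y ->
        admissible (A `&` Y) (inv_radius ks) (w 3) la ->
        admissible (B `&` Y) (inv_radius ks) (w 4) lb ->
        0 <= gap eta beta' w tau y la lb].
Proof.
move=> keta bb' eps0.
pose theta := Num.min 1 (Num.min (beta' - beta) ((eta - kap) / 4)).
have th0 : 0 < theta.
  by rewrite !lt_min ltr01 subr_gt0 bb' divr_gt0 // subr_gt0.
have th1 : theta <= 1 by rewrite ge_min lexx.
have thb : theta <= beta' - beta by rewrite !ge_min lexx orbT.
have the : theta * 4 <= eta - kap by rewrite -ler_pdivlMr // !ge_min lexx !orbT.
have th01 : 0 < theta <= 1 by rewrite th0.
have [N [NN [v [z [[s NP] NNP [Sv dv] Sz vmin]]]]] := perturbed_minimum th01 eps0.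
case: v Sv dv vmin => [[[[x1 x2] x] a] b] Sv dv vmin.
have [Y1 Y2 Yx [Aa Ya] [Bb Yb]] := Sv; rewrite /= in Y1 Y2 Yx Aa Ya Bb Yb.
have YN u : Y u -> Y (- u) by move=> Yu; rewrite -scaleN1r; apply: (YZ).
have [_ _ Nlip _ Nsm] := NP.
have [phi1 phi1b phi1P] := Nsm (x1 - a).
have [phi2 phi2b phi2P] := Nsm (x2 - b).
have [psia psiab psiaP] := smooth_choice (fun n => a - (z n).1.2) NNP.
have [psib psibb psibP] := smooth_choice (fun n => b - (z n).2) NNP.
have NNlip n u u' : NN n u <= NN n u' + `|u - u'|.
  by have [? [_ _ H _ _]] := NNP n.
have unifa := uniform_smooth NNlip psiab psiaP.
have unifb := uniform_smooth NNlip psibb psibP.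
have kex n : exists k : nat, forall h, Y h -> `|h| < (k.+1%:R)^-1 ->
  [/\ N (x1 - a + h) <= N (x1 - a) + phi1 h + (n.+1%:R)^-1 / 4 * `|h|,
      N (x2 - b + h) <= N (x2 - b) + phi2 h + (n.+1%:R)^-1 / 4 * `|h|,
      forall m, \sum_(i < m) wgt i * NN i (a - (z i).1.2 + h) <=
        \sum_(i < m) wgt i * NN i (a - (z i).1.2) + \sum_(i < m) wgt i * psia i h
        + (n.+1%:R)^-1 / 2 * `|h| &
      forall m, \sum_(i < m) wgt i * NN i (b - (z i).2 + h) <=
        \sum_(i < m) wgt i * NN i (b - (z i).2) + \sum_(i < m) wgt i * psib i h
        + (n.+1%:R)^-1 / 2 * `|h|].
  have n4 : 0 < (n.+1%:R)^-1 / 4 :> R by rewrite divr_gt0.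
  have n2 : 0 < (n.+1%:R)^-1 / 2 :> R by rewrite divr_gt0.
  have [r1 r10 r1P] := phi1P _ n4; have [r2 r20 r2P] := phi2P _ n4.
  have [r3 r30 r3P] := unifa _ n2; have [r4 r40 r4P] := unifb _ n2.
  have r0 : 0 < Num.min (Num.min r1 r2) (Num.min r3 r4).
    by rewrite !lt_min r10 r20 r30.
  have [k] := inv_below r0; rewrite !le_min => /andP[/andP[k1 k2] /andP[k3 k4]].
  exists k => h Yh hk; split=> [||m|m].
  - by apply: r1P => //; exact: lt_le_trans k1.
  - by apply: r2P => //; exact: lt_le_trans k2.
  - by apply: r3P => //; exact: lt_le_trans k3.
  - by apply: r4P => //; exact: lt_le_trans k4.
pose ks n := sval (cid (kex n)).
have ksP n := svalP (cid (kex n)).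
pose w := nth 0 [:: x1; x2; x; a; b].
exists w, ks; split=> //.
- by case=> [|[|[|[|[|]]]]].
- have [d1 d2 d3 d4 d5] := dist_ge (x1, x2, x, a, b) z0.
  by rewrite /= in d1 d2 d3 d4 d5; split; apply: le_lt_trans dv.
move=> tau y la lb t0 Yy Ala Blb.
rewrite /gap /w /=; set hb := comb a la; set gb := comb b lb.
have Yhb : Y hb by apply: comb_mem => // e /Ala[_ []].
have Ygb : Y gb by apply: comb_mem => // e /Blb[_ []].
have bsum (y1 y2 y3 ya yb : X) m :
  \sum_(n < m) wgt n * bump (NN n) (y1, y2, y3, ya, yb) (z n) =
  \sum_(n < m) wgt n * (`|y1 - (z n).1.1.1.1| + `|y2 - (z n).1.1.1.2| +
     `|y3 - (z n).1.1.2|) +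
  \sum_(n < m) wgt n * NN n (ya - (z n).1.2) +
  \sum_(n < m) wgt n * NN n (yb - (z n).2).
  by rewrite -!big_split /=; apply: eq_bigr => n _; rewrite /bump /= !mulrDr.
pose Pa m h := \sum_(n < m) wgt n * psia n h.
pose Pb m h := \sum_(n < m) wgt n * psib n h.
(* The derivative of the perturbation depends on the number [m] of its terms; one
   common [m] is chosen once the finitely many test points are known. *)
have factA e : e \in la -> exists m0, forall m, (m0 <= m)%N ->
    2 * phi1 (e.2.2 - a) - theta * Pa m (e.2.2 - a) <=
    `|e.2.2 - a| / e.2.1.+1%:R.
  case: e => [ea [n c]] el; have /= [_ [Ac Yc] cr] := Ala _ el.
  have Yh : Y (c - a) by apply: (YD) => //; exact: YN.
  have [m0 m0P] : exists m0, forall m, (m0 <= m)%N ->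
      energy N (x1, x2, x, a, b) + theta *
        \sum_(n < m) wgt n * bump (NN n) (x1, x2, x, a, b) (z n) <=
      energy N (x1, x2, x, c, b) + theta *
        \sum_(n < m) wgt n * bump (NN n) (x1, x2, x, c, b) (z n).
    by apply: vmin; split.
  exists m0 => m mm; have := m0P m mm; rewrite !bsum /energy /=.
  have hr : `|- (c - a)| < ((ks n).+1%:R)^-1 by rewrite normrN.
  have [S1 _ _ _] := ksP n _ (YN _ Yh) hr.
  have [_ _ /(_ m) S3 _] := ksP n _ Yh cr.
  have E1 : x1 - a - (c - a) = x1 - c by rewrite opprB addrA subrK.
  have E2 i : a - (z i).1.2 + (c - a) = c - (z i).1.2.
    by rewrite addrC addrA subrK.
  rewrite E1 dualN normrN in S1.
  have E3 : \sum_(i < m) wgt i * NN i (a - (z i).1.2 + (c - a)) =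
      \sum_(i < m) wgt i * NN i (c - (z i).1.2).
    by apply: eq_bigr => i _; rewrite E2.
  rewrite E3 in S3.
  have := ler_wpM2l (ltW th0) S3; rewrite -/(Pa m (c - a)) !mulrDr.
  have : theta * ((n.+1%:R)^-1 / 2 * `|c - a|) <= (n.+1%:R)^-1 / 2 * `|c - a|.
    by rewrite ler_piMl // mulr_ge0 // divr_ge0 // invr_ge0 ler0n.
  move: S1; rewrite [`|c - a| / _]mulrC -![(n.+1%:R)^-1 / _ * _]mulrAC.
  move: ((n.+1%:R)^-1 * `|c - a|) => q.
  move: (theta * Pa m _) (\sum_(i < m) wgt i * NN i (c - _)) => P1 P2.
  move: (\sum_(i < m) _) (\sum_(i < m) _) (\sum_(i < m) _) => P3 P4 P5.
  by lra.
have factB e : e \in lb -> exists m0, forall m, (m0 <= m)%N ->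
    2 * phi2 (e.2.2 - b) - theta * Pb m (e.2.2 - b) <=
    `|e.2.2 - b| / e.2.1.+1%:R.
  case: e => [ea [n c]] el; have /= [_ [Ac Yc] cr] := Blb _ el.
  have Yh : Y (c - b) by apply: (YD) => //; exact: YN.
  have [m0 m0P] : exists m0, forall m, (m0 <= m)%N ->
      energy N (x1, x2, x, a, b) + theta *
        \sum_(n < m) wgt n * bump (NN n) (x1, x2, x, a, b) (z n) <=
      energy N (x1, x2, x, a, c) + theta *
        \sum_(n < m) wgt n * bump (NN n) (x1, x2, x, a, c) (z n).
    by apply: vmin; split.
  exists m0 => m mm; have := m0P m mm; rewrite !bsum /energy /=.
  have hr : `|- (c - b)| < ((ks n).+1%:R)^-1 by rewrite normrN.
  have [_ S1 _ _] := ksP n _ (YN _ Yh) hr.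
  have [_ _ _ /(_ m) S3] := ksP n _ Yh cr.
  have E1 : x2 - b - (c - b) = x2 - c by rewrite opprB addrA subrK.
  have E2 i : b - (z i).2 + (c - b) = c - (z i).2.
    by rewrite addrC addrA subrK.
  rewrite E1 dualN normrN in S1.
  have E3 : \sum_(i < m) wgt i * NN i (b - (z i).2 + (c - b)) =
      \sum_(i < m) wgt i * NN i (c - (z i).2).
    by apply: eq_bigr => i _; rewrite E2.
  rewrite E3 in S3.
  have := ler_wpM2l (ltW th0) S3; rewrite -/(Pb m (c - b)) !mulrDr.
  have : theta * ((n.+1%:R)^-1 / 2 * `|c - b|) <= (n.+1%:R)^-1 / 2 * `|c - b|.
    by rewrite ler_piMl // mulr_ge0 // divr_ge0 // invr_ge0 ler0n.
  move: S1; rewrite [`|c - b| / _]mulrC -![(n.+1%:R)^-1 / _ * _]mulrAC.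
  move: ((n.+1%:R)^-1 * `|c - b|) => q.
  move: (theta * Pb m _) (\sum_(i < m) wgt i * NN i (c - _)) => P1 P2.
  move: (\sum_(i < m) _) (\sum_(i < m) _) (\sum_(i < m) _) => P3 P4 P5.
  by lra.
have [t [t_gt0 tt [h1s h2s]]] : exists t : R, [/\ 0 < t, t * tau <= 1 &
    N (x1 - a + t *: hb) <= N (x1 - a) + phi1 (t *: hb) + theta * `|t *: hb| /\
    N (x2 - b + t *: gb) <= N (x2 - b) + phi2 (t *: gb) + theta * `|t *: gb|].
  have [r1 r10 r1P] := phi1P _ th0; have [r2 r20 r2P] := phi2P _ th0.
  have [t [t_gt0 tt tr1 tr2]] :=
    small_step t0 r10 r20 (normr_ge0 hb) (normr_ge0 gb).
  exists t; split=> //; split.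
    by apply: r1P; [exact: YZ | rewrite normrZ gtr0_norm].
  by apply: r2P; [exact: YZ | rewrite normrZ gtr0_norm].
have [m1 m1P] := eventually_all factA.
have [m2 m2P] := eventually_all factB.
have [m3 m3P] : exists m0, forall m, (m0 <= m)%N ->
    energy N (x1, x2, x, a, b) + theta *
      \sum_(n < m) wgt n * bump (NN n) (x1, x2, x, a, b) (z n) <=
    energy N (x1 + t *: hb, x2 + t *: gb, x + t *: y, a, b) + theta *
      \sum_(n < m) wgt n *
        bump (NN n) (x1 + t *: hb, x2 + t *: gb, x + t *: y, a, b) (z n).
  by apply: vmin; split=> //=; apply: (YD) => //; apply: (YZ).
pose m := maxn m1 (maxn m2 m3).
have mA := m1P m (leq_maxl _ _).
have mB := m2P m (leq_trans (leq_maxl _ _) (leq_maxr _ _)).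
have mT := m3P m (leq_trans (leq_maxr _ _) (leq_maxr _ _)).
have PaD u u' : Pa m (u + u') = Pa m u + Pa m u'.
  by rewrite /Pa -big_split /=; apply: eq_bigr => i _; rewrite dualD mulrDr.
have PaZ (r : R) u : Pa m (r *: u) = r * Pa m u.
  by rewrite /Pa mulr_sumr; apply: eq_bigr => i _; rewrite dualZ mulrCA.
have PbD u u' : Pb m (u + u') = Pb m u + Pb m u'.
  by rewrite /Pb -big_split /=; apply: eq_bigr => i _; rewrite dualD mulrDr.
have PbZ (r : R) u : Pb m (r *: u) = r * Pb m u.
  by rewrite /Pb mulr_sumr; apply: eq_bigr => i _; rewrite dualZ mulrCA.
have costA : 2 * phi1 hb - theta * Pa m hb <= cost a la.
  rewrite (@comb_linear _ _ (fun h => 2 * phi1 h - theta * Pa m h)).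
  - rewrite /cost big_seq [leRHS]big_seq; apply: ler_sum => e el.
    by apply: ler_wpM2l; [case: (Ala e el) | exact: mA].
  - by move=> u u'; rewrite dualD PaD; ring.
  - by move=> r u; rewrite dualZ PaZ; ring.
have costB : 2 * phi2 gb - theta * Pb m gb <= cost b lb.
  rewrite (@comb_linear _ _ (fun h => 2 * phi2 h - theta * Pb m h)).
  - rewrite /cost big_seq [leRHS]big_seq; apply: ler_sum => e el.
    by apply: ler_wpM2l; [case: (Blb e el) | exact: mB].
  - by move=> u u'; rewrite dualD PbD; ring.
  - by move=> r u; rewrite dualZ PbZ; ring.
have PaB : theta * Pa m hb <= theta * `|hb|.
  apply: ler_wpM2l; first exact: ltW.
  exact: le_trans (ler_norm _) (@sum_wgt_psi _ _ _ _ _ psiab).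
have PbB : theta * Pb m gb <= theta * `|gb|.
  apply: ler_wpM2l; first exact: ltW.
  exact: le_trans (ler_norm _) (@sum_wgt_psi _ _ _ _ _ psibb).
have slope := @maxnorm_slope _ _ tau t (x - x1) (x - x2) (y - hb) (y - gb) t_gt0 tt.
have Ex (u h : X) : x + t *: y - (u + t *: h) = x - u + t *: (y - h).
  by rewrite opprD addrACA -scalerBr.
have nrm (u c h : X) : `|u + t *: h - c| <= `|u - c| + t * `|h|.
  by rewrite addrAC (le_trans (ler_normD _ _)) // normrZ gtr0_norm.
have bumpT : \sum_(n < m) wgt n *
     (`|x1 + t *: hb - (z n).1.1.1.1| + `|x2 + t *: gb - (z n).1.1.1.2| +
        `|x + t *: y - (z n).1.1.2|) <=
   \sum_(n < m) wgt n * (`|x1 - (z n).1.1.1.1| + `|x2 - (z n).1.1.1.2| +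
     `|x - (z n).1.1.2|) + t * (`|hb| + `|gb| + `|y|).
  apply: (@le_trans _ _ (\sum_(n < m) (wgt n * (`|x1 - (z n).1.1.1.1| +
     `|x2 - (z n).1.1.1.2| + `|x - (z n).1.1.2|) +
     wgt n * (t * (`|hb| + `|gb| + `|y|))))).
    apply: ler_sum => n _; rewrite -mulrDr.
    apply: ler_wpM2l; first exact: ltW (wgt_gt0 _).
    have q1 := nrm x1 (z n).1.1.1.1 hb; have q2 := nrm x2 (z n).1.1.1.2 gb.
    have q3 := nrm x (z n).1.1.2 y; rewrite !mulrDr.
    apply: le_trans (lerD (lerD q1 q2) q3) _.
    by rewrite le_eqVlt; apply/orP; left; apply/eqP; ring.
  rewrite big_split /= lerD2l -mulr_suml sum_wgt; apply: ler_piMl.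
    by apply: mulr_ge0; [exact: ltW | rewrite !addr_ge0].
  by rewrite gerBl exprn_ge0 // invr_ge0 ler0n.
move: mT; rewrite !bsum /energy /= !Ex.
have -> : x1 + t *: hb - a = x1 - a + t *: hb by rewrite addrAC.
have -> : x2 + t *: gb - b = x2 - b + t *: gb by rewrite addrAC.
move: bumpT; set s1 := \sum_(n < m) _; set s2 := \sum_(n < m) _.
set s3 := \sum_(n < m) _; set s4 := \sum_(n < m) _ => bumpT mT.
have thB := ler_wpM2l (ltW th0) bumpT.
have [b0 _] := andP beta01; have [k0 _] := andP kap01.
have betaT := ler_wpM2l b0 (nrm x xh y).
have kapT := ler_wpM2l k0 (lerD (nrm x1 ah hb) (nrm x2 bh gb)).
rewrite !dualZ !normrZ (gtr0_norm t_gt0) in h1s h2s.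
have etaH : (kap + theta * 4) * (`|hb| + `|gb|) <= eta * (`|hb| + `|gb|).
  by apply: ler_wpM2r; [exact: addr_ge0 | rewrite -lerBrDl].
have betaY : (beta + theta) * `|y| <= beta' * `|y|.
  by apply: ler_wpM2r => //; rewrite -lerBrDl.
have Ek (u h : X) : tau *: u + (y - h) = tau *: u + y - h by rewrite addrA.
rewrite !Ek in slope.
have final := descent_rate t_gt0 mT thB betaT kapT h1s h2s slope.
exact: (descent_sum final costA costB PaB PbB etaH betaY).
Qed.

End GapInSubspace.

(** * The fuzzy sum rule at an Ekeland point, and the theorem *)
Section FuzzyNormals.
Context {R : realType} {X : completeNormedModType R}.

(** The separable subspace is fixed first, so as to reflect gaps; the points are
then found in it, and by reflection the gap at them is nonnegative on all of
[X]. *)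
Lemma fuzzy_normals (A B : set X) (ah bh xh : X) (beta kap eta beta' eps : R) :
  asplund X -> closed A -> closed B -> A ah -> B bh ->
  0 <= beta <= 1 -> 0 <= kap <= 1 ->
  (forall a b x, A a -> B b -> Num.max `|xh - ah| `|xh - bh| <=
    Num.max `|x - a| `|x - b| + beta * `|x - xh| + kap * (`|a - ah| + `|b - bh|)) ->
  kap < eta <= 1 -> beta < beta' -> 0 < eps ->
  exists (a b x1 x2 x : X) (f1 f2 e1 e2 : dual X),
  [/\ [/\ A a, B b, `|a - ah| < eps & `|b - bh| < eps],
      [/\ `|x1 - ah| < eps, `|x2 - bh| < eps & `|x - xh| < eps],
      (forall k1 k2, f1 k1 + f2 k2 <= Num.max `|k1| `|k2|) /\
      Num.max `|x - x1| `|x - x2| <= f1 (x - x1) + f2 (x - x2),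
      [/\ `|f1 + f2| <= beta', `|e1| <= eta & `|e2| <= eta] &
      frechet_normal_cone A a (f1 + e1) /\ frechet_normal_cone B b (f2 + e2)].
Proof.
move=> aX Acl Bcl Aah Bbh b01 k01 hmin /andP[keta eta1] bb' eps0.
have eta0 : 0 <= eta by case/andP: k01 => k0 _; apply: le_trans k0 (ltW keta).
have beta'0 : 0 <= beta'.
  by case/andP: b01 => b0 _; apply: le_trans b0 (ltW bb').
have eta01 : 0 <= eta <= 1 by rewrite eta0.
have [q] := gap_reflection A B beta' eta01 [:: ah; bh; xh].
set Y := closure (range q) => -[Yseed [YD YZ] refl].
have [c cb cd] := dual_separable q aX.
have Yah : Y ah by apply: Yseed; rewrite inE eqxx.
have Ybh : Y bh by apply: Yseed; rewrite !inE eqxx orbT.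
have Yxh : Y xh by apply: Yseed; rewrite !inE eqxx !orbT.
have Y0 : Y 0 by have := YZ 0 _ Yah; rewrite scale0r.
have Yapprox (s : R) : 0 < s -> exists N : X -> R, approx_norm Y s N.
  by move=> s0; exact: (smooth_norm Y0 YZ cb cd s0).
have Ycl : closed Y by exact: closed_closure.
have [w [ks [[Aw Bw] Yw [w0 w1 w2 w3 w4] gapY]]] :=
  gap_in_subspace Ycl Y0 YD YZ Yapprox Acl Bcl Aah Bbh Yah Ybh Yxh b01 k01 hmin
    keta bb' eps0.
have gapX := refl w ks Yw gapY.
have [f1 [f2 [e1 [e2 [fmax fu [f12 [e1b e2b]] fA fB]]]]] :=
  gap_functionals eta0 beta'0 gapX.
exists (w 3), (w 4), (w 0), (w 1), (w 2), f1, f2, e1, e2; split=> //.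
by split; [exact: frechet_normal_of_modulus fA | exact: frechet_normal_of_modulus fB].
Qed.

End FuzzyNormals.

Section Ekeland.
Context {R : realType} {X : completeNormedModType R}.

(** Ekeland's principle on [A * B * X] with the distance of the first two factors
scaled by [gamma], so that its penalty on [a] and [b] is small.  The first weight
[alpha] controls the distance to the starting point, and the weights add up to
at most [beta]. *)
Lemma ekeland_pair (A B : set X) (a0 b0 x0 : X) (alpha beta gamma : R) :
  closed A -> closed B -> A a0 -> B b0 -> 0 < alpha < beta -> 0 < gamma <= 1 ->
  0 < Num.max `|x0 - a0| `|x0 - b0| ->
  exists a b x, [/\ A a, B b,
    `|x - x0| + gamma * (`|a - a0| + `|b - b0|) <=
      Num.max `|x0 - a0| `|x0 - b0| / alpha &
    forall a' b' x', A a' -> B b' -> Num.max `|x - a| `|x - b| <=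
      Num.max `|x' - a'| `|x' - b'| + beta * `|x' - x| +
      (beta * gamma) * (`|a' - a| + `|b' - b|)].
Proof.
move=> Acl Bcl Aa0 Bb0 /andP[al0 ab] /andP[g0 g1] m0.
pose d (z z' : X * X * X) : R :=
  `|z.2 - z'.2| + gamma * (`|z.1.1 - z'.1.1| + `|z.1.2 - z'.1.2|).
pose S : set (X * X * X) := [set z | A z.1.1 /\ B z.1.2].
pose f (z : X * X * X) : R := Num.max `|z.2 - z.1.1| `|z.2 - z.1.2|.
pose mu n : R := if n is n.+1 then (beta - alpha) * wgt n else alpha.
have nd (u v : X) : `|u| <= `|v| + `|u - v|.
  by rewrite -{1}(subrK v u) addrC ler_normD.
have d_refl z : d z z = 0 by rewrite /d !subrr normr0 !addr0 mulr0 ?addr0.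
have d_sym z w : d z w = d w z.
  by rewrite /d (distrC z.2) (distrC z.1.1) (distrC z.1.2).
have d_tri z w v : d z v <= d z w + d w v.
  have t1 := ler_distD w.2 z.2 v.2.
  have t2 := lerD (ler_distD w.1.1 z.1.1 v.1.1) (ler_distD w.1.2 z.1.2 v.1.2).
  by have := ler_wpM2l (ltW g0) t2; rewrite /d !mulrDr; lra.
have d_ge0 z w : 0 <= d z w.
  by rewrite addr_ge0 // mulr_ge0 ?(ltW g0) // addr_ge0.
have d_ge z w : [/\ `|z.2 - w.2| <= d z w, gamma * `|z.1.1 - w.1.1| <= d z w &
    gamma * `|z.1.2 - w.1.2| <= d z w].
  have p0 := normr_ge0 (z.2 - w.2).
  have p1 : 0 <= gamma * `|z.1.1 - w.1.1| by rewrite mulr_ge0 // ltW.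
  have p2 : 0 <= gamma * `|z.1.2 - w.1.2| by rewrite mulr_ge0 // ltW.
  by rewrite /d mulrDr; split; lra.
have complete (z : nat -> X * X * X) : (forall n, S (z n)) ->
    (forall e : R, 0 < e -> exists N, forall m n, (N <= m)%N -> (N <= n)%N ->
       d (z m) (z n) < e) ->
    exists2 v, S v & forall e : R, 0 < e -> exists N, forall n, (N <= n)%N ->
       d (z n) v < e.
  move=> Sz cz.
  have coord (pr : X * X * X -> X) (D : set X) : closed D ->
      (forall n, D (pr (z n))) -> (forall u v, gamma * `|pr u - pr v| <= d u v) ->
      exists2 x, D x & forall e : R, 0 < e -> exists N, forall n, (N <= n)%N ->
       `|pr (z n) - x| < e.
    move=> cD Dz prd; apply: complete_seq => // e e0.
    have [N NP] := cz _ (mulr_gt0 g0 e0); exists N => m n Nm Nn.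
    have := le_lt_trans (prd _ _) (NP m n Nm Nn).
    by rewrite ltr_pM2l.
  have [a Aa aP] : exists2 x, A x & forall e : R, 0 < e -> exists N,
      forall n, (N <= n)%N -> `|(z n).1.1 - x| < e.
    apply: (coord (fun z => z.1.1)) => // [n|u v]; first by case: (Sz n).
    by case: (d_ge u v).
  have [b Bb bP] : exists2 x, B x & forall e : R, 0 < e -> exists N,
      forall n, (N <= n)%N -> `|(z n).1.2 - x| < e.
    apply: (coord (fun z => z.1.2)) => // [n|u v]; first by case: (Sz n).
    by case: (d_ge u v).
  have [x _ xP] : exists2 x, setT x & forall e : R, 0 < e -> exists N,
      forall n, (N <= n)%N -> `|(z n).2 - x| < e.
    apply: (coord (fun z => z.2)) => // u v.
    by case: (d_ge u v) => h _ _; apply: le_trans h; rewrite ler_piMl.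
  exists (a, b, x) => // e e0.
  have e3 : 0 < e / 3 by rewrite divr_gt0.
  have [N1 P1] := aP _ e3; have [N2 P2] := bP _ e3; have [N3 P3] := xP _ e3.
  exists (maxn N1 (maxn N2 N3)) => n; rewrite !geq_max => /and3P[n1 n2 n3].
  rewrite /d /=; have := P1 n n1; have := P2 n n2; have := P3 n n3.
  have := ler_piMl (addr_ge0 (normr_ge0 ((z n).1.1 - a)) (normr_ge0 ((z n).1.2 - b))) g1.
  by lra.
have f_lip z w : f z <= f w + gamma^-1 * d z w.
  have [] := d_ge z w; rewrite -!(ler_pdivlMl _ _ g0) => d1 d2 d3.
  have E : gamma^-1 * d z w = gamma^-1 * `|z.2 - w.2| +
      (`|z.1.1 - w.1.1| + `|z.1.2 - w.1.2|).
    by rewrite /d mulrDr mulKf // gt_eqF.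
  have n1 := normr_ge0 (z.1.1 - w.1.1); have n2 := normr_ge0 (z.1.2 - w.1.2).
  have h : `|z.2 - w.2| <= gamma^-1 * `|z.2 - w.2|.
    by rewrite ler_peMl // invf_ge1.
  have diff (u v u' v' : X) : `|(u - v) - (u' - v')| <= `|u - u'| + `|v - v'|.
    rewrite opprD addrACA opprK (le_trans (ler_normD _ _)) // lerD2l.
    by rewrite addrC distrC.
  rewrite /f E ge_max; apply/andP; split.
    apply: le_trans (nd _ (w.2 - w.1.1)) _; apply: lerD.
      by rewrite le_max lexx.
    by apply: le_trans (diff _ _ _ _) _; lra.
  apply: le_trans (nd _ (w.2 - w.1.2)) _; apply: lerD.
    by rewrite le_max lexx orbT.
  by apply: le_trans (diff _ _ _ _) _; lra.
have mu0 n : 0 < mu n by case: n => [//|n]; rewrite mulr_gt0 ?subr_gt0 ?wgt_gt0.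
have summu m : \sum_(n < m) mu n <= beta.
  case: m => [|m]; first by rewrite big_ord0; lra.
  rewrite big_ord_recl /= -mulr_sumr sum_wgt.
  have : (beta - alpha) * (1 - 2^-1 ^+ m) <= beta - alpha.
    apply: ler_piMr; first by lra.
    by rewrite gerBl exprn_ge0 // invr_ge0 ler0n.
  by lra.
have Sz0 : S (a0, b0, x0) by [].
have fge0 z : 0 <= f z by rewrite le_max normr_ge0.
have := @variational R _ S d (fun=> d) (fun=> 0) mu f gamma^-1 (a0, b0, x0)
  (f (a0, b0, x0)) d_refl d_sym d_tri complete f_lip.
case=> //.
- by move=> n z z' w; rewrite addrC; exact: d_tri.
- by move=> n z w _ _; rewrite addr0.
- by move=> e e0; exists 0%N.
- by move=> z _; rewrite lerDr.
move=> [[a b] x] [z [[Aa Bb] _ _ dz vmin]].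
exists a, b, x; split=> //; first by move: dz; rewrite addr0.
move=> a' b' x' Aa' Bb'.
have Sw : S (a', b', x') by [].
have [m0' /(_ m0' (leqnn _)) H] := vmin _ Sw.
have : \sum_(n < m0') mu n * d (a', b', x') (z n) <=
    \sum_(n < m0') mu n * d (a, b, x) (z n) + beta * d (a', b', x') (a, b, x).
  apply: (@le_trans _ _ (\sum_(n < m0') (mu n * d (a, b, x) (z n) +
      mu n * d (a', b', x') (a, b, x)))).
    apply: ler_sum => n _; rewrite -mulrDr; apply: ler_wpM2l; first exact: ltW.
    by rewrite addrC; exact: d_tri.
  rewrite big_split /= lerD2l -mulr_suml.
  by apply: ler_wpM2r; [exact: d_ge0 | exact: summu].
have E : beta * d (a', b', x') (a, b, x) =
    beta * `|x' - x| + beta * gamma * (`|a' - a| + `|b' - b|).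
  by rewrite /d /= mulrDr mulrA.
by move: H; rewrite E /f /=; lra.
Qed.

End Ekeland.

Lemma edist_inf_ltP (R : realType) (X : normedModType R) (S : set X) (x : X) (r : R) :
  (edist_inf S x < r%:E)%E -> exists2 c, S c & `|x - c| < r.
Proof.
move=> /ereal_inf_lt[_ [c Sc <-]] /edist_lt_ball /=.
by rewrite -ball_normE; exists c.
Qed.

Lemma edist_inf_le (R : realType) (X : normedModType R) (S : set X) (x c : X) : S c -> (edist_inf S x <= `|x - c|%:E)%E.
Proof.
move=> Sc; apply/lee_addgt0Pr => e e0.
apply: (@le_trans _ _ (edist (x, c))); first by apply: ereal_inf_lbound; exists c.
apply: edist_fin => /=; first exact: ltr_wpDl.
by rewrite -ball_normE /= ltrDl.
Qed.

(** Otherwise a small step of [x] towards [a] would decrease the maximum at unit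
rate, at the cost of the rate [beta < 1] only. *)
Lemma ekeland_equidistant (R : realType) (X : normedModType R) (a b x : X) (beta : R) : 0 <= beta < 1 ->
  (forall x', Num.max `|x - a| `|x - b| <=
     Num.max `|x' - a| `|x' - b| + beta * `|x' - x|) ->
  `|x - a| <= `|x - b|.
Proof.
move=> /andP[be0 be1] H; rewrite leNgt; apply/negP => lt.
set m := `|x - a| in lt *; set n := `|x - b| in lt *.
have n0 : 0 <= n := normr_ge0 _.
have m0 : 0 < m := le_lt_trans n0 lt.
pose t := (m - n) / (2 * m).
have t0 : 0 < t by rewrite divr_gt0 ?mulr_gt0 // subr_gt0.
have tm : t * m = (m - n) / 2 by rewrite /t; field; rewrite gt_eqF.
have t1 : t <= 1 by rewrite ler_pdivrMr ?mulr_gt0 //; lra.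
have := H (x + t *: (a - x)).
have -> : x + t *: (a - x) - x = t *: (a - x) by rewrite addrAC subrr add0r.
have -> : `|t *: (a - x)| = t * m by rewrite normrZ gtr0_norm // distrC.
have -> : Num.max m n = m by apply/max_idPl; exact: ltW.
have h1 : `|x + t *: (a - x) - a| <= m - t * m.
  have -> : x + t *: (a - x) - a = (1 - t) *: (x - a).
    by rewrite scalerBl scale1r -[X in _ = _ - X]opprK -scalerN opprB addrAC opprK.
  by rewrite normrZ ger0_norm ?subr_ge0 // mulrBl mul1r.
have h2 : `|x + t *: (a - x) - b| <= n + t * m.
  rewrite addrAC (le_trans (ler_normD _ _)) // normrZ gtr0_norm //.
  by rewrite (distrC a).
have h3 : Num.max `|x + t *: (a - x) - a| `|x + t *: (a - x) - b| <= m - t * m.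
  by rewrite ge_max h1 /= (le_trans h2) // tm; lra.
have h4 : beta * (t * m) < t * m by rewrite gtr_pMl // mulr_gt0.
by lra.
Qed.

(** The bound [m / alpha < r] on the displacement of [x0] in Ekeland's principle
prevents [x] from lying in the intersection, so that [|x - a| > 0].  If [a] were
in [B], the choice [a' = b' = x' = a] would reach the value [0] at a cost below
[|x - a|]. *)
Lemma equidistant_pair (R : realType) (X : completeNormedModType R)
    (A B : set X) (xbar : X) (alpha beta gamma delta : R) :
  closed A -> closed B -> (A `&` B) xbar -> 0 < alpha < beta -> beta < 1 ->
  0 < gamma <= (1 - beta) / 4 -> 0 < delta ->
  exists2 rho : R, 0 < rho & forall x0, ball xbar rho x0 ->
    forall r, (forall c, (A `&` B) c -> r <= `|x0 - c|) ->
    forall a0 b0, A a0 -> B b0 -> Num.max `|x0 - a0| `|x0 - b0| < alpha * r ->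
    exists a b x, [/\ ((A `\` B) `&` ball xbar delta) a,
      ((B `\` A) `&` ball xbar delta) b, ball xbar delta x,
      `|x - a| = `|x - b| /\ 0 < `|x - a| &
      forall a' b' x', A a' -> B b' -> Num.max `|x - a| `|x - b| <=
        Num.max `|x' - a'| `|x' - b'| + beta * `|x' - x| +
        (beta * gamma) * (`|a' - a| + `|b' - b|)].
Proof.
move=> Acl Bcl ABx /andP[al0 ab] be1 /andP[g0 gb] dl0.
have be0 : 0 < beta by exact: lt_trans ab.
have g1 : gamma <= 1 by lra.
have bg : beta * gamma <= gamma by rewrite ler_piMl // ltW.
have bg0 : 0 < beta * gamma by rewrite mulr_gt0.
(* In Ekeland's principle [a] and [b] move by less than [rho / gamma], and they
   start within [2 rho] of [xbar]. *)
pose rho := delta / (2 + gamma^-1).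
have D0 : 0 < 2 + gamma^-1 by rewrite addr_gt0 // invr_gt0.
have rho0 : 0 < rho by rewrite divr_gt0.
have rhod : rho * 2 + rho / gamma = delta.
  by rewrite -mulrDr /rho divfK // gt_eqF.
exists rho => // x0 bx0 r rP a0 b0 Aa0 Bb0.
have x0b : `|xbar - x0| < rho by move: bx0; rewrite -ball_normE.
set m := Num.max _ _ => mr.
have rx : r < rho by apply: le_lt_trans (rP _ ABx) _; rewrite distrC.
have m_ge0 : 0 <= m by rewrite le_max normr_ge0.
have r0 : 0 < r by rewrite -(pmulr_rgt0 _ al0); exact: le_lt_trans m_ge0 mr.
have m0 : 0 < m.
  rewrite lt_neqAle m_ge0 andbT; apply/eqP => m0.
  have xa : `|x0 - a0| <= 0 by rewrite m0 le_max lexx.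
  have xb : `|x0 - b0| <= 0 by rewrite m0 le_max lexx orbT.
  move: xa xb; rewrite !normr_le0 !subr_eq0 => /eqP xa /eqP xb.
  have ABx0 : (A `&` B) x0 by split; [rewrite xa | rewrite xb].
  by have := rP _ ABx0; rewrite subrr normr0 leNgt r0.
have alb : 0 < alpha < beta by rewrite al0.
have g01 : 0 < gamma <= 1 by rewrite g0.
have [a [b [x [Aa Bb dist hmin]]]] := ekeland_pair Acl Bcl Aa0 Bb0 alb g01 m0.
have {dist} dist : `|x - x0| + gamma * (`|a - a0| + `|b - b0|) < r.
  by apply: le_lt_trans dist _; rewrite ltr_pdivrMr // mulrC.
have mrho : m < rho.
  apply: lt_trans mr _; apply: le_lt_trans rx; rewrite ler_piMl ?(ltW r0) //.
  exact: ltW (lt_trans ab be1).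
have [xx0 aa0 bb0] : [/\ `|x - x0| < r, `|a - a0| < rho / gamma &
    `|b - b0| < rho / gamma].
  have na : 0 <= gamma * `|a - a0| by rewrite mulr_ge0 // ltW.
  have nb : 0 <= gamma * `|b - b0| by rewrite mulr_ge0 // ltW.
  have nx := normr_ge0 (x - x0); rewrite mulrDr in dist.
  rewrite !(ltr_pdivlMr _ _ g0) ![_ * gamma]mulrC.
  by move: dist rx na nb nx; clear; move=> *; split; lra.
have inball y y0 : `|y - y0| < rho / gamma -> `|x0 - y0| <= m ->
    ball xbar delta y.
  rewrite -ball_normE /= distrC => yy0 x0y0.
  have := ler_distD x0 xbar y; have := ler_distD y0 x0 y.
  by move: yy0 x0y0 mrho rhod x0b; clear; lra.
have ad : ball xbar delta a by apply: inball aa0 _; rewrite le_max lexx.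
have bd : ball xbar delta b by apply: inball bb0 _; rewrite le_max lexx orbT.
have xd : ball xbar delta x.
  rewrite -ball_normE /=; have := ler_distD x0 xbar x; rewrite (distrC x0 x).
  have : 0 < rho / gamma by rewrite divr_gt0.
  by move: xx0 rx rhod x0b; clear; lra.
have be01 : 0 <= beta < 1 by rewrite be1 ltW.
have eqd : `|x - a| = `|x - b|.
  apply/eqP; rewrite eq_le; apply/andP; split.
    apply: (ekeland_equidistant be01) => x'; have := hmin a b x' Aa Bb.
    by rewrite !subrr normr0 !addr0 mulr0 addr0.
  apply: (ekeland_equidistant be01) => x'; have := hmin a b x' Aa Bb.
  by rewrite !subrr normr0 !addr0 mulr0 addr0 ![Num.max _ `|_ - b|]maxC.
have mxE : Num.max `|x - a| `|x - b| = `|x - a| by rewrite -eqd maxxx.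
have xa0 : 0 < `|x - a|.
  rewrite lt_neqAle normr_ge0 andbT; apply/eqP => xa0.
  have xa : x = a by apply/eqP; rewrite -subr_eq0 -normr_eq0 -xa0.
  have xb : x = b by apply/eqP; rewrite -subr_eq0 -normr_eq0 -eqd -xa0.
  have ABxh : (A `&` B) x by split; [rewrite xa | rewrite xb].
  by have := rP _ ABxh; rewrite distrC leNgt xx0.
have dab : `|a - b| <= 2 * `|x - a|.
  have := ler_distD x a b; rewrite (distrC a x) -eqd.
  by clear; lra.
have small : beta * `|x - a| + beta * gamma * `|a - b| < `|x - a|.
  have h1 := ler_wpM2l (ltW bg0) dab.
  have h2 : beta * gamma * (2 * `|x - a|) <= (1 - beta) / 4 * (2 * `|x - a|).
    by rewrite ler_wpM2r ?mulr_ge0 // (le_trans bg).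
  have h3 : 0 < (1 - beta) * `|x - a| by rewrite mulr_gt0 // subr_gt0.
  by move: h1 h2 h3; clear; lra.
exists a, b, x; split=> //.
- split; last exact: ad.
  split; first exact: Aa.
  move=> Ba; have := hmin a a a Aa Ba.
  rewrite mxE !subrr normr0 maxxx !add0r (distrC a x).
  by move: small; clear; lra.
- split; last exact: bd.
  split; first exact: Bb.
  move=> Ab; have := hmin b b b Ab Bb.
  rewrite mxE !subrr normr0 maxxx add0r addr0 (distrC b x) -eqd (distrC b a).
  by move: small; clear; lra.
Qed.

(** The subtransversality inequality with constant [alpha'], the distance to the
intersection being replaced by its lower bounds and the distances to the two
sets by distances to their points. *)
Lemma subtransversal_below (R : realType) (X : completeNormedModType R)
    (A B : set X) (xbar : X) (alpha delta alpha' : R) :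
  asplund X -> closed A -> closed B -> (A `&` B) xbar ->
  0 < alpha < 1 -> 0 < delta ->
  (forall a b x : X,
    ((A `\` B) `&` ball xbar delta) a ->
    ((B `\` A) `&` ball xbar delta) b ->
    ball xbar delta x ->
    `|x - a| = `|x - b| ->
    exists2 eps : R, 0 < eps &
      forall (a' b' x1' x2' x' : X) (xs1 xs2 : dual X),
        (A `&` ball a eps) a' -> (B `&` ball b eps) b' ->
        ball a eps x1' -> ball b eps x2' -> ball x eps x' ->
        `|x' - x1'| = `|x' - x2'| ->
        `|xs1| + `|xs2| = 1 ->
        xs1 (x' - x1') = `|xs1| * `|x' - x1'| ->
        xs2 (x' - x2') = `|xs2| * `|x' - x2'| ->
        (edist_inf (frechet_normal_cone A a') xs1 < delta%:E)%E ->
        (edist_inf (frechet_normal_cone B b') xs2 < delta%:E)%E ->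
        alpha < `|xs1 + xs2|) ->
  0 < alpha' < alpha ->
  exists2 rho : R, 0 < rho & forall x, ball xbar rho x ->
    forall r, (forall c, (A `&` B) c -> r <= `|x - c|) ->
    forall a b, A a -> B b -> alpha' * r <= Num.max `|x - a| `|x - b|.
Proof.
move=> aX Acl Bcl ABx /andP[al0 al1] dl0 H /andP[al'0 al'a].
pose beta := (alpha' + alpha) / 2.
have al'b : alpha' < beta by rewrite /beta; lra.
have ba : beta < alpha by rewrite /beta; lra.
have be0 : 0 < beta by exact: lt_trans al'b.
have be1 : beta < 1 by exact: lt_trans al1.
pose gamma := Num.min (delta / 8) ((1 - beta) / 4).
have g0 : 0 < gamma by rewrite lt_min !divr_gt0 // subr_gt0.
have gd : gamma <= delta / 8 by rewrite ge_min lexx.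
have gb : gamma <= (1 - beta) / 4 by rewrite ge_min lexx orbT.
have bg : beta * gamma <= gamma by rewrite ler_piMl // ltW.
pose eta := Num.min (delta / 2) 1.
have keta : beta * gamma < eta by rewrite lt_min; apply/andP; split; lra.
have etad : eta < delta by rewrite /eta gt_min; apply/orP; left; lra.
have keta1 : beta * gamma < eta <= 1 by rewrite keta ge_min lexx orbT.
have k01 : 0 <= beta * gamma <= 1.
  by rewrite mulr_ge0 ?(ltW be0) ?(ltW g0) //=; lra.
have be01 : 0 <= beta <= 1 by rewrite !ltW.
have al'b0 : 0 < alpha' < beta by rewrite al'0.
have gb0 : 0 < gamma <= (1 - beta) / 4 by rewrite g0.
have [rho rho0 rhoP] := equidistant_pair Acl Bcl ABx al'b0 be1 gb0 dl0.
exists rho => // x0 x0b r rP a0 b0 Aa0 Bb0; rewrite leNgt; apply/negP => mr.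
have [ah [bh [xh [Aah Bbh xhd [eqd xa0] hmin]]]] := rhoP x0 x0b r rP a0 b0 Aa0 Bb0 mr.
have [eps eps0 epsP] := H ah bh xh Aah Bbh xhd eqd.
(* Within [|xh - ah| / 5] the points [x] and [x1] remain distinct. *)
pose e := Num.min eps (`|xh - ah| / 5).
have e0 : 0 < e by rewrite lt_min eps0 divr_gt0.
have ee : e <= eps by rewrite ge_min lexx.
have em : e <= `|xh - ah| / 5 by rewrite ge_min lexx orbT.
have [a [b [x1 [x2 [x [f1 [f2 [e1 [e2]]]]]]]]] :=
  fuzzy_normals aX Acl Bcl Aah.1.1 Bbh.1.1 be01 k01 hmin keta1 ba e0.
move=> [[Aa Bb aah bbh] [x1ah x2bh xxh] [fmax fu] [f12 e1b e2b] [nA nB]].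
have inball (u v : X) : `|u - v| < e -> ball v eps u.
  by rewrite -ball_normE /= distrC => uv; exact: lt_le_trans ee.
have u10 : 0 < `|x - x1|.
  have := ler_distD x xh ah; have := ler_distD x1 x ah; rewrite (distrC xh x).
  by move: x1ah xxh em xa0; clear; lra.
have max0 : 0 < Num.max `|x - x1| `|x - x2| by rewrite lt_max u10.
have [E1 E2 E3 E4] :=
  max_norm_subgradient fmax fu max0 (le_lt_trans f12 al1).
have dN (f g : dual X) (N : set (dual X)) : `|g| <= eta -> N (f + g) ->
    (edist_inf N f < delta%:E)%E.
  move=> ge Nfg; apply: (edist_inf_lt Nfg _ etad).
  by rewrite opprD addrA subrr add0r normrN.
have := epsP a b x1 x2 x f1 f2 (conj Aa (inball _ _ aah)) (conj Bb (inball _ _ bbh))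
  (inball _ _ x1ah) (inball _ _ x2bh) (inball _ _ xxh) E1 E2 E3 E4
  (dN _ _ _ e1b nA) (dN _ _ _ e2b nB).
by rewrite ltNge f12.
Qed.

Theorem theorem2 (R : realType) (X : completeNormedModType R)
  (A B : set X) (xbar : X) (alpha delta : R) :
  asplund X -> closed A -> closed B -> (A `&` B) xbar ->
  0 < alpha < 1 -> 0 < delta ->
  (forall a b x : X,
    ((A `\` B) `&` ball xbar delta) a ->
    ((B `\` A) `&` ball xbar delta) b ->
    ball xbar delta x ->
    `|x - a| = `|x - b| ->
    exists2 eps : R, 0 < eps &
      forall (a' b' x1' x2' x' : X) (xs1 xs2 : dual X),
        (A `&` ball a eps) a' -> (B `&` ball b eps) b' ->
        ball a eps x1' -> ball b eps x2' -> ball x eps x' ->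
        `|x' - x1'| = `|x' - x2'| ->
        `|xs1| + `|xs2| = 1 ->
        xs1 (x' - x1') = `|xs1| * `|x' - x1'| ->
        xs2 (x' - x2') = `|xs2| * `|x' - x2'| ->
        (edist_inf (frechet_normal_cone A a') xs1 < delta%:E)%E ->
        (edist_inf (frechet_normal_cone B b') xs2 < delta%:E)%E ->
        alpha < `|xs1 + xs2|) ->
  subtransversal A B xbar /\ alpha <= str A B xbar.
Proof.
move=> aX Acl Bcl ABx al01 dl0 H.
have rate alpha' : 0 < alpha' < alpha ->
    exists2 rho : R, 0 < rho & subtransversal_rate A B xbar alpha' rho.
  move=> al'; have [rho rho0 rhoP] := subtransversal_below aX Acl Bcl ABx al01 dl0 H al'.
  exists rho => // x xb.
  have D0 : (0 <= edist_inf (A `&` B) x)%E by exact: edist_inf_ge0.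
  have Dfin : edist_inf (A `&` B) x \is a fin_num.
    by rewrite ge0_fin_numE // (le_lt_trans (edist_inf_le x ABx)) // ltry.
  rewrite -(fineK Dfin) -EFinM leNgt; apply/negP.
  rewrite gt_max => /andP[/edist_inf_ltP[a Aa ax] /edist_inf_ltP[b Bb bx]].
  have := rhoP x xb (fine (edist_inf (A `&` B) x)) _ a b Aa Bb.
  rewrite leNgt gt_max ax bx /= => F; suff : false by []; apply: F => c ABc.
  by rewrite -lee_fin fineK //; exact: edist_inf_le.
have [al0 al1] := andP al01.
split.
  have h : 0 < alpha / 2 < alpha by apply/andP; split; lra.
  have [rho rho0 rhoP] := rate _ h.
  by exists (alpha / 2), rho; split=> //; apply/andP; split; lra.
rewrite leNgt; apply/negP => lt.
have ub : has_ubound [set alpha : R | 0 < alpha < 1 /\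
    exists2 delta : R, 0 < delta & subtransversal_rate A B xbar alpha delta].
  by exists 1 => t [/andP[_ t1] _]; exact: ltW.
pose s := Num.max (str A B xbar) (alpha / 2).
have sa : s < alpha by rewrite gt_max lt; lra.
pose t := (s + alpha) / 2.
have ts : s < t by rewrite /t; lra.
have ta : t < alpha by rewrite /t; lra.
have s2 : alpha / 2 <= s by rewrite le_max lexx orbT.
have h : 0 < t < alpha by apply/andP; split; lra.
have [rho rho0 rhoP] := rate _ h.
have : t <= str A B xbar.
  apply: ub_le_sup => //; split; last by exists rho.
  by apply/andP; split; lra.
have : str A B xbar <= s by rewrite le_max lexx.
by lra.
Qed.
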